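(* Let $u\in C^\infty(\overline{\mathbb D})$ be a real-valued solution of $$-\Delta u=e^{2u}\ \text{ in }\mathbb D,\qquad \frac{\partial u}{\partial \nu}+1=e^{u}\ \text{ on }\mathbb S^1. \qquad (P_1)$$ Then there exists $\psi\in\operatorname{Aut}(\mathbb D)$ such that $$u(z)=\log\frac{2R|\psi'(z)|}{1+R^2|\psi(z)|^2},\qquad R=\sqrt2-1. \qquad ( * )$$ Conversely, for every $\psi\in\operatorname{Aut}(\mathbb D)$, the function defined by $( * )$ is a solution of $(P_1)$. Moreover, $\psi$ is unique up to a rotation: if $\psi_1,\psi_2\in\operatorname{Aut}(\mathbb D)$ determine the same function $u$ via $( * )$, then $\psi_2=e^{i\theta}\psi_1$ for some $\theta\in\mathbb R$.
   Context: $\mathbb D=\{z\in\mathbb C:|z|<1\}$ is the open unit disk, $\mathbb S^1=\partial\mathbb D$, $\nu$ is the outer unit normal on $\mathbb S^1$, and $\Delta$ is the Euclidean Laplacian. $C^\infty(\overline{\mathbb D})$ denotes functions smooth up to the boundary. $\operatorname{Aut}(\mathbb D)$ is the group of biholomorphic maps $\psi:\mathbb D\to\mathbb D$ (each extends holomorphically to a neighborhood of $\overline{\mathbb D}$). *)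

(* Defs.v *)
(* Stdlib reals and Coquelicot; the complex plane is Coquelicot's [C] = R * R. *)
From Stdlib Require Import Reals List.
From Coquelicot Require Import Coquelicot.
Open Scope R_scope.

Definition disk (z : C) : Prop := Cmod z < 1.
Definition closed_disk (z : C) : Prop := Cmod z <= 1.
Definition circle (z : C) : Prop := Cmod z = 1.

Inductive axis : Set := X_axis | Y_axis.

(* The restriction of [f] to the line through [z] parallel to an axis,
   parametrized by the coordinate itself. *)
Definition slice (a : axis) (f : C -> R) (z : C) : R -> R :=
  match a with
  | X_axis => fun t => f (t, Im z)
  | Y_axis => fun t => f (Re z, t)
  end.

Definition coord (a : axis) (z : C) : R :=
  match a with X_axis => Re z | Y_axis => Im z end.

Definition ex_partial (a : axis) (f : C -> R) (z : C) : Prop :=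
  ex_derive (slice a f z) (coord a z).

Definition partial (a : axis) (f : C -> R) (z : C) : R :=
  Derive (slice a f z) (coord a z).

Definition partials (w : list axis) (f : C -> R) : C -> R :=
  fold_right partial f w.

(* C^infty of the closed disk: the iterated partial derivatives of all orders,
   in any order of differentiation, exist in the open disk and extend
   continuously to the closed disk.  The values of [u] outside the closed disk
   are irrelevant; those on the circle are fixed by continuity. *)
Definition smooth_up_to_boundary (u : C -> R) : Prop :=
  continuous_on closed_disk u /\
  forall w : list axis,
    (forall (a : axis) (z : C), disk z -> ex_partial a (partials w u) z) /\
    (exists g : C -> R, continuous_on closed_disk g /\
       forall z : C, disk z -> partials w u z = g z).

Definition laplacian (u : C -> R) (z : C) : R :=
  partial X_axis (partial X_axis u) z + partial Y_axis (partial Y_axis u) z.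

(* At a point [z] of the unit circle the outer unit normal is [z]; since [u]
   lives on the closed disk, the derivative is taken from the inside (h < 0). *)
Definition is_normal_derivative (u : C -> R) (z : C) (l : R) : Prop :=
  filterlim (fun h : R => (u (RtoC (1 + h) * z)%C - u z) / h)
    (at_left 0) (locally l).

Definition is_solution (u : C -> R) : Prop :=
  smooth_up_to_boundary u /\
  (forall z : C, disk z -> - laplacian u z = exp (2 * u z)) /\
  (forall z : C, circle z ->
     exists l : R, is_normal_derivative u z l /\ l + 1 = exp (u z)).

Definition holomorphic_on (U : C -> Prop) (f : C -> C) : Prop :=
  forall z : C, U z -> ex_derive f z.

(* Only the restriction of [psi] to the open disk matters. *)
Definition disk_automorphism (psi : C -> C) : Prop :=
  (forall z : C, disk z -> disk (psi z)) /\
  holomorphic_on disk psi /\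
  exists phi : C -> C,
    (forall z : C, disk z -> disk (phi z)) /\
    holomorphic_on disk phi /\
    (forall z : C, disk z -> phi (psi z) = z) /\
    (forall z : C, disk z -> psi (phi z) = z).

Definition holomorphic_extension (psi Psi : C -> C) : Prop :=
  exists U : C -> Prop,
    open U /\ (forall z : C, closed_disk z -> U z) /\
    holomorphic_on U Psi /\
    (forall z : C, disk z -> Psi z = psi z).

Definition radius : R := sqrt 2 - 1.

Definition bubble (psi : C -> C) (z : C) : R :=
  ln (2 * radius * Cmod (C_derive psi z) /
      (1 + radius ^ 2 * Cmod (psi z) ^ 2)).

(* [u] is given on the whole closed disk by the formula, in which [psi] and its
   derivative are read on the circle through the holomorphic extension. *)
Definition given_by (psi : C -> C) (u : C -> R) : Prop :=
  exists Psi : C -> C, holomorphic_extension psi Psi /\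
    forall z : C, closed_disk z -> u z = bubble Psi z.

(* Main.v *)
(* Uniqueness for (P_1).  The function 4 z^2 (u_zz - u_z^2) is holomorphic because
   -Delta u = e^{2u}, and the boundary condition says exactly that it is real on the
   unit circle; by the maximum principle it is a real constant, which is its value 0 at
   the origin.  Hence (e^{-u})_zz = 0, so e^{-u} is a real polynomial
   A |z|^2 + B x + C y + D.  The equation and the boundary condition become
   4 A D - B^2 - C^2 = 1 and D - A = 1, and these polynomials are precisely
   (|1 - conj a z|^2 + R^2 |z - a|^2) / (2 R (1 - |a|^2)) with |a| < 1, that is, e^{-u} for
   psi the Mobius map (z - a) / (1 - conj a z).

   The converse needs that every automorphism of the disk is such a Mobius map up to a
   rotation, hence the Schwarz lemma for functions which are only assumed to be complex
   differentiable.  Goursat's subdivision argument gives a local primitive U of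
   P dx - Q dy when P + i Q is holomorphic; difference quotients of U have zero
   Laplacian and converge uniformly to P, which is all that the maximum principle
   requires. *)
Require Import Defs.
From Stdlib Require Import Reals List Lra Psatz Classical ClassicalEpsilon.
From Coquelicot Require Import Coquelicot.
Open Scope R_scope.

(** * Maxima and differentiability in the plane *)

(** The boundary condition is of first order, while the imaginary part of [4 z^2 (u_zz - u_z^2)] is
    of second order; on the circle it is reached by differentiating the condition in the tangential
    direction. Since [u] has derivatives only inside the disk, and these have continuous extensions,
    every statement on the circle is a limit of mean value estimates along radii or along smaller
    concentric circles.

    One maximum principle serves both halves: the real part of a once differentiable holomorphic
    function, plus a term [S] whose Laplacian has a positive lower bound, has no interior maximum.
    For the classification of solutions [S] is a multiple of [|z|^2]; for the Schwarz lemma a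
    logarithm is added to it.

    The value of [R] comes from the boundary condition: for the identity map
    [e^{-u} = (1 + R^2 |z|^2) / (2 R)], so [D - A = (1 - R^2) / (2 R)], which is 1 exactly when
    [R^2 + 2 R = 1]. The other automorphisms give the same difference [D - A]. *)

Lemma finite_argmax (A : Type) (f : A -> R) (l : list A) :
  l <> nil -> exists m, In m l /\ forall x, In x l -> f x <= f m.
Proof.
  induction l as [|a l IH]; [congruence|intros _].
  destruct l as [|b l'].
  - exists a. split; [now left|]. intros x [->|[]]. lra.
  - destruct IH as [m [Hm Hmax]]; [congruence|].
    destruct (Rle_dec (f a) (f m)) as [H|H].
    + exists m. split; [now right|]. intros x [<-|Hx]; auto.
    + exists a. split; [now left|]. intros x [<-|Hx]; [lra|].
      specialize (Hmax x Hx). lra.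
Qed.

(* If no point of [K] is a maximum, each [p] in [K] has a neighbourhood on which
   [f] stays below [f q] for some [q] in [K]; the best of the finitely many [q]
   of a subcover beats itself. *)
Lemma compact_argmax (f : C -> R) (K : C -> Prop) (r : R) (z0 : C) :
  K z0 ->
  (forall z, K z -> Rabs (fst z) <= r /\ Rabs (snd z) <= r) ->
  (forall z, ~ K z -> locally z (fun w => ~ K w)) ->
  continuous_on K f ->
  exists m, K m /\ forall z, K z -> f z <= f m.
Proof.
  intros Kz0 Hr Kc fc. apply NNPP. intros Hno.
  assert (Hbig : forall p, K p -> exists q, K q /\ f p < f q).
  { intros p Kp. apply NNPP. intros H. apply Hno. exists p. split; auto.
    intros z Kz. apply Rnot_lt_le. intros Hlt. apply H. now exists z. }
  assert (Hloc : forall p : C, exists dq : posreal * C, K (snd dq) /\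
    forall w : C, Rabs (fst w - fst p) < fst dq -> Rabs (snd w - snd p) < fst dq ->
      K w -> f w < f (snd dq)).
  { intros p. destruct (classic (K p)) as [Kp|nKp].
    - destruct (Hbig p Kp) as [q [Kq Hq]].
      specialize (fc p Kp (fun y => y < f q)).
      destruct fc as [d Hd].
      + apply (open_lt (f q) (f p) Hq).
      + exists (d, q). split; [exact Kq|]. simpl. intros w H1 H2 Kw.
        apply Hd; auto. now split.
    (* Off [K] the neighbourhood misses [K], so any point of [K] can serve as the second component.
       These neighbourhoods are needed because the cover is taken of a whole square containing
       [K]. *)
    - destruct (Kc p nKp) as [d Hd]. exists (d, z0). split; [exact Kz0|].
      simpl. intros w H1 H2 Kw. exfalso. apply (Hd w); auto. now split. }
  pose (sel := fun p => proj1_sig (constructive_indefinite_description _ (Hloc p))).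
  assert (Hsel : forall p, K (snd (sel p)) /\
    forall w : C, Rabs (fst w - fst p) < fst (sel p) -> Rabs (snd w - snd p) < fst (sel p) ->
      K w -> f w < f (snd (sel p))).
  { intros p. exact (proj2_sig (constructive_indefinite_description _ (Hloc p))). }
  apply (@compactness_list 2 (-r, (-r, tt)) (r, (r, tt))
    (fun t => fst (sel (fst t, fst (snd t))))).
  intros [l Hl].
  assert (Hcov : forall z, K z -> exists t, In t l /\ f z < f (snd (sel (fst t, fst (snd t))))).
  { intros z Kz. destruct (Hr z Kz) as [h1 h2].
    apply Rabs_le_between in h1. apply Rabs_le_between in h2.
    destruct (Hl (fst z, (snd z, tt))) as [[t1 [t2 t3]] [Hin [_ Hc]]].
    { simpl. tauto. }
    exists (t1, (t2, t3)). split; auto. simpl in *. destruct Hc as [h3 [h4 _]].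
    apply (proj2 (Hsel (t1, t2))); auto. }
  destruct (finite_argmax _ (fun t => f (snd (sel (fst t, fst (snd t))))) l) as [m [Hm Hmax]].
  { destruct (Hcov z0 Kz0) as [t [Ht _]]. destruct l; [easy|congruence]. }
  destruct (Hcov (snd (sel (fst m, fst (snd m))))) as [t [Ht Hlt]].
  { apply Hsel. }
  specialize (Hmax t Ht). simpl in Hmax. lra.
Qed.

(** At the maximum [f'] vanishes, so [l > 0] would make [f'] positive immediately to the right of
    [x], and [f] would exceed [f x] there. *)
Lemma second_derivative_at_max (f f' : R -> R) (x l d : R) :
  0 < d ->
  (forall t, Rabs (t - x) < d -> is_derive f t (f' t)) ->
  is_derive f' x l ->
  (forall t, Rabs (t - x) < d -> f t <= f x) -> l <= 0.
Proof.
  intros Hd Hf Hf' Hmax. apply Rnot_lt_le. intros Hl.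
  assert (H0 : f' x = 0).
  { assert (pr : derivable_pt f x).
    { exists (f' x). apply is_derive_Reals. apply Hf. rewrite Rminus_eq_0, Rabs_R0. lra. }
    rewrite <- (is_derive_unique f x (f' x)) by (apply Hf; rewrite Rminus_eq_0, Rabs_R0; lra).
    rewrite <- (Derive_Reals f x pr).
    apply (deriv_maximum f (x - d) (x + d) x pr); try lra.
    intros t h1 h2. apply Hmax. apply Rabs_def1; lra. }
  apply is_derive_Reals in Hf'. destruct (Hf' (l/2)) as [e He]; [lra|].
  set (s := Rmin (e/2) (d/2)).
  assert (Hs : 0 < s /\ s < e /\ s < d).
  { unfold s. pose proof (cond_pos e). repeat split.
    - apply Rmin_glb_lt; lra.
    - apply Rle_lt_trans with (e/2); [apply Rmin_l|lra].
    - apply Rle_lt_trans with (d/2); [apply Rmin_r|lra]. }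
  assert (Hpos : forall t, x < t <= x + s -> 0 < f' t).
  { intros t Ht. specialize (He (t - x)). rewrite H0 in He.
    replace (x + (t - x)) with t in He by ring.
    assert (h : Rabs ((f' t - 0) / (t - x) - l) < l / 2).
    { apply He; [lra|]. rewrite Rabs_pos_eq by lra. lra. }
    apply Rabs_def2 in h. destruct h as [_ h].
    assert (0 < (f' t - 0) / (t - x)) by lra.
    replace (f' t) with ((f' t - 0) / (t - x) * (t - x)) by (field; lra).
    apply Rmult_lt_0_compat; lra. }
  assert (MV : forall p q, x <= p -> p < q -> q <= x + s ->
    exists c, p <= c <= q /\ f q - f p = f' c * (q - p)).
  { intros p q h1 h2 h3. destruct (MVT_gen f p q f') as [c [Hc Heq]].
    - intros t Ht. rewrite Rmin_left, Rmax_right in Ht by lra. apply Hf.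
      apply Rabs_def1; lra.
    - intros t Ht. rewrite Rmin_left, Rmax_right in Ht by lra.
      apply derivable_continuous_pt. exists (f' t). apply is_derive_Reals. apply Hf.
      apply Rabs_def1; lra.
    - rewrite Rmin_left, Rmax_right in Hc by lra. now exists c. }
  (* The mean value point may be [x] itself, where [f'] is 0; the first half of the interval
     therefore gives only a weak increase, and the second half makes it strict. *)
  destruct (MV x (x + s/2)) as [c [Hc Ec]]; try lra.
  destruct (MV (x + s/2) (x + s)) as [k [Hk Ek]]; try lra.
  assert (0 <= f' c) by (destruct (Req_dec c x) as [->|]; [lra|apply Rlt_le, Hpos; lra]).
  assert (0 < f' k) by (apply Hpos; lra).
  assert (f (x + s) <= f x) by (apply Hmax; apply Rabs_def1; lra).
  nra.
Qed.

(** The increment is split at the corner [(x, v)] and the mean value theorem is applied on each leg;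
    continuity of [fx] and [fy] at the single point [(x, y)] controls both errors. *)
Lemma differentiable_of_partials (f fx fy : R -> R -> R) (x y : R) :
  locally_2d (fun u v => is_derive (fun t => f t v) u (fx u v)) x y ->
  locally_2d (fun u v => is_derive (fun t => f u t) v (fy u v)) x y ->
  continuity_2d_pt fx x y -> continuity_2d_pt fy x y ->
  differentiable_pt_lim f x y (fx x y) (fy x y).
Proof.
  intros [d1 H1] [d2 H2] Cx Cy eps.
  destruct (Cx (pos_div_2 eps)) as [d3 H3].
  destruct (Cy (pos_div_2 eps)) as [d4 H4]. simpl in *.
  assert (Hd : 0 < Rmin (Rmin d1 d2) (Rmin d3 d4)).
  { repeat apply Rmin_glb_lt; apply cond_pos. }
  exists (mkposreal _ Hd). simpl. intros u v Hu Hv.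
  assert (Hm : forall e, e < Rmin (Rmin d1 d2) (Rmin d3 d4) -> e < d1 /\ e < d2 /\ e < d3 /\ e < d4).
  { intros e He. apply Rmin_Rgt_l in He. destruct He as [He He'].
    apply Rmin_Rgt_l in He. apply Rmin_Rgt_l in He'. lra. }
  assert (Hbet : forall p q t e, Rmin p q <= t <= Rmax p q -> Rabs (q - p) < e -> Rabs (t - p) < e).
  { intros p q t e Ht Hpq. apply Rle_lt_trans with (2 := Hpq).
    unfold Rmin, Rmax in Ht. destruct (Rle_dec p q); unfold Rabs;
    destruct (Rcase_abs (t - p)), (Rcase_abs (q - p)); lra. }
  destruct (MVT_gen (fun t => f t v) x u (fun t => fx t v)) as [c [Hc Ec]].
  { intros t Ht. apply H1; [|apply Hm; exact Hv].
    apply (Hbet x u); [lra|]. apply Hm; exact Hu. }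
  { intros t Ht. apply derivable_continuous_pt. exists (fx t v). apply is_derive_Reals.
    apply H1; [|apply Hm; exact Hv]. apply (Hbet x u); [lra|]. apply Hm; exact Hu. }
  destruct (MVT_gen (fun t => f x t) y v (fun t => fy x t)) as [e [He Ee]].
  { intros t Ht. apply H2. rewrite Rminus_eq_0, Rabs_R0. apply cond_pos.
    apply (Hbet y v); [lra|]. apply Hm; exact Hv. }
  { intros t Ht. apply derivable_continuous_pt. exists (fy x t). apply is_derive_Reals.
    apply H2. rewrite Rminus_eq_0, Rabs_R0. apply cond_pos.
    apply (Hbet y v); [lra|]. apply Hm; exact Hv. }
  replace (f u v - f x y - (fx x y * (u - x) + fy x y * (v - y)))
    with ((fx c v - fx x y) * (u - x) + (fy x e - fy x y) * (v - y)).
  2:{ replace (f u v - f x y) with ((f u v - f x v) + (f x v - f x y)) by ring.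
      rewrite Ec, Ee. ring. }
  assert (Bx : Rabs (fx c v - fx x y) < eps / 2).
  { apply H3; [|apply Hm; exact Hv]. apply (Hbet x u); [lra|]. apply Hm; exact Hu. }
  assert (By : Rabs (fy x e - fy x y) < eps / 2).
  { apply H4; [rewrite Rminus_eq_0, Rabs_R0; apply cond_pos|].
    apply (Hbet y v); [lra|]. apply Hm; exact Hv. }
  apply Rle_trans with (1 := Rabs_triang _ _). rewrite 2!Rabs_mult.
  set (M := Rmax (Rabs (u - x)) (Rabs (v - y))).
  assert (Rabs (u - x) <= M) by apply Rmax_l. assert (Rabs (v - y) <= M) by apply Rmax_r.
  pose proof (Rabs_pos (u - x)). pose proof (Rabs_pos (v - y)).
  apply Rle_trans with (eps / 2 * M + eps / 2 * M); [|lra].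
  apply Rplus_le_compat; apply Rmult_le_compat; try apply Rabs_pos; lra.
Qed.

Lemma differentiable_partial_x (f : R -> R -> R) (x y lx ly : R) :
  differentiable_pt_lim f x y lx ly -> is_derive (fun t => f t y) x lx.
Proof.
  intros H. apply is_derive_Reals.
  replace lx with (lx * 1 + ly * 0) by ring.
  apply (derivable_pt_lim_comp_2d f (fun t => t) (fun _ => y) x lx ly 1 0 H).
  apply derivable_pt_lim_id. apply derivable_pt_lim_const.
Qed.

Lemma differentiable_partial_y (f : R -> R -> R) (x y lx ly : R) :
  differentiable_pt_lim f x y lx ly -> is_derive (fun t => f x t) y ly.
Proof.
  intros H. apply is_derive_Reals.
  replace ly with (lx * 0 + ly * 1) by ring.
  apply (derivable_pt_lim_comp_2d f (fun _ => x) (fun t => t) y lx ly 0 1 H).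
  apply derivable_pt_lim_const. apply derivable_pt_lim_id.
Qed.

Lemma continuity_2d_slice_x (f : R -> R -> R) (x y : R) :
  continuity_2d_pt f x y -> continuous (fun t => f t y) x.
Proof.
  intros H. apply filterlim_locally. intros eps. destruct (H eps) as [d Hd].
  exists d. intros t Ht. apply Hd; [exact Ht|]. rewrite Rminus_eq_0, Rabs_R0. apply cond_pos.
Qed.

Lemma continuity_2d_slice_y (f : R -> R -> R) (x y : R) :
  continuity_2d_pt f x y -> continuous (fun t => f x t) y.
Proof.
  intros H. apply filterlim_locally. intros eps. destruct (H eps) as [d Hd].
  exists d. intros t Ht. apply Hd; [|exact Ht]. rewrite Rminus_eq_0, Rabs_R0. apply cond_pos.
Qed.

(** * Goursat's lemma and local primitives *)

(** A rectangle violating [Q] has a quarter violating [Q]. The nested bad rectangles shrink to a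
    point, and the local hypothesis at this point covers all sufficiently small ones. *)
Lemma quartering (Q : R -> R -> R -> R -> Prop) (a c L H : R) :
  0 < L -> 0 < H ->
  (forall a c l h, 0 < l -> 0 < h -> Q a c (l/2) (h/2) -> Q (a + l/2) c (l/2) (h/2) ->
     Q a (c + h/2) (l/2) (h/2) -> Q (a + l/2) (c + h/2) (l/2) (h/2) -> Q a c l h) ->
  (forall x y, a <= x <= a + L -> c <= y <= c + H -> exists d, 0 < d /\
     forall a' c' l h, a <= a' -> a' + l <= a + L -> c <= c' -> c' + h <= c + H ->
       a' <= x <= a' + l -> c' <= y <= c' + h -> 0 < l < d -> 0 < h < d -> Q a' c' l h) ->
  Q a c L H.
Proof.
  intros HL HH Hq Hloc. apply NNPP. intros Hno.
  pose (l := fun n => L / 2 ^ n). pose (h := fun n => H / 2 ^ n).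
  assert (lS : forall n, l (S n) = l n / 2).
  { intros n. unfold l. simpl. field. apply pow_nonzero. lra. }
  assert (hS : forall n, h (S n) = h n / 2).
  { intros n. unfold h. simpl. field. apply pow_nonzero. lra. }
  assert (lpos : forall n, 0 < l n).
  { intros n. unfold l. apply Rdiv_lt_0_compat; auto. apply pow_lt. lra. }
  assert (hpos : forall n, 0 < h n).
  { intros n. unfold h. apply Rdiv_lt_0_compat; auto. apply pow_lt. lra. }
  pose (bad := fun n (p : R * R) => ~ Q (fst p) (snd p) (l n) (h n)).
  (* The premise [bad n p] stands under the existential so that choice gives a total step function,
     which can be iterated. *)
  assert (Hstep : forall n (p : R * R), exists q : R * R, bad n p ->
    bad (S n) q /\ fst p <= fst q <= fst p + l (S n) /\ snd p <= snd q <= snd p + h (S n)).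
  { intros n [x y]. apply NNPP. intros Hn.
    assert (Hall : forall q : R * R, bad n (x, y) /\
      (x <= fst q <= x + l (S n) -> y <= snd q <= y + h (S n) -> Q (fst q) (snd q) (l (S n)) (h (S n)))).
    { intros q. assert (B : bad n (x, y)).
      { apply NNPP. intros B. apply Hn. exists (x, y). tauto. }
      split; [exact B|]. intros h1 h2. apply NNPP. intros B'. apply Hn. exists q.
      intros _. split; [exact B'|]. simpl. tauto. }
    destruct (Hall (x, y)) as [B _]. apply B. simpl.
    pose proof (lpos (S n)). pose proof (hpos (S n)).
    apply Hq; auto; rewrite <- lS, <- hS.
    - apply (Hall (x, y)); simpl; lra.
    - apply (Hall (x + l (S n), y)); simpl; lra.
    - apply (Hall (x, y + h (S n))); simpl; lra.
    - apply (Hall (x + l (S n), y + h (S n))); simpl; lra. }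
  pose (next := fun n p => proj1_sig (constructive_indefinite_description _ (Hstep n p))).
  pose (s := fix s n := match n with O => (a, c) | S n => next n (s n) end).
  assert (Hs : forall n, bad n (s n) /\ fst (s n) <= fst (s (S n)) <= fst (s n) + l (S n) /\
    snd (s n) <= snd (s (S n)) <= snd (s n) + h (S n)).
  { assert (Hn : forall n, bad n (s n) -> bad (S n) (s (S n)) /\
      fst (s n) <= fst (s (S n)) <= fst (s n) + l (S n) /\
      snd (s n) <= snd (s (S n)) <= snd (s n) + h (S n)).
    { intros n. exact (proj2_sig (constructive_indefinite_description _ (Hstep n (s n)))). }
    assert (Hb : forall n, bad n (s n)).
    { induction n as [|n IH]; [|now apply Hn].
      unfold bad, l, h. simpl. now replace (L / 1) with L by field; replace (H / 1) with H by field. }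
    intros n. split; [apply Hb|]. now apply Hn. }
  (* Nested intervals with halving lengths: the supremum of the left ends lies in all of them. It is
     applied to each coordinate. *)
  assert (lim1 : forall (u k : nat -> R), (forall n, 0 < k n) -> (forall n, k (S n) = k n / 2) ->
    (forall n, u n <= u (S n) <= u n + k (S n)) -> exists x, forall n, u n <= x <= u n + k n).
  { intros u k kp kS Hu.
    assert (Hd : forall n m, u n <= u (n + m)%nat /\ u (n + m)%nat + k (n + m)%nat <= u n + k n).
    { intros n m. induction m as [|m IH].
      - rewrite Nat.add_0_r. lra.
      - rewrite Nat.add_succ_r. specialize (Hu (n + m)%nat). pose proof (kS (n + m)%nat). lra. }
    assert (Hub : forall n m, u m <= u n + k n).
    { intros n m. destruct (Nat.le_ge_cases n m) as [Hle|Hle].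
      - destruct (Hd n (m - n)%nat) as [_ h2]. replace (n + (m - n))%nat with m in h2 by lia.
        specialize (kp m). lra.
      - destruct (Hd m (n - m)%nat) as [h1 _]. replace (m + (n - m))%nat with n in h1 by lia.
        specialize (kp n). lra. }
    destruct (completeness (fun x => exists n, x = u n)) as [x [hx1 hx2]].
    - exists (u O + k O). intros x [n ->]. apply Hub.
    - exists (u O). now exists O.
    - exists x. intros n. split.
      + apply hx1. now exists n.
      + apply hx2. intros y [m ->]. apply Hub. }
  destruct (lim1 (fun n => fst (s n)) l lpos lS) as [x Hx]; [intros n; apply Hs|].
  destruct (lim1 (fun n => snd (s n)) h hpos hS) as [y Hy]; [intros n; apply Hs|].
  assert (Hin : forall n, a <= fst (s n) /\ fst (s n) + l n <= a + L /\
    c <= snd (s n) /\ snd (s n) + h n <= c + H).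
  { induction n as [|n IH].
    - simpl. unfold l, h. simpl. lra.
    - pose proof (proj2 (Hs n)). pose proof (lS n). pose proof (hS n). lra. }
  destruct (Hloc x y) as [d [Hd HQ]].
  { specialize (Hx O). specialize (Hin O). lra. }
  { specialize (Hy O). specialize (Hin O). lra. }
  assert (Hsmall : exists n, l n < d /\ h n < d).
  { destruct (pow_lt_1_zero (1/2) ltac:(rewrite Rabs_pos_eq; lra) (d / (L + H))) as [n Hn].
    - apply Rdiv_lt_0_compat; lra.
    - exists n. specialize (Hn n (Nat.le_refl n)).
      assert (Hp : 0 < (1/2) ^ n) by (apply pow_lt; lra).
      rewrite Rabs_pos_eq in Hn by lra.
      assert (E : (1 / 2) ^ n = / 2 ^ n) by (rewrite <- pow_inv; f_equal; lra).
      assert (K : (L + H) * (1 / 2) ^ n < d).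
      { apply Rmult_lt_compat_l with (r := L + H) in Hn; [|lra].
        replace ((L + H) * (d / (L + H))) with d in Hn by (field; lra). exact Hn. }
      unfold l, h, Rdiv. rewrite <- E. nra. }
  destruct Hsmall as [n [Hl Hh]].
  apply (proj1 (Hs n)). specialize (Hin n).
  apply HQ; try tauto; try (split; auto); try apply Hx; try apply Hy.
Qed.

(** Circulation of [A dx + B dy], counterclockwise, around the rectangle with lower left corner
    [(a, c)] and sides [l], [h]. *)
Definition rect_integral (A B : R -> R -> R) (a c l h : R) : R :=
  RInt (fun x => A x c) a (a + l) + RInt (fun y => B (a + l) y) c (c + h)
  - RInt (fun x => A x (c + h)) a (a + l) - RInt (fun y => B a y) c (c + h).

(** Pointwise closedness of [A dx + B dy]: the shared [m] is both [A_y] and [B_x]. Continuity of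
    these derivatives is not assumed, so the theorem of Green does not apply. *)
Definition closed_form_at (A B : R -> R -> R) (x y : R) : Prop :=
  exists ax m b_y, differentiable_pt_lim A x y ax m /\ differentiable_pt_lim B x y m b_y.

Lemma differentiable_lim_continuity (f : R -> R -> R) (x y lx ly : R) :
  differentiable_pt_lim f x y lx ly -> continuity_2d_pt f x y.
Proof. intros H. apply differentiable_continuity_pt. now exists lx, ly. Qed.

Lemma closed_form_continuity (A B : R -> R -> R) (x y : R) :
  closed_form_at A B x y -> continuity_2d_pt A x y /\ continuity_2d_pt B x y.
Proof.
  intros (ax & m & b_y & HA & HB). split; eapply differentiable_lim_continuity; eassumption.
Qed.

(** For every [eps] the circulation is at most [eps * (L ^ 2 + H ^ 2)]: circulations add under
    quartering, and so do these bounds. Near a point the linear parts of [A] and [B] contribute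
    [- m l h] and [m l h], which cancel, and only the differentiability error is left. *)
Lemma goursat (A B : R -> R -> R) (a c L H : R) :
  0 < L -> 0 < H ->
  (forall x y, a <= x <= a + L -> c <= y <= c + H -> closed_form_at A B x y) ->
  rect_integral A B a c L H = 0.
Proof.
  intros HL HH HF.
  assert (EA : forall p q y, a <= p <= q -> q <= a + L -> c <= y <= c + H ->
    ex_RInt (fun x => A x y) p q).
  { intros p q y h1 h2 h3. apply (@ex_RInt_continuous R_CompleteNormedModule). intros z Hz.
    rewrite Rmin_left, Rmax_right in Hz by lra.
    apply continuity_2d_slice_x, (closed_form_continuity A B). apply HF; lra. }
  assert (EB : forall p q x, c <= p <= q -> q <= c + H -> a <= x <= a + L ->
    ex_RInt (fun y => B x y) p q).
  { intros p q x h1 h2 h3. apply (@ex_RInt_continuous R_CompleteNormedModule). intros z Hz.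
    rewrite Rmin_left, Rmax_right in Hz by lra.
    apply continuity_2d_slice_y, (closed_form_continuity A B). apply HF; lra. }
  assert (Hall : forall eps, 0 < eps -> Rabs (rect_integral A B a c L H) <= eps * (L ^ 2 + H ^ 2)).
  { intros eps Heps.
    set (Q := fun a' c' l h => a <= a' -> a' + l <= a + L -> c <= c' -> c' + h <= c + H ->
      Rabs (rect_integral A B a' c' l h) <= eps * (l ^ 2 + h ^ 2)).
    assert (HQ : Q a c L H); [|apply HQ; lra].
    apply quartering; auto; unfold Q.
    - intros a' c' l h Hl Hh Q1 Q2 Q3 Q4 h1 h2 h3 h4.
      specialize (Q1 ltac:(lra) ltac:(lra) ltac:(lra) ltac:(lra)).
      specialize (Q2 ltac:(lra) ltac:(lra) ltac:(lra) ltac:(lra)).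
      specialize (Q3 ltac:(lra) ltac:(lra) ltac:(lra) ltac:(lra)).
      specialize (Q4 ltac:(lra) ltac:(lra) ltac:(lra) ltac:(lra)).
      assert (E : rect_integral A B a' c' l h =
        rect_integral A B a' c' (l/2) (h/2) + rect_integral A B (a' + l/2) c' (l/2) (h/2) +
        rect_integral A B a' (c' + h/2) (l/2) (h/2) +
        rect_integral A B (a' + l/2) (c' + h/2) (l/2) (h/2)).
      { unfold rect_integral.
        replace (a' + l/2 + l/2) with (a' + l) by field.
        replace (c' + h/2 + h/2) with (c' + h) by field.
        assert (CA : forall y, c' <= y <= c' + h -> RInt (fun x => A x y) a' (a' + l) =
          RInt (fun x => A x y) a' (a' + l/2) + RInt (fun x => A x y) (a' + l/2) (a' + l)).
        { intros y Hy. symmetry. apply (RInt_Chasles (V := R_CompleteNormedModule)); apply EA; lra. }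
        assert (CB : forall x, a' <= x <= a' + l -> RInt (fun y => B x y) c' (c' + h) =
          RInt (fun y => B x y) c' (c' + h/2) + RInt (fun y => B x y) (c' + h/2) (c' + h)).
        { intros x Hx. symmetry. apply (RInt_Chasles (V := R_CompleteNormedModule)); apply EB; lra. }
        rewrite (CA c'), (CA (c' + h)), (CB a'), (CB (a' + l)) by lra. ring. }
      rewrite E.
      apply Rabs_le_between in Q1. apply Rabs_le_between in Q2.
      apply Rabs_le_between in Q3. apply Rabs_le_between in Q4.
      apply Rabs_le. lra.
    - intros x y Hx Hy. destruct (HF x y Hx Hy) as (ax & m & b_y & HA & HB).
      (* Each difference across the rectangle uses the estimate twice, hence has error
         [eps / 2 * (l + h)]; integrating over both directions gives [eps / 2 * (l + h) ^ 2 <= eps *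
         (l ^ 2 + h ^ 2)]. *)
      assert (He : 0 < eps / 4) by lra.
      destruct (HA (mkposreal _ He)) as [d1 D1].
      destruct (HB (mkposreal _ He)) as [d2 D2]. simpl in *.
      exists (Rmin d1 d2). split; [apply Rmin_glb_lt; apply cond_pos|].
      intros a' c' l h h1 h2 h3 h4 hx hy [hl hl'] [hh hh'] _ _ _ _.
      apply Rmin_Rgt_l in hl'. apply Rmin_Rgt_l in hh'.
      assert (BA : forall u, a' < u < a' + l ->
        - (m * h) - eps / 2 * (l + h) <= A u c' - A u (c' + h) <= - (m * h) + eps / 2 * (l + h)).
      { intros u Hu.
        assert (G : forall v, c' <= v <= c' + h ->
          Rabs (A u v - A x y - (ax * (u - x) + m * (v - y))) <= eps / 4 * (l + h)).
        { intros v Hv. eapply Rle_trans.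
          - apply D1; apply Rabs_def1; lra.
          - apply Rmult_le_compat_l; [lra|]. apply Rmax_lub; apply Rabs_le; lra. }
        pose proof (G c' ltac:(lra)) as G1. pose proof (G (c' + h) ltac:(lra)) as G2.
        apply Rabs_le_between in G1. apply Rabs_le_between in G2. lra. }
      assert (BB : forall v, c' < v < c' + h ->
        (m * l) - eps / 2 * (l + h) <= B (a' + l) v - B a' v <= m * l + eps / 2 * (l + h)).
      { intros v Hv.
        assert (G : forall u, a' <= u <= a' + l ->
          Rabs (B u v - B x y - (m * (u - x) + b_y * (v - y))) <= eps / 4 * (l + h)).
        { intros u Hu. eapply Rle_trans.
          - apply D2; apply Rabs_def1; lra.
          - apply Rmult_le_compat_l; [lra|]. apply Rmax_lub; apply Rabs_le; lra. }
        pose proof (G a' ltac:(lra)) as G1. pose proof (G (a' + l) ltac:(lra)) as G2.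
        apply Rabs_le_between in G1. apply Rabs_le_between in G2. lra. }
      assert (E : rect_integral A B a' c' l h =
        RInt (fun u => A u c' - A u (c' + h)) a' (a' + l) +
        RInt (fun v => B (a' + l) v - B a' v) c' (c' + h)).
      { unfold rect_integral.
        rewrite (RInt_minus (V := R_CompleteNormedModule) (fun u => A u c')) by (apply EA; lra).
        rewrite (RInt_minus (V := R_CompleteNormedModule) (fun v => B (a' + l) v)) by (apply EB; lra).
        unfold minus, plus, opp; simpl. change (RInt (B a')) with (RInt (fun y => B a' y)). ring. }
      assert (IC : forall k p q, RInt (fun _ : R => k) p q = (q - p) * k).
      { intros. rewrite RInt_const. reflexivity. }
      assert (XA : ex_RInt (fun u => A u c' - A u (c' + h)) a' (a' + l)).
      { apply (@ex_RInt_minus R_NormedModule); apply EA; lra. }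
      assert (XB : ex_RInt (fun v => B (a' + l) v - B a' v) c' (c' + h)).
      { apply (@ex_RInt_minus R_NormedModule); apply EB; lra. }
      assert (I1 : RInt (fun _ => - (m * h) - eps / 2 * (l + h)) a' (a' + l) <=
        RInt (fun u => A u c' - A u (c' + h)) a' (a' + l)).
      { apply RInt_le; [lra|apply ex_RInt_const|exact XA|]. intros u Hu. now apply BA. }
      assert (I2 : RInt (fun u => A u c' - A u (c' + h)) a' (a' + l) <=
        RInt (fun _ => - (m * h) + eps / 2 * (l + h)) a' (a' + l)).
      { apply RInt_le; [lra|exact XA|apply ex_RInt_const|]. intros u Hu. now apply BA. }
      assert (I3 : RInt (fun _ => m * l - eps / 2 * (l + h)) c' (c' + h) <=
        RInt (fun v => B (a' + l) v - B a' v) c' (c' + h)).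
      { apply RInt_le; [lra|apply ex_RInt_const|exact XB|]. intros u Hu. now apply BB. }
      assert (I4 : RInt (fun v => B (a' + l) v - B a' v) c' (c' + h) <=
        RInt (fun _ => m * l + eps / 2 * (l + h)) c' (c' + h)).
      { apply RInt_le; [lra|exact XB|apply ex_RInt_const|]. intros u Hu. now apply BB. }
      rewrite IC in I1, I2, I3, I4. rewrite E. apply Rabs_le.
      assert (eps / 2 * (l + h) * (l + h) <= eps * (l ^ 2 + h ^ 2)).
      { pose proof (pow2_ge_0 (l - h)). nra. }
      split; nra. }
  destruct (Req_dec (rect_integral A B a c L H) 0) as [E|E]; [exact E|exfalso].
  apply Rabs_pos_lt in E.
  assert (HLH : 0 < L ^ 2 + H ^ 2) by nra.
  specialize (Hall (Rabs (rect_integral A B a c L H) / (2 * (L ^ 2 + H ^ 2)))).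
  replace (Rabs (rect_integral A B a c L H) / (2 * (L ^ 2 + H ^ 2)) * (L ^ 2 + H ^ 2))
    with (Rabs (rect_integral A B a c L H) / 2) in Hall by (field; lra).
  assert (0 < Rabs (rect_integral A B a c L H) / (2 * (L ^ 2 + H ^ 2))).
  { apply Rdiv_lt_0_compat; lra. }
  lra.
Qed.

(** Integrating along the bottom and then upwards makes the [y]-derivative evident. For the
    [x]-derivative, [goursat] exchanges this path for the one that goes up the left side and then
    across. *)
Lemma closed_form_exact (A B : R -> R -> R) (a c L H : R) :
  0 < L -> 0 < H ->
  (forall x y, a <= x <= a + L -> c <= y <= c + H -> closed_form_at A B x y) ->
  exists U : R -> R -> R, forall x y, a < x < a + L -> c < y < c + H ->
    is_derive (fun t => U t y) x (A x y) /\ is_derive (fun t => U x t) y (B x y).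
Proof.
  intros HL HH HF.
  exists (fun x y => RInt (fun t => A t c) a x + RInt (fun s => B x s) c y).
  intros x y Hx Hy. 
  assert (CA : forall x y, a <= x <= a + L -> c <= y <= c + H -> continuous (fun t => A t y) x).
  { intros u v Hu Hv. apply continuity_2d_slice_x, (closed_form_continuity A B). now apply HF. }
  assert (CB : forall x y, a <= x <= a + L -> c <= y <= c + H -> continuous (fun t => B x t) y).
  { intros u v Hu Hv. apply continuity_2d_slice_y, (closed_form_continuity A B). now apply HF. }
  assert (IA : forall u v, a < u < a + L -> c <= v <= c + H ->
    is_derive (fun t => RInt (fun s => A s v) a t) u (A u v)).
  { intros u v Hu Hv. apply (is_derive_RInt (V := R_CompleteNormedModule) (fun s => A s v) _ a); [|apply CA; lra].
    assert (Hd : 0 < Rmin (u - a) (a + L - u)) by (apply Rmin_glb_lt; lra).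
    exists (mkposreal _ Hd). intros t Ht. apply Rabs_def2 in Ht. simpl in Ht.
    pose proof (Rmin_l (u - a) (a + L - u)). pose proof (Rmin_r (u - a) (a + L - u)).
    unfold minus, plus, opp in Ht; simpl in Ht.
    apply (@RInt_correct R_CompleteNormedModule), (@ex_RInt_continuous R_CompleteNormedModule).
    intros z Hz. rewrite Rmin_left, Rmax_right in Hz by lra. apply CA; lra. }
  assert (IB : forall u v, a <= u <= a + L -> c < v < c + H ->
    is_derive (fun t => RInt (fun s => B u s) c t) v (B u v)).
  { intros u v Hu Hv. apply (is_derive_RInt (V := R_CompleteNormedModule) (fun s => B u s) _ c); [|apply CB; lra].
    assert (Hd : 0 < Rmin (v - c) (c + H - v)) by (apply Rmin_glb_lt; lra).
    exists (mkposreal _ Hd). intros t Ht. apply Rabs_def2 in Ht. simpl in Ht.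
    pose proof (Rmin_l (v - c) (c + H - v)). pose proof (Rmin_r (v - c) (c + H - v)).
    unfold minus, plus, opp in Ht; simpl in Ht.
    apply (@RInt_correct R_CompleteNormedModule), (@ex_RInt_continuous R_CompleteNormedModule).
    intros z Hz. rewrite Rmin_left, Rmax_right in Hz by lra. apply CB; lra. }
  split.
  - apply is_derive_ext_loc with
      (fun t => RInt (fun s => B a s) c y + RInt (fun s => A s y) a t).
    + assert (Hd : 0 < Rmin (x - a) (a + L - x)) by (apply Rmin_glb_lt; lra).
      exists (mkposreal _ Hd). intros t Ht. apply Rabs_def2 in Ht. simpl in Ht.
      pose proof (Rmin_l (x - a) (a + L - x)). pose proof (Rmin_r (x - a) (a + L - x)).
      unfold minus, plus, opp in Ht; simpl in Ht.
      assert (G : rect_integral A B a c (t - a) (y - c) = 0).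
      { apply goursat; try lra. intros u v Hu Hv. apply HF; lra. }
      unfold rect_integral in G.
      assert (E : forall p q : R, p + (q - p) = q) by (intros; ring).
      rewrite !E in G. lra.
    + rewrite <- (Rplus_0_l (A x y)). apply (is_derive_plus (V := R_NormedModule)).
      * apply (is_derive_const (V := R_NormedModule)).
      * apply IA; lra.
  - rewrite <- (Rplus_0_l (B x y)). apply (is_derive_plus (V := R_NormedModule)).
    + apply (is_derive_const (V := R_NormedModule)).
    + apply IB; lra.
Qed.

(** * The maximum principle *)

Definition cauchy_riemann_at (P Q : R -> R -> R) (x y : R) : Prop :=
  exists px py, differentiable_pt_lim P x y px py /\ differentiable_pt_lim Q x y (- py) px.

Lemma differentiable_opp (f : R -> R -> R) (x y lx ly : R) :
  differentiable_pt_lim f x y lx ly ->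
  differentiable_pt_lim (fun u v => - f u v) x y (- lx) (- ly).
Proof.
  intros H eps. destruct (H eps) as [d Hd]. exists d. intros u v Hu Hv.
  replace (- f u v - - f x y - (- lx * (u - x) + - ly * (v - y)))
    with (- (f u v - f x y - (lx * (u - x) + ly * (v - y)))) by ring.
  rewrite Rabs_Ropp. now apply Hd.
Qed.

(** The common shape of the test function of the maximum principle and of its first derivatives: a
    difference quotient, plus [S], minus a paraboloid. It serves both orders of differentiation in
    both variables. *)
Lemma is_derive_perturbed_difference (f g h e : R -> R) (s f' g' h' e' t : R) :
  is_derive f s f' -> is_derive g s g' -> is_derive h s h' -> is_derive e s e' ->
  is_derive (fun u => (f u - g u) / t + h u - e u) s ((f' - g') / t + h' - e').
Proof.
  intros Hf Hg Hh He.
  auto_derive.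
  - repeat split; eexists; eassumption.
  - rewrite (is_derive_unique (fun u : R => f u) _ _ Hf), (is_derive_unique (fun u : R => g u) _ _ Hg),
      (is_derive_unique (fun u : R => h u) _ _ Hh), (is_derive_unique (fun u : R => e u) _ _ He). unfold Rdiv. ring.
Qed.

(* [Q] need not be twice differentiable, so neither is [P] and its Laplacian makes no
   sense.  But [P dx - Q dy] has a primitive [U], whose difference quotients
   [(U (x + t) y - U x y) / t] have a vanishing Laplacian and converge uniformly to [P]. *)
Lemma no_interior_max (P Q S Sx Sy Sxx Syy : R -> R -> R) (x0 y0 r k : R) :
  0 < r -> 0 < k ->
  (forall x y, Rabs (x - x0) <= r -> Rabs (y - y0) <= r -> cauchy_riemann_at P Q x y) ->
  (forall x y, Rabs (x - x0) < r -> Rabs (y - y0) < r ->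
     continuity_2d_pt S x y /\
     is_derive (fun t => S t y) x (Sx x y) /\ is_derive (fun t => Sx t y) x (Sxx x y) /\
     is_derive (fun t => S x t) y (Sy x y) /\ is_derive (fun t => Sy x t) y (Syy x y) /\
     k <= Sxx x y + Syy x y) ->
  ~ (forall x y, Rabs (x - x0) < r -> Rabs (y - y0) < r -> P x y + S x y <= P x0 y0 + S x0 y0).
Proof.
  intros Hr Hk HCR HS Hmax.
  assert (HP : forall x y, Rabs (x - x0) <= r -> Rabs (y - y0) <= r -> continuity_2d_pt P x y).
  { intros x y h1 h2. destruct (HCR x y h1 h2) as (px & py & H & _).
    eapply differentiable_lim_continuity; eassumption. }
  assert (HQ : forall x y, Rabs (x - x0) <= r -> Rabs (y - y0) <= r -> continuity_2d_pt Q x y).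
  { intros x y h1 h2. destruct (HCR x y h1 h2) as (px & py & _ & H).
    eapply differentiable_lim_continuity; eassumption. }
  destruct (closed_form_exact P (fun x y => - Q x y) (x0 - r) (y0 - r) (2 * r) (2 * r)) as [U HU]; try lra.
  { intros x y Hx Hy. destruct (HCR x y) as (px & py & H1 & H2); try (apply Rabs_le; lra).
    exists px, py, (- px). split; [exact H1|].
    replace py with (- - py) by ring. now apply differentiable_opp. }
  assert (HU' : forall x y, Rabs (x - x0) < r -> Rabs (y - y0) < r ->
    is_derive (fun t => U t y) x (P x y) /\ is_derive (fun t => U x t) y (- Q x y)).
  { intros x y h1 h2. apply Rabs_def2 in h1. apply Rabs_def2 in h2. apply HU; lra. }
  clear HU.
  assert (CU : forall x y, Rabs (x - x0) < r -> Rabs (y - y0) < r -> continuity_2d_pt U x y).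
  { intros x y h1 h2. eapply differentiable_lim_continuity.
    assert (Hd : 0 < Rmin (r - Rabs (x - x0)) (r - Rabs (y - y0))) by (apply Rmin_glb_lt; lra).
    assert (HN : forall u v, Rabs (u - x) < mkposreal _ Hd -> Rabs (v - y) < mkposreal _ Hd ->
      Rabs (u - x0) < r /\ Rabs (v - y0) < r).
    { intros u v a b. simpl in a, b. apply Rmin_Rgt_l in a. apply Rmin_Rgt_l in b. split.
      - replace (u - x0) with ((u - x) + (x - x0)) by ring.
        apply Rle_lt_trans with (1 := Rabs_triang _ _). lra.
      - replace (v - y0) with ((v - y) + (y - y0)) by ring.
        apply Rle_lt_trans with (1 := Rabs_triang _ _). lra. }
    apply (differentiable_of_partials U P (fun x y => - Q x y)).
    - exists (mkposreal _ Hd). intros u v a b. apply HU'; now apply (HN u v).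
    - exists (mkposreal _ Hd). intros u v a b. apply HU'; now apply (HN u v).
    - apply HP; lra.
    - apply continuity_2d_pt_opp, HQ; lra. }
  set (rho := r / 2).
  (* The test function is compared with [P + S] twice, at the centre and at its maximum. Two errors
     [k * rho ^ 2 / 20] stay below the drop [k / 8 * rho ^ 2] of the paraboloid at distance
     [rho]. *)
  assert (Heta : 0 < k * rho ^ 2 / 20).
  { apply Rdiv_lt_0_compat; [apply Rmult_lt_0_compat; [lra|apply pow_lt; unfold rho; lra]|lra]. }
  destruct (uniform_continuity_2d P (x0 - r) (x0 + r) (y0 - r) (y0 + r)) with (eps := mkposreal _ Heta)
    as [d Hd].
  { intros x y h1 h2. apply HP; apply Rabs_le; lra. }
  simpl in Hd.
  (* [t < d] lets uniform continuity compare [P] with its mean over [[x, x + t]]; [t < r / 2] keeps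
     shifted points of the half-size square inside the domain of [U]. *)
  set (t := Rmin (d / 2) (r / 4)).
  assert (Ht : 0 < t /\ t < d /\ t < r / 2).
  { unfold t. pose proof (cond_pos d). pose proof (Rmin_l (d/2) (r/4)).
    pose proof (Rmin_r (d/2) (r/4)). split; [apply Rmin_glb_lt; lra|lra]. }
  set (V := fun x y => (U (x + t) y - U x y) / t).
  assert (HV : forall x y, Rabs (x - x0) <= rho -> Rabs (y - y0) <= rho ->
    Rabs (V x y - P x y) < k * rho ^ 2 / 20).
  { intros x y h1 h2. unfold rho in h1, h2. apply Rabs_le_between in h1. apply Rabs_le_between in h2.
    destruct (MVT_gen (fun s => U s y) x (x + t) (fun s => P s y)) as [c [Hc Ec]].
    - intros s. rewrite Rmin_left, Rmax_right by lra. intros Hs. apply HU'; apply Rabs_def1; lra.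
    - intros s. rewrite Rmin_left, Rmax_right by lra. intros Hs.
      apply derivable_continuous_pt. exists (P s y). apply is_derive_Reals, HU'; apply Rabs_def1; lra.
    - rewrite Rmin_left, Rmax_right in Hc by lra.
      unfold V. rewrite Ec. replace (P c y * (x + t - x) / t) with (P c y) by (field; lra).
      apply Hd; try lra.
      + apply Rabs_def1; lra.
      + rewrite Rminus_eq_0, Rabs_R0. apply cond_pos. }
  (* The paraboloid forces the maximum into the interior of the square. It costs [k / 2] in the
     Laplacian, less than the [k] supplied by [S]. *)
  set (m := fun z : C => V (fst z) (snd z) + S (fst z) (snd z)
    - k / 8 * ((fst z - x0) ^ 2 + (snd z - y0) ^ 2)).
  assert (Hrho : 0 < rho) by (unfold rho; lra).
  assert (Hin : forall x, - rho <= x <= rho -> Rabs x < r) by (intros x Hx; apply Rabs_def1; unfold rho in Hx; lra).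
  destruct (compact_argmax m (fun z => Rabs (fst z - x0) <= rho /\ Rabs (snd z - y0) <= rho)
     (Rabs x0 + Rabs y0 + rho) (x0, y0)) as [[x1 y1] [[K1 K2] Km]].
  - simpl. rewrite !Rminus_eq_0, Rabs_R0. lra.
  - intros [x y]. simpl. intros [h1 h2]. pose proof (Rabs_pos x0). pose proof (Rabs_pos y0). split.
    + replace x with ((x - x0) + x0) by ring. apply Rle_trans with (1 := Rabs_triang _ _). lra.
    + replace y with ((y - y0) + y0) by ring. apply Rle_trans with (1 := Rabs_triang _ _). lra.
  - assert (Far : forall a b c e : R, Rabs (b - a) < Rabs (a - c) - e -> e < Rabs (b - c)).
    { intros a b c e h. pose proof (Rabs_triang_inv (a - c) (a - b)) as T.
      replace (a - c - (a - b)) with (b - c) in T by ring. rewrite (Rabs_minus_sym a b) in T. lra. }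
    intros [x y] Hn. simpl in Hn. destruct (Rle_dec (Rabs (x - x0)) rho) as [a|a].
    + assert (b : 0 < Rabs (y - y0) - rho) by (apply Rlt_0_minus, Rnot_le_lt; tauto).
      exists (mkposreal _ b). intros [u v] [_ h] [_ h']. simpl in *. apply (Far y v y0 rho) in h. lra.
    + apply Rnot_le_lt in a. assert (b : 0 < Rabs (x - x0) - rho) by lra.
      exists (mkposreal _ b). intros [u v] [h _] [h' _]. simpl in *. apply (Far x u x0 rho) in h. lra.
  - intros [x y] [h1 h2]. simpl in h1, h2. apply (filterlim_filter_le_1 (F := locally ((x, y) : C))); [intros A [e He]; exists e; auto|].
    pose proof h1 as h1'. pose proof h2 as h2'.
    apply Rabs_le_between in h1'. apply Rabs_le_between in h2'. pose proof (Hin _ h1') as a1. pose proof (Hin _ h2') as a2.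
    apply (continuity_2d_pt_filterlim (fun x y => m (x, y)) x y). unfold m; simpl.
    apply continuity_2d_pt_minus; [apply continuity_2d_pt_plus|].
    + unfold V, Rdiv. apply continuity_2d_pt_mult; [|apply continuity_2d_pt_const].
      apply continuity_2d_pt_minus; [|now apply CU].
      assert (C1 : continuity_2d_pt U (x + t) y) by (apply CU; auto; apply Rabs_def1; unfold rho in *; lra).
      intros e. destruct (C1 e) as [d' H']. exists d'. intros u v Hu Hv. apply H'; auto.
      now replace (u + t - (x + t)) with (u - x) by ring.
    + now apply HS.
    + repeat first [apply continuity_2d_pt_mult | apply continuity_2d_pt_plus | apply continuity_2d_pt_minus
        | apply continuity_2d_pt_id1 | apply continuity_2d_pt_id2 | apply continuity_2d_pt_const].
  - simpl in K1, K2.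
    assert (B0 : P x0 y0 + S x0 y0 - k * rho ^ 2 / 20 < m (x1, y1)).
    { apply Rlt_le_trans with (m (x0, y0)).
      - unfold m; simpl. assert (Z : Rabs 0 <= rho) by (rewrite Rabs_R0; lra).
        pose proof (HV x0 y0 ltac:(now rewrite Rminus_eq_0) ltac:(now rewrite Rminus_eq_0)) as h.
        apply Rabs_def2 in h. rewrite !Rminus_eq_0. lra.
      - apply Km. simpl. rewrite !Rminus_eq_0, Rabs_R0. lra. }
    pose proof K1 as K1'. pose proof K2 as K2'.
    apply Rabs_le_between in K1'. apply Rabs_le_between in K2'.
    assert (B1 : m (x1, y1) < P x0 y0 + S x0 y0 + k * rho ^ 2 / 20 - k / 8 * ((x1 - x0) ^ 2 + (y1 - y0) ^ 2)).
    { unfold m; simpl fst; simpl snd. pose proof (HV x1 y1 K1 K2) as h. apply Rabs_def2 in h.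
      pose proof (Hmax x1 y1 (Hin _ K1') (Hin _ K2')). lra. }
    assert (J : (x1 - x0) ^ 2 + (y1 - y0) ^ 2 < rho ^ 2).
    { apply Rnot_le_lt. intros h. apply (Rmult_le_compat_l (k / 8)) in h; lra. }
    assert (J1 : Rabs (x1 - x0) < rho).
    { apply Rnot_le_lt. intros h. pose proof (pow2_abs (x1 - x0)). pose proof (pow2_ge_0 (y1 - y0)). nra. }
    assert (J2 : Rabs (y1 - y0) < rho).
    { apply Rnot_le_lt. intros h. pose proof (pow2_abs (y1 - y0)). pose proof (pow2_ge_0 (x1 - x0)). nra. }
    assert (Near : forall a b s, Rabs (s - a) < rho - Rabs (a - b) -> Rabs (s - b) < rho).
    { intros a b s h. replace (s - b) with ((s - a) + (a - b)) by ring.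
      apply Rle_lt_trans with (1 := Rabs_triang _ _). lra. }
    assert (Hr' : forall s, Rabs s < rho -> Rabs s < r) by (unfold rho; intros; lra).
    assert (HrT : forall s, Rabs s < rho -> Rabs (s + t) < r).
    { intros s h. apply Rabs_def2 in h. unfold rho in h. apply Rabs_def1; lra. }
    assert (UT : forall s y, Rabs (s - x0) < rho -> Rabs (y - y0) < rho ->
      is_derive (fun s => U (s + t) y) s (P (s + t) y)).
    { intros s y h1 h2. replace (P (s + t) y) with (scal 1 (P (s + t) y)) by (unfold scal; simpl; unfold mult; simpl; ring).
      apply (is_derive_comp (V := R_NormedModule) (fun s => U s y) (fun s => s + t)).
      - apply HU'; [|now apply Hr']. replace (s + t - x0) with (s - x0 + t) by ring. now apply HrT.
      - auto_derive; auto. }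
    destruct (HCR (x1 + t) y1) as (pxt & pyt & D1 & D2).
    { apply Rlt_le. replace (x1 + t - x0) with (x1 - x0 + t) by ring. now apply HrT. }
    { apply Rlt_le; now apply Hr'. }
    destruct (HCR x1 y1) as (px & py & D3 & D4); try (apply Rlt_le; now apply Hr').
    destruct (HS x1 y1) as (_ & _ & Hxx & _ & Hyy & Hlap); [now apply Hr'|now apply Hr'|].
    assert (Lx : (pxt - px) / t + Sxx x1 y1 - k / 4 <= 0).
    { apply (second_derivative_at_max (fun s => m (s, y1))
        (fun s => (P (s + t) y1 - P s y1) / t + Sx s y1 - k / 4 * (s - x0)) x1 _ (rho - Rabs (x1 - x0))).
      - lra.
      - intros s Hs. apply Near in Hs. unfold m, V; simpl.
        apply is_derive_perturbed_difference; [now apply UT|apply HU'; now apply Hr'|apply HS; now apply Hr'|].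
        auto_derive; [auto|field].
      - apply differentiable_partial_x in D1. apply differentiable_partial_x in D3.
        apply is_derive_perturbed_difference; [|exact D3|exact Hxx|].
        + replace pxt with (scal 1 pxt) by (unfold scal; simpl; unfold mult; simpl; ring).
          apply (is_derive_comp (V := R_NormedModule) (fun s => P s y1) (fun s => s + t)); [exact D1|auto_derive; auto].
        + auto_derive; [auto|field].
      - intros s Hs. apply Km. simpl. apply Near in Hs. split; apply Rlt_le; assumption. }
    assert (Ly : (- pxt - - px) / t + Syy x1 y1 - k / 4 <= 0).
    { apply (second_derivative_at_max (fun s => m (x1, s))
        (fun s => (- Q (x1 + t) s - - Q x1 s) / t + Sy x1 s - k / 4 * (s - y0)) y1 _ (rho - Rabs (y1 - y0))).
      - lra.
      - intros s Hs. apply Near in Hs. unfold m, V; simpl.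
        apply is_derive_perturbed_difference; [|apply HU'; now apply Hr'|apply HS; now apply Hr'|].
        + apply HU'; [|now apply Hr'].
          replace (x1 + t - x0) with (x1 - x0 + t) by ring. now apply HrT.
        + auto_derive; [auto|field].
      - apply differentiable_opp, differentiable_partial_y in D2.
        apply differentiable_opp, differentiable_partial_y in D4.
        apply is_derive_perturbed_difference; [exact D2|exact D4|exact Hyy|].
        auto_derive; [auto|field].
      - intros s Hs. apply Km. simpl. apply Near in Hs. split; apply Rlt_le; assumption. }
    (* By the Cauchy-Riemann equations at [(x1, y1)] and [(x1 + t, y1)], the second derivatives of
       [V] cancel; adding [Lx] and [Ly] leaves [Sxx + Syy <= k / 2]. *)
    assert ((pxt - px) / t + (- pxt - - px) / t = 0) by (field; lra). lra.
Qed.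

(** * Complex derivatives *)

Notation is_C_derive := (@is_derive C_AbsRing C_NormedModule).

Lemma is_C_derive_eps (f : C -> C) (z l : C) :
  is_C_derive f z l <->
  forall eps, 0 < eps -> exists d, 0 < d /\ forall w, Cmod (w - z) < d ->
    Cmod (f w - f z - (w - z) * l) <= eps * Cmod (w - z).
Proof.
  split.
  - intros [_ H] eps He. specialize (H z (fun P H => H) (mkposreal _ He)).
    destruct H as [d Hd]. exists d. split; [apply cond_pos|]. intros w Hw. exact (Hd w Hw).
  - intros H. split.
    + apply is_linear_scal_l.
    + intros x Hx e.
      apply (@is_filter_lim_locally_unique C_AbsRing (AbsRing_NormedModule C_AbsRing)) in Hx. rewrite <- Hx.
      destruct (H e (cond_pos e)) as [d [Hd H']].
      exists (mkposreal _ Hd). intros w Hw. exact (H' w Hw).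
Qed.

(* [C_NormedModule] and [AbsRing_NormedModule C_AbsRing] are not convertible, but have the same norm. *)
Lemma is_C_derive_ring (f : C -> C) (z l : C) :
  is_C_derive f z l <-> @is_derive C_AbsRing (AbsRing_NormedModule C_AbsRing) f z l.
Proof.
  split; intros [_ H]; (split; [apply is_linear_scal_l|exact H]).
Qed.

Lemma is_C_derive_value (f : C -> C) (z l l' : C) : is_C_derive f z l -> l = l' -> is_C_derive f z l'.
Proof. now intros H <-. Qed.

Lemma is_C_derive_id (z : C) : is_C_derive (fun w => w) z (RtoC 1).
Proof. apply is_C_derive_ring. apply (@is_derive_id C_AbsRing). Qed.

Lemma is_C_derive_const (c z : C) : is_C_derive (fun _ => c) z (RtoC 0).
Proof. apply (@is_derive_const C_AbsRing C_NormedModule). Qed.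

Lemma is_C_derive_minus (f g : C -> C) (z l k : C) :
  is_C_derive f z l -> is_C_derive g z k -> is_C_derive (fun w => f w - g w)%C z (l - k)%C.
Proof. apply (@is_derive_minus C_AbsRing C_NormedModule). Qed.

Lemma is_C_derive_mult (f g : C -> C) (z l k : C) :
  is_C_derive f z l -> is_C_derive g z k ->
  is_C_derive (fun w => f w * g w)%C z (l * g z + f z * k)%C.
Proof.
  rewrite !is_C_derive_ring. intros Hf Hg.
  apply (@is_derive_mult C_AbsRing f g z l k Hf Hg). intros n m. apply Cmult_comm.
Qed.

Lemma is_C_derive_comp (f g : C -> C) (z l k : C) :
  is_C_derive f (g z) l -> is_C_derive g z k -> is_C_derive (fun w => f (g w)) z (k * l)%C.
Proof.
  intros Hf Hg. apply is_C_derive_ring in Hg.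
  apply (@is_derive_comp C_AbsRing C_NormedModule f g z l k Hf Hg).
Qed.

Lemma Cmod_sub_sym (z w : C) : Cmod (z - w) = Cmod (w - z).
Proof. rewrite <- Cmod_opp. f_equal. ring. Qed.

Lemma Cmod_triangle_sub (z w : C) : Cmod z - Cmod w <= Cmod (z - w).
Proof.
  pose proof (Cmod_triangle (z - w) w) as H. replace (z - w + w)%C with z in H by ring. lra.
Qed.

Lemma is_C_derive_inv (z : C) : z <> 0%C -> is_C_derive (fun w => / w)%C z (- / (z * z))%C.
Proof.
  intros Hz. apply is_C_derive_eps. intros eps He.
  assert (Hm : 0 < Cmod z) by now apply Cmod_gt_0.
  (* The remainder is exactly [(w - z)^2 / (z^2 w)]. The first radius gives [Cmod w > Cmod z / 2],
     and the second then bounds the factor of [w - z] by [eps]. *)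
  exists (Rmin (Cmod z / 2) (eps * Cmod z ^ 3 / 2)).
  assert (H3 : 0 < Cmod z ^ 3) by now apply pow_lt.
  split; [apply Rmin_glb_lt; nra|]. intros w Hw. apply Rmin_Rgt_l in Hw. destruct Hw as [h1 h2].
  pose proof (Cmod_triangle_sub z w) as T. rewrite Cmod_sub_sym in T.
  assert (Hw : Cmod z / 2 < Cmod w) by lra.
  assert (Hw0 : w <> 0%C) by (intros ->; rewrite Cmod_0 in Hw; lra).
  replace (/ w - / z - (w - z) * - / (z * z))%C with ((w - z) * (w - z) / (z * z * w))%C by (field; auto).
  assert (Hzz : (z * z * w)%C <> 0%C) by (repeat apply Cmult_neq_0; auto).
  rewrite Cmod_div, !Cmod_mult by auto.
  pose proof (Cmod_ge_0 (w - z)).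
  assert (K : Cmod z ^ 3 / 2 < Cmod z * Cmod z * Cmod w).
  { replace (Cmod z ^ 3 / 2) with (Cmod z * Cmod z * (Cmod z / 2)) by field.
    apply Rmult_lt_compat_l; [|exact Hw]. now apply Rmult_lt_0_compat. }
  unfold Rdiv. rewrite Rmult_assoc, (Rmult_comm eps). apply Rmult_le_compat_l; [auto|].
  apply Rmult_le_reg_r with (Cmod z * Cmod z * Cmod w); [lra|].
  rewrite Rmult_assoc, Rinv_l, Rmult_1_r by lra. apply Rlt_le.
  apply Rlt_le_trans with (1 := h2). unfold Rdiv. rewrite Rmult_assoc.
  apply Rmult_le_compat_l; lra.
Qed.

Lemma is_C_derive_differentiable (f : C -> C) (x y : R) (l : C) :
  is_C_derive f (x, y) l ->
  differentiable_pt_lim (fun u v => Re (f (u, v))) x y (Re l) (- Im l) /\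
  differentiable_pt_lim (fun u v => Im (f (u, v))) x y (Im l) (Re l).
Proof.
  rewrite is_C_derive_eps. intros H.
  assert (G : forall eps : posreal, exists d : posreal, forall u v, Rabs (u - x) < d -> Rabs (v - y) < d ->
    Cmod (f (u, v) - f (x, y) - ((u, v) - (x, y)) * l) <= eps * Rmax (Rabs (u - x)) (Rabs (v - y))).
  { intros eps. destruct (H (eps / 2)) as [d [Hd H']]; [apply is_pos_div_2|].
    assert (Hd2 : 0 < d / 2) by lra.
    exists (mkposreal _ Hd2). simpl. intros u v Hu Hv.
    assert (E : Cmod ((u, v) - (x, y)) <= 2 * Rmax (Rabs (u - x)) (Rabs (v - y))).
    { apply Rle_trans with (1 := Cmod_2Rmax _). simpl.
      apply Rmult_le_compat_r; [apply Rle_trans with (1 := Rabs_pos (u + - x)), Rmax_l|].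
      rewrite <- (sqrt_square 2) at 2 by lra. apply sqrt_le_1_alt. lra. }
    assert (E' : Rmax (Rabs (u - x)) (Rabs (v - y)) < d / 2) by now apply Rmax_lub_lt.
    apply Rle_trans with (1 := H' (u, v) ltac:(apply Rle_lt_trans with (1 := E); lra)).
    apply Rmult_le_compat_l with (r := eps / 2) in E; [lra|]. pose proof (cond_pos eps). lra. }
  split; intros eps; destruct (G eps) as [d Hd]; exists d; intros u v Hu Hv;
    apply Rle_trans with (2 := Hd u v Hu Hv).
  - apply Rle_trans with (2 := re_le_Cmod _). apply Req_le. f_equal.
    destruct (f (u, v)), (f (x, y)), l. simpl. ring.
  - apply Rle_trans with (2 := Rle_trans _ _ _ (Rmax_r _ _) (Rmax_Cmod _)). apply Req_le. f_equal.
    destruct (f (u, v)), (f (x, y)), l. simpl. ring.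
Qed.

Lemma is_C_derive_cauchy_riemann (f : C -> C) (x y : R) (l : C) :
  is_C_derive f (x, y) l ->
  cauchy_riemann_at (fun u v => Re (f (u, v))) (fun u v => Im (f (u, v))) x y.
Proof.
  intros H. apply is_C_derive_differentiable in H. exists (Re l), (- Im l). now rewrite Ropp_involutive.
Qed.

Lemma Cmod_square_bound (u v x y e : R) :
  Rabs (u - x) < e -> Rabs (v - y) < e -> Cmod ((u, v) - (x, y)) < 2 * e.
Proof.
  intros Hu Hv. apply Rle_lt_trans with (1 := Cmod_2Rmax _). simpl.
  assert (h : Rmax (Rabs (u + - x)) (Rabs (v + - y)) < e) by now apply Rmax_lub_lt.
  assert (h0 : 0 <= Rmax (Rabs (u + - x)) (Rabs (v + - y))).
  { apply Rle_trans with (1 := Rabs_pos (u + - x)), Rmax_l. }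
  assert (sqrt 2 <= 2). { rewrite <- (sqrt_square 2) at 2 by lra. apply sqrt_le_1_alt. lra. }
  nra.
Qed.

Lemma Cmod_coord_bound (u v x y e : R) :
  Cmod ((u, v) - (x, y)) < e -> Rabs (u - x) < e /\ Rabs (v - y) < e.
Proof.
  intros H. pose proof (Rmax_Cmod ((u, v) - (x, y))%C) as M. simpl in M.
  pose proof (Rmax_l (Rabs (u + - x)) (Rabs (v + - y))).
  pose proof (Rmax_r (Rabs (u + - x)) (Rabs (v + - y))). unfold Rminus. lra.
Qed.

Lemma locally_C_Cmod (z : C) (P : C -> Prop) :
  @locally C_UniformSpace z P <-> exists d, 0 < d /\ forall w, Cmod (w - z) < d -> P w.
Proof.
  destruct z as [x y]. split.
  - intros [d Hd]. exists d. split; [apply cond_pos|]. intros [u v] H.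
    apply Cmod_coord_bound in H. apply Hd. exact H.
  - intros [d [Hd H]]. assert (Hd2 : 0 < d / 2) by lra. exists (mkposreal _ Hd2).
    intros [u v] [h1 h2]. simpl in h1, h2. apply H.
    replace d with (2 * (d / 2)) by field. now apply Cmod_square_bound.
Qed.

Lemma locally_Cmod_lt (z : C) (r : R) : Cmod z < r -> @locally C_UniformSpace z (fun w => Cmod w < r).
Proof.
  intros H. apply locally_C_Cmod. exists (r - Cmod z). split; [lra|]. intros w Hw.
  pose proof (Cmod_triangle_sub w z). lra.
Qed.

Lemma locally_Cmod_gt (z : C) (r : R) : r < Cmod z -> @locally C_UniformSpace z (fun w => r < Cmod w).
Proof.
  intros H. apply locally_C_Cmod. exists (Cmod z - r). split; [lra|]. intros w Hw.
  pose proof (Cmod_triangle_sub z w). rewrite Cmod_sub_sym in Hw. lra.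
Qed.

Lemma is_C_derive_ext_loc (f g : C -> C) (z l : C) :
  @locally C_UniformSpace z (fun w => f w = g w) -> is_C_derive f z l -> is_C_derive g z l.
Proof.
  intros H Hf. apply locally_C_Cmod in H. destruct H as [d [Hd H]].
  apply is_derive_ext_loc with f; [|exact Hf].
  exists (mkposreal _ Hd). intros w Hw. apply H. exact Hw.
Qed.

Lemma continuous_on_continuity_2d (K : C -> Prop) (f : C -> R) :
  (forall z, K z -> continuity_2d_pt (fun x y => f (x, y)) (fst z) (snd z)) -> continuous_on K f.
Proof.
  intros H [x y] Kz. apply (filterlim_filter_le_1 (F := locally ((x, y) : C))).
  { intros A [e He]; exists e; auto. }
  specialize (H _ Kz). apply continuity_2d_pt_filterlim in H. simpl in H.
  apply filterlim_ext with (2 := H). now intros [u v].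
Qed.

(** * The Schwarz lemma *)

Lemma Cmod_sqr (z : C) : Cmod z ^ 2 = fst z ^ 2 + snd z ^ 2.
Proof. apply Cmod2_alt. Qed.

(* The logarithm is a barrier which keeps the maximum of [|f z / z|^2] away from
   the singularity at [0]. *)
Lemma schwarz_lemma (f : C -> C) :
  (forall z, disk z -> disk (f z)) -> holomorphic_on disk f -> f 0 = 0 ->
  forall z, disk z -> Cmod (f z) <= Cmod z.
Proof.
  intros Hf Hol f0 z1 Hz1. apply Rnot_lt_le. intros Hlt.
  assert (Hz0 : z1 <> 0%C).
  { intros ->. rewrite f0, Cmod_0 in Hlt. lra. }
  assert (Hm1 : 0 < Cmod z1) by now apply Cmod_gt_0.
  assert (D0 : disk (RtoC 0)) by (unfold disk; rewrite Cmod_0; lra).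
  unfold disk in Hf, Hz1.
  set (g := fun z : C => (/ z * f z)%C).
  assert (gmod : forall z : C, z <> 0%C -> Cmod (g z) = Cmod (f z) / Cmod z).
  { intros z Hz. unfold g. rewrite Cmod_mult, Cmod_inv by auto. unfold Rdiv. ring. }
  assert (gder : forall z : C, Cmod z < 1 -> z <> 0%C -> exists l, is_C_derive g z l).
  { intros z Hz Hz'. destruct (Hol z Hz) as [l Hl]. eexists.
    apply is_C_derive_mult; [now apply is_C_derive_inv|exact Hl]. }
  assert (Hg1 : 1 < Cmod (g z1)).
  { rewrite gmod by auto. apply Rmult_lt_reg_r with (Cmod z1); auto.
    unfold Rdiv. rewrite Rmult_assoc, Rinv_l by lra. lra. }
  set (G1 := Cmod (g z1)) in *.
  (* On the circle of radius [r] one has [Cmod g <= / r], which must stay below the value [G1] at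
     [z1]. *)
  assert (Hr : exists r, Cmod z1 < r < 1 /\ / r < G1).
  { exists ((Rmax (Cmod z1) (/ G1) + 1) / 2).
    assert (/ G1 < 1) by (rewrite <- Rinv_1; apply Rinv_lt_contravar; lra).
    assert (0 < / G1) by (apply Rinv_0_lt_compat; lra).
    pose proof (Rmax_l (Cmod z1) (/ G1)). pose proof (Rmax_r (Cmod z1) (/ G1)).
    assert (Rmax (Cmod z1) (/ G1) < 1) by (apply Rmax_lub_lt; lra).
    set (r := (Rmax (Cmod z1) (/ G1) + 1) / 2). assert (Hr : / G1 < r < 1) by (unfold r; lra).
    split; [unfold r; lra|]. apply Rmult_lt_reg_r with r; [lra|]. rewrite Rinv_l by lra.
    apply Rle_lt_trans with (G1 * / G1); [rewrite Rinv_r; lra|]. apply Rmult_lt_compat_l; lra. }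
  destruct Hr as [r [Hr Hri]].
  assert (Hir : 0 < / r) by (apply Rinv_0_lt_compat; lra).
  destruct (Hol (RtoC 0) D0) as [l0 Hl0].
  apply is_C_derive_eps with (eps := 1) in Hl0; [|lra]. destruct Hl0 as [d0 [Hd0 Hl0]].
  set (M := Cmod l0 + 1).
  (* Differentiability at 0 together with [f 0 = 0] keeps [g] bounded near its singularity. *)
  assert (HM : forall z : C, z <> 0%C -> Cmod z < d0 -> Cmod (g z) <= M).
  { intros z Hz Hzd. specialize (Hl0 z). replace (z - RtoC 0)%C with z in Hl0 by ring.
    rewrite f0 in Hl0. specialize (Hl0 Hzd). rewrite gmod by auto.
    assert (0 < Cmod z) by now apply Cmod_gt_0.
    apply Rmult_le_reg_r with (Cmod z); auto. unfold Rdiv. rewrite Rmult_assoc, Rinv_l by lra.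
    pose proof (Cmod_triangle (f z - RtoC 0 - z * l0) (z * l0)) as T.
    replace (f z - RtoC 0 - z * l0 + z * l0)%C with (f z) in T by ring.
    rewrite Cmod_mult in T. unfold M. lra. }
  assert (HM0 : 1 <= M) by (unfold M; pose proof (Cmod_ge_0 l0); lra).
  set (N := ln (Cmod z1 ^ 2)).
  assert (HN : N < 0).
  { unfold N. rewrite <- ln_1. apply ln_increasing; nra. }
  assert (HG : 0 < G1 ^ 2 - (/ r) ^ 2) by nra.
  (* Chosen so that [G1 ^ 2 + del * N = (/ r) ^ 2 + del]: the left side is below [k z1], and the
     right side exceeds [k] on the outer circle. *)
  set (del := (G1 ^ 2 - (/ r) ^ 2) / (1 - N)).
  assert (Hdel : 0 < del) by (apply Rdiv_lt_0_compat; lra).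
  assert (HdelE : del * (1 - N) = G1 ^ 2 - (/ r) ^ 2) by (unfold del; field; lra).
  (* Chosen so that [M ^ 2 + del * (T + 1) = del * N]: once [ln (r0 ^ 2) <= T], the values of [k] on
     the inner circle are below [k z1]. *)
  set (T := (- M ^ 2) / del + N - 1).
  set (r0 := Rmin (Cmod z1 / 2) (Rmin (d0 / 2) (exp (T / 2)))).
  assert (Hr0 : 0 < r0 /\ r0 < Cmod z1 /\ r0 < d0 /\ r0 <= exp (T / 2)).
  { unfold r0. pose proof (exp_pos (T / 2)).
    pose proof (Rmin_l (Cmod z1 / 2) (Rmin (d0 / 2) (exp (T / 2)))).
    pose proof (Rmin_r (Cmod z1 / 2) (Rmin (d0 / 2) (exp (T / 2)))).
    pose proof (Rmin_l (d0 / 2) (exp (T / 2))). pose proof (Rmin_r (d0 / 2) (exp (T / 2))).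
    split; [repeat apply Rmin_glb_lt; lra|lra]. }
  assert (HT : ln (r0 ^ 2) <= T).
  { rewrite <- (ln_exp T). replace (exp T) with (exp (T / 2) ^ 2).
    - apply Rcomplements.ln_le; [apply pow_lt; lra|]. apply pow_incr. lra.
    - simpl. rewrite Rmult_1_r, <- exp_plus. f_equal. field. }
  (* The logarithm is harmonic away from 0, and [|z|^2] supplies the Laplacian [4 * del] required by
     [no_interior_max]. *)
  set (S := fun x y : R => del * (ln (x ^ 2 + y ^ 2) + (x ^ 2 + y ^ 2))).
  set (k := fun z : C => fst (g z) ^ 2 + snd (g z) ^ 2 + S (fst z) (snd z)).
  assert (kE : forall z, k z = Cmod (g z) ^ 2 + del * (ln (Cmod z ^ 2) + Cmod z ^ 2)).
  { intros z. unfold k, S. now rewrite !Cmod_sqr. }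
  assert (nz : forall z : C, r0 <= Cmod z -> z <> 0%C).
  { intros z h ->. rewrite Cmod_0 in h. lra. }
  assert (SC : forall x y, r0 <= Cmod (x, y) -> continuity_2d_pt S x y).
  { intros x y h. unfold S. apply continuity_2d_pt_mult; [apply continuity_2d_pt_const|].
    assert (Cq : continuity_2d_pt (fun x y => x ^ 2 + y ^ 2) x y).
    { repeat first [apply continuity_2d_pt_mult | apply continuity_2d_pt_plus 
        | apply continuity_2d_pt_id1 | apply continuity_2d_pt_id2 | apply continuity_2d_pt_const]. }
    apply continuity_2d_pt_plus; [|exact Cq].
    apply (continuity_1d_2d_pt_comp ln); [|exact Cq].
    apply derivable_continuous_pt. eexists. apply derivable_pt_lim_ln.
    pose proof (Cmod_sqr (x, y)) as Cs. simpl fst in Cs. simpl snd in Cs. rewrite <- Cs. apply pow_lt. lra. }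
  destruct (compact_argmax k (fun z => r0 <= Cmod z <= r) r z1) as [[x0 y0] [Km Hmax]].
  - lra.
  - intros z Hz. pose proof (Rmax_Cmod z). pose proof (Rmax_l (Rabs (fst z)) (Rabs (snd z))).
    pose proof (Rmax_r (Rabs (fst z)) (Rabs (snd z))). lra.
  - intros z Hn. destruct (Rlt_dec (Cmod z) r0) as [a|a].
    + apply filter_imp with (2 := locally_Cmod_lt z r0 a). intros w Hw. lra.
    + assert (b : r < Cmod z) by (apply Rnot_le_lt; lra).
      apply filter_imp with (2 := locally_Cmod_gt z r b). intros w Hw. lra.
  - apply continuous_on_continuity_2d. intros [x y] Hz. simpl.
    destruct (gder (x, y)) as [l Hl]; [lra|apply nz; lra|].
    apply is_C_derive_differentiable in Hl. destruct Hl as [L1 L2].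
    apply differentiable_lim_continuity in L1. apply differentiable_lim_continuity in L2.
    unfold k; simpl fst; simpl snd.
    apply continuity_2d_pt_plus; [apply continuity_2d_pt_plus|apply SC; lra];
      apply continuity_2d_pt_mult; auto; apply continuity_2d_pt_mult; auto; apply continuity_2d_pt_const.
  - assert (Hk1 : k z1 <= k (x0, y0)) by (apply Hmax; lra).
    assert (Hk1E : G1 ^ 2 + del * N < k z1).
    { rewrite kE. fold G1 N. pose proof (pow_lt _ 2 Hm1). nra. }
    set (c := Cmod (x0, y0)) in *.
    assert (Hc1 : c < r).
    { destruct (Req_dec c r) as [E|]; [exfalso|lra].
      assert (Hg : Cmod (g (x0, y0)) <= / r).
      { rewrite gmod by (apply nz; unfold c in *; lra). fold c. rewrite E. unfold Rdiv.
        rewrite <- (Rmult_1_l (/ r)) at 2. apply Rmult_le_compat_r; [lra|].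
        apply Rlt_le, Hf. fold c. lra. }
      rewrite (kE (x0, y0)) in Hk1. fold c in Hk1. rewrite E in Hk1. 
      assert (ln (r ^ 2) < 0) by (rewrite <- ln_1; apply ln_increasing; nra).
      assert (Cmod (g (x0, y0)) ^ 2 <= (/ r) ^ 2) by (apply pow_incr; split; [apply Cmod_ge_0|auto]).
      assert (r ^ 2 < 1) by nra.
      assert (del * (ln (r ^ 2) + r ^ 2) < del * 1) by (apply Rmult_lt_compat_l; lra). lra. }
    assert (Hc0 : r0 < c).
    { destruct (Req_dec c r0) as [E|]; [exfalso|lra].
      assert (Hg : Cmod (g (x0, y0)) <= M) by (apply HM; [apply nz|]; fold c; lra).
      rewrite (kE (x0, y0)) in Hk1. fold c in Hk1. rewrite E in Hk1.
      assert (Cmod (g (x0, y0)) ^ 2 <= M ^ 2) by (apply pow_incr; split; [apply Cmod_ge_0|auto]).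
      assert (r0 ^ 2 < 1) by nra.
      assert (del * (ln (r0 ^ 2) + r0 ^ 2) < del * (T + 1)) by (apply Rmult_lt_compat_l; lra).
      assert (del * (T + 1) = - M ^ 2 + del * N) by (unfold T; field; lra).
      nra. }
    (* Linearization of the square: [|g|^2 >= Re (q g) - |g (x0, y0)|^2], with equality at
       [(x0, y0)]. So a maximum of [|g|^2 + S] there is also a maximum of [Re (q g) + S], and [q g]
       is holomorphic. *)
    set (q := (2 * Cconj (g (x0, y0)))%C).
    set (rho := Rmin (c - r0) (r - c) / 4).
    assert (Hrho : 0 < rho) by (unfold rho; assert (0 < Rmin (c - r0) (r - c)) by (apply Rmin_glb_lt; lra); lra).
    assert (Hnear : forall x y, Rabs (x - x0) <= rho -> Rabs (y - y0) <= rho -> r0 < Cmod (x, y) < r).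
    { intros x y h1 h2. pose proof (Cmod_square_bound x y x0 y0 (2 * rho) ltac:(lra) ltac:(lra)) as B.
      pose proof (Cmod_triangle_sub (x, y) (x0, y0)) as T1.
      pose proof (Cmod_triangle_sub (x0, y0) (x, y)) as T2. rewrite Cmod_sub_sym in T2.
      fold c in T1, T2. unfold rho in B.
      pose proof (Rmin_l (c - r0) (r - c)). pose proof (Rmin_r (c - r0) (r - c)). lra. }
    apply (no_interior_max (fun x y => Re (q * g (x, y))%C) (fun x y => Im (q * g (x, y))%C) S
      (fun x y => del * (2 * x / (x ^ 2 + y ^ 2) + 2 * x)) (fun x y => del * (2 * y / (x ^ 2 + y ^ 2) + 2 * y))
      (fun x y => del * ((2 * (x ^ 2 + y ^ 2) - 4 * x ^ 2) / (x ^ 2 + y ^ 2) ^ 2 + 2))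
      (fun x y => del * ((2 * (x ^ 2 + y ^ 2) - 4 * y ^ 2) / (x ^ 2 + y ^ 2) ^ 2 + 2))
      x0 y0 rho (4 * del)); [exact Hrho|lra|..].
    + intros x y h1 h2. destruct (Hnear x y h1 h2) as [a1 a2].
      destruct (gder (x, y)) as [l Hl]; [lra|apply nz; lra|].
      apply (is_C_derive_cauchy_riemann (fun z => q * g z)%C x y (0 * g (x, y) + q * l)%C).
      apply is_C_derive_mult; [apply is_C_derive_const|exact Hl].
    + intros x y h1 h2. destruct (Hnear x y (Rlt_le _ _ h1) (Rlt_le _ _ h2)) as [a1 a2].
      assert (Hpos : 0 < x ^ 2 + y ^ 2).
      { pose proof (Cmod_sqr (x, y)) as Cs. simpl fst in Cs. simpl snd in Cs. rewrite <- Cs. apply pow_lt. lra. }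
      assert (Hpos' : 0 < x * (x * 1) + y * (y * 1)) by (simpl in Hpos; exact Hpos).
      assert (Hne : x * (x * 1) + y * (y * 1) <> 0) by lra.
      split; [apply SC; lra|]. unfold S.
      split; [auto_derive; [repeat split; auto|field; auto]|].
      split; [auto_derive; [repeat split; auto|field; auto]|].
      split; [auto_derive; [repeat split; auto|field; auto]|].
      split; [auto_derive; [repeat split; auto|field; auto]|].
      apply Req_le. field. auto.
    + intros x y h1 h2. destruct (Hnear x y (Rlt_le _ _ h1) (Rlt_le _ _ h2)) as [a1 a2].
      assert (Hk : fst (g (x, y)) ^ 2 + snd (g (x, y)) ^ 2 + S x y <=
        fst (g (x0, y0)) ^ 2 + snd (g (x0, y0)) ^ 2 + S x0 y0) by (apply (Hmax (x, y)); lra).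
      unfold q. destruct (g (x, y)) as [gx gy]. destruct (g (x0, y0)) as [hx hy].
      unfold Cmult, Cconj, Re, Im, RtoC; simpl fst in *; simpl snd in *.
      pose proof (pow2_ge_0 (gx - hx)). pose proof (pow2_ge_0 (gy - hy)). nra.
Qed.

(** * Automorphisms of the disk *)

Lemma zero_derivative_constant (f : R -> R) (a b : R) :
  a <= b -> (forall t, a <= t <= b -> is_derive f t 0) -> f b = f a.
Proof.
  intros Hab H. destruct (MVT_gen f a b (fun _ => 0)) as [c [_ E]].
  - intros t Ht. rewrite Rmin_left, Rmax_right in Ht by lra. apply H. lra.
  - intros t Ht. rewrite Rmin_left, Rmax_right in Ht by lra. apply derivable_continuous_pt.
    exists 0. apply is_derive_Reals, H. lra.
  - lra.
Qed.

Lemma is_derive_sum_squares (p q : R -> R) (x p' q' : R) :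
  is_derive p x p' -> is_derive q x q' ->
  is_derive (fun t => p t ^ 2 + q t ^ 2) x (2 * (p x * p' + q x * q')).
Proof.
  intros Hp Hq. auto_derive; [repeat split; eexists; eassumption|].
  rewrite (is_derive_unique (fun u : R => p u) _ _ Hp), (is_derive_unique (fun u : R => q u) _ _ Hq). ring.
Qed.

Lemma is_derive_div_id (p : R -> R) (x p' l : R) :
  x <> 0 -> is_derive p x p' -> x * p' - p x = l * x ^ 2 -> is_derive (fun t => p t / t) x l.
Proof.
  intros Hx Hp El. auto_derive; [repeat split; [eexists; eassumption|exact Hx]|].
  rewrite (is_derive_unique (fun u : R => p u) _ _ Hp).
  replace l with ((l * x ^ 2) / x ^ 2) by (field; auto). rewrite <- El. field. auto.
Qed.

(** Differentiating [|f|^2 = |z|^2] gives [f * conj f' = z], hence [z f' = f]. So [f] is homogeneous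
    of degree one along rays, and its derivative at 0 identifies it as linear. This takes the place
    of the equality case in the maximum principle. *)
Lemma isometry_fixing_origin (f : C -> C) :
  holomorphic_on disk f -> (forall z, disk z -> Cmod (f z) = Cmod z) ->
  exists c : C, Cmod c = 1 /\ forall z, disk z -> f z = (c * z)%C.
Proof.
  intros Hol Hiso.
  assert (Hder : forall z l : C, disk z -> is_C_derive f z l -> (z * l)%C = f z).
  { intros [x y] [lr li] Hz Hl. destruct (is_C_derive_differentiable _ _ _ _ Hl) as [D1 D2].
    assert (Hloc : @locally C_UniformSpace (x, y) (fun w => disk w)) by now apply locally_Cmod_lt.
    assert (Heq : forall w, disk w -> Re (f w) ^ 2 + Im (f w) ^ 2 = fst w ^ 2 + snd w ^ 2).
    { intros w Hw. rewrite <- (Cmod_sqr w), <- (Hiso w Hw), (Cmod_sqr (f w)). reflexivity. }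
    assert (Hxy := Heq _ Hz).
    pose proof (differentiable_partial_x _ _ _ _ _ D1) as X1.
    pose proof (differentiable_partial_x _ _ _ _ _ D2) as X2.
    pose proof (differentiable_partial_y _ _ _ _ _ D1) as Y1.
    pose proof (differentiable_partial_y _ _ _ _ _ D2) as Y2.
    destruct Hloc as [d Hd].
    assert (EX : Re (f (x, y)) * lr + Im (f (x, y)) * li = x).
    { assert (I1 : is_derive (fun t => Re (f (t, y)) ^ 2 + Im (f (t, y)) ^ 2) x
        (2 * (Re (f (x, y)) * lr + Im (f (x, y)) * li))).
      { exact (is_derive_sum_squares _ _ _ _ _ X1 X2). }
      assert (I2 : is_derive (fun t => Re (f (t, y)) ^ 2 + Im (f (t, y)) ^ 2) x (2 * x)).
      { apply is_derive_ext_loc with (fun t => t ^ 2 + y ^ 2); [|auto_derive; auto; ring].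
        exists d. intros t Ht. symmetry. apply (Heq (t, y)). apply Hd.
        split; [exact Ht|apply ball_center]. }
      apply is_derive_unique in I1. apply is_derive_unique in I2. lra. }
    assert (EY : - Re (f (x, y)) * li + Im (f (x, y)) * lr = y).
    { assert (I1 : is_derive (fun t => Re (f (x, t)) ^ 2 + Im (f (x, t)) ^ 2) y
        (2 * (Re (f (x, y)) * - li + Im (f (x, y)) * lr))).
      { exact (is_derive_sum_squares _ _ _ _ _ Y1 Y2). }
      assert (I2 : is_derive (fun t => Re (f (x, t)) ^ 2 + Im (f (x, t)) ^ 2) y (2 * y)).
      { apply is_derive_ext_loc with (fun t => x ^ 2 + t ^ 2); [|auto_derive; auto; ring].
        exists d. intros t Ht. symmetry. apply (Heq (x, t)). apply Hd.
        split; [apply ball_center|exact Ht]. }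
      apply is_derive_unique in I1. apply is_derive_unique in I2. lra. }
    simpl fst in Hxy. simpl snd in Hxy.
    destruct (f (x, y)) as [fr fi]. unfold Re, Im in *. simpl fst in *. simpl snd in *.
    assert (Hl1 : (fr ^ 2 + fi ^ 2) * (lr ^ 2 + li ^ 2 - 1) = 0).
    { replace ((fr ^ 2 + fi ^ 2) * (lr ^ 2 + li ^ 2 - 1))
        with ((fr * lr + fi * li) ^ 2 + (- fr * li + fi * lr) ^ 2 - (fr ^ 2 + fi ^ 2)) by ring.
      rewrite EX, EY, Hxy. ring. }
    unfold Cmult. simpl. apply Rmult_integral in Hl1. destruct Hl1 as [Hl1|Hl1].
    - assert (fr = 0) by nra. assert (fi = 0) by nra. assert (x = 0) by nra. assert (y = 0) by nra.
      subst. f_equal; ring.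
    - rewrite <- EX, <- EY. f_equal.
      + replace ((fr * lr + fi * li) * lr - (- fr * li + fi * lr) * li) with (fr * (lr ^ 2 + li ^ 2)) by ring.
        replace (lr ^ 2 + li ^ 2) with 1 by lra. ring.
      + replace ((fr * lr + fi * li) * li + (- fr * li + fi * lr) * lr) with (fi * (lr ^ 2 + li ^ 2)) by ring.
        replace (lr ^ 2 + li ^ 2) with 1 by lra. ring. }
  assert (D0 : disk (RtoC 0)) by (unfold disk; rewrite Cmod_0; lra).
  assert (f0 : f (RtoC 0) = RtoC 0) by (apply Cmod_eq_0; rewrite Hiso, Cmod_0; auto).
  destruct (Hol (RtoC 0) D0) as [c Hc].
  assert (Hlin : forall z, disk z -> f z = (c * z)%C).
  { intros z Hz.
    (* [f (t z) / t] does not depend on [t] in (0, 1], and tends to [c z] as [t] tends to [0]. *)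
    assert (Hray : forall t, 0 < t <= 1 -> f (RtoC t * z)%C = (RtoC t * f z)%C).
    { intros t Ht. destruct z as [x y].
      assert (Ein : forall s, 0 < s <= 1 -> disk (s * x, s * y)).
      { intros s Hs. replace (s * x, s * y) with (RtoC s * (x, y))%C.
        - unfold disk in *. rewrite Cmod_mult, Cmod_R, Rabs_pos_eq by lra. pose proof (Cmod_ge_0 (x, y)). nra.
        - unfold Cmult, RtoC; simpl. f_equal; ring. }
      assert (Hd : forall s, t <= s <= 1 ->
        is_derive (fun s => Re (f (s * x, s * y)) / s) s 0 /\ is_derive (fun s => Im (f (s * x, s * y)) / s) s 0).
      { intros s Hs. destruct (Hol _ (Ein s ltac:(lra))) as [l Hl].
        pose proof (Hder _ _ (Ein s ltac:(lra)) Hl) as E.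
        destruct (is_C_derive_differentiable _ _ _ _ Hl) as [D1 D2].
        assert (lin : forall p, derivable_pt_lim (fun s => s * p) s p).
        { intros p. apply is_derive_Reals. auto_derive; auto. ring. }
        pose proof (derivable_pt_lim_comp_2d _ (fun s => s * x) (fun s => s * y) s _ _ _ _ D1 (lin x) (lin y)) as E1.
        pose proof (derivable_pt_lim_comp_2d _ (fun s => s * x) (fun s => s * y) s _ _ _ _ D2 (lin x) (lin y)) as E2.
        apply is_derive_Reals in E1. apply is_derive_Reals in E2.
        assert (ER : Re (f (s * x, s * y)) = s * (x * Re l - y * Im l)).
        { rewrite <- E. unfold Re, Im, Cmult; simpl. ring. }
        assert (EI : Im (f (s * x, s * y)) = s * (x * Im l + y * Re l)).
        { rewrite <- E. unfold Re, Im, Cmult; simpl. ring. }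
        split.
        - apply (is_derive_div_id (fun s => Re (f (s * x, s * y))) s _ 0 ltac:(lra) E1). rewrite ER. ring.
        - apply (is_derive_div_id (fun s => Im (f (s * x, s * y))) s _ 0 ltac:(lra) E2). rewrite EI. ring. }
      pose proof (zero_derivative_constant (fun s => Re (f (s * x, s * y)) / s) t 1 ltac:(lra) (fun s h => proj1 (Hd s h))) as H1.
      pose proof (zero_derivative_constant (fun s => Im (f (s * x, s * y)) / s) t 1 ltac:(lra) (fun s h => proj2 (Hd s h))) as H2.
      cbv beta in H1, H2. rewrite !Rmult_1_l in H1, H2.
      replace (RtoC t * (x, y))%C with (t * x, t * y) by (unfold Cmult, RtoC; simpl; f_equal; ring).
      unfold Re, Im in H1, H2.
      rewrite (surjective_pairing (f (t * x, t * y))). unfold Cmult, RtoC; simpl. f_equal.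
      - apply Rmult_eq_reg_r with (/ t); [|apply Rinv_neq_0_compat; lra].
        transitivity (fst (f (x, y)) / 1); [symmetry; exact H1|field; lra].
      - apply Rmult_eq_reg_r with (/ t); [|apply Rinv_neq_0_compat; lra].
        transitivity (snd (f (x, y)) / 1); [symmetry; exact H2|field; lra]. }
    assert (Hsmall : forall eps, 0 < eps -> Cmod (f z - c * z)%C <= eps).
    { intros eps He. destruct (proj1 (is_C_derive_eps _ _ _) Hc eps He) as [d [Hd Hc']].
      set (t := Rmin 1 (d / 2)).
      assert (Ht : 0 < t <= 1 /\ t < d).
      { unfold t. pose proof (Rmin_l 1 (d / 2)). pose proof (Rmin_r 1 (d / 2)).
        split; [split; [apply Rmin_glb_lt; lra|lra]|lra]. }
      specialize (Hc' (RtoC t * z)%C).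
      rewrite f0, Hray in Hc' by lra.
      replace (RtoC t * f z - RtoC 0 - (RtoC t * z - RtoC 0) * c)%C with (RtoC t * (f z - c * z))%C in Hc' by ring.
      replace (RtoC t * z - RtoC 0)%C with (RtoC t * z)%C in Hc' by ring.
      rewrite !Cmod_mult, !Cmod_R, Rabs_pos_eq in Hc' by lra.
      unfold disk in Hz. pose proof (Cmod_ge_0 z).
      assert (h : t * Cmod (f z - c * z) <= eps * (t * Cmod z)) by (apply Hc'; nra).
      apply Rmult_le_reg_l with t; [lra|]. apply Rle_trans with (1 := h).
      replace (eps * (t * Cmod z)) with (t * (eps * Cmod z)) by ring.
      apply Rmult_le_compat_l; [lra|]. nra. }
    assert (E : Cmod (f z - c * z)%C = 0).
    { pose proof (Cmod_ge_0 (f z - c * z)%C) as P. destruct (Rle_lt_or_eq_dec _ _ P) as [h|h]; [|auto].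
      specialize (Hsmall (Cmod (f z - c * z)%C / 2)). lra. }
    apply Cmod_eq_0 in E. replace (f z) with (f z - c * z + c * z)%C by ring. rewrite E. ring. }
  exists c. split; [|exact Hlin].
  assert (Dh : disk (RtoC (1/2))) by (unfold disk; rewrite Cmod_R, Rabs_pos_eq; lra).
  pose proof (Hiso _ Dh) as E. rewrite Hlin, Cmod_mult, Cmod_R, Rabs_pos_eq in E by (auto; lra). lra.
Qed.

Definition mobius (a z : C) : C := ((z - a) / (1 - Cconj a * z))%C.

Lemma mobius_den (a z : C) : Cmod a * Cmod z < 1 -> (1 - Cconj a * z)%C <> 0%C.
Proof.
  intros Haz E. assert (H : Cmod (Cconj a * z)%C = 1).
  { replace (Cconj a * z)%C with (RtoC 1); [now rewrite Cmod_1|].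
    replace (RtoC 1) with (1 - Cconj a * z + Cconj a * z)%C by ring. rewrite E. ring. }
  rewrite Cmod_mult, Cmod_conj in H. lra.
Qed.

Lemma mobius_den_closed_disk (a z : C) : disk a -> closed_disk z -> (1 - Cconj a * z)%C <> 0%C.
Proof.
  unfold disk, closed_disk. intros Ha Hz. apply mobius_den.
  pose proof (Cmod_ge_0 a). pose proof (Cmod_ge_0 z). nra.
Qed.

(** Compares denominator and numerator of [mobius a]; positivity of the right side is why the disk
    is mapped into itself. *)
Lemma mobius_den_mod (a z : C) :
  Cmod (1 - Cconj a * z)%C ^ 2 - Cmod (z - a)%C ^ 2 = (1 - Cmod a ^ 2) * (1 - Cmod z ^ 2).
Proof.
  rewrite !Cmod_sqr. destruct a as [a b], z as [x y]. unfold Cminus, Cplus, Copp, Cconj, Cmult, RtoC. simpl. ring.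
Qed.

Lemma mobius_disk (a z : C) : disk a -> disk z -> disk (mobius a z).
Proof.
  unfold disk. intros Ha Hz. unfold mobius.
  assert (Hd : (1 - Cconj a * z)%C <> 0%C) by (apply mobius_den_closed_disk; unfold disk, closed_disk; lra).
  rewrite Cmod_div by auto. pose proof (proj1 (Cmod_gt_0 _) Hd) as Hp.
  apply Rmult_lt_reg_r with (Cmod (1 - Cconj a * z)%C); auto.
  unfold Rdiv. rewrite Rmult_assoc, Rinv_l by lra. rewrite Rmult_1_r, Rmult_1_l.
  pose proof (mobius_den_mod a z) as M. pose proof (Cmod_ge_0 a). pose proof (Cmod_ge_0 z).
  assert (0 < (1 - Cmod a ^ 2) * (1 - Cmod z ^ 2)) by (apply Rmult_lt_0_compat; nra).
  pose proof (Cmod_ge_0 (z - a)%C). nra.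
Qed.

Lemma mobius_derive (a z : C) : (1 - Cconj a * z)%C <> 0%C ->
  is_C_derive (mobius a) z ((1 - Cconj a * a) / ((1 - Cconj a * z) * (1 - Cconj a * z)))%C.
Proof.
  intros Hd. unfold mobius, Cdiv.
  eapply is_C_derive_value.
  - apply is_C_derive_mult.
    + apply is_C_derive_minus; [apply is_C_derive_id|apply is_C_derive_const].
    + apply (is_C_derive_comp (fun w => / w)%C (fun w => 1 - Cconj a * w)%C); [now apply is_C_derive_inv|].
      apply is_C_derive_minus; [apply is_C_derive_const|].
      apply is_C_derive_mult; [apply is_C_derive_const|apply is_C_derive_id].
  - cbv beta. field. exact Hd.
Qed.

Lemma mobius_inverse (a z : C) : disk a -> disk z -> mobius (- a) (mobius a z) = z.
Proof.
  intros Ha Hz. unfold disk in *.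
  assert (Hd : (1 - Cconj a * z)%C <> 0%C) by (apply mobius_den_closed_disk; unfold disk, closed_disk; lra).
  assert (Hd2 : (1 - Cconj a * a)%C <> 0%C) by (apply mobius_den_closed_disk; unfold disk, closed_disk; lra).
  assert (E : Cconj (- a) = (- Cconj a)%C).
  { destruct a. unfold Cconj, Copp. reflexivity. }
  unfold mobius. rewrite E. field. split; [exact Hd|].
  intros E2. apply Hd2. rewrite <- E2. ring.
Qed.

Lemma disk_opp (a : C) : disk a -> disk (- a)%C.
Proof. unfold disk. now rewrite Cmod_opp. Qed.

Lemma automorphism_mobius (psi : C -> C) :
  disk_automorphism psi -> exists a c : C, disk a /\ Cmod c = 1 /\
    forall z, disk z -> psi z = (c * mobius a z)%C.
Proof.
  intros (Hpsi & Hol & phi & Hphi & Hol' & phipsi & psiphi).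
  assert (D0 : disk (RtoC 0)) by (unfold disk; rewrite Cmod_0; lra).
  set (a := phi (RtoC 0)).
  assert (Ha : disk a) by now apply Hphi.
  assert (Ha' : disk (- a)%C) by now apply disk_opp.
  assert (Mder : forall b z, disk b -> disk z -> exists l, is_C_derive (mobius b) z l).
  { intros b z Hb Hz. eexists. apply mobius_derive, mobius_den_closed_disk; unfold disk, closed_disk in *; lra. }
  assert (Minv : forall z, disk z -> mobius a (mobius (- a) z) = z).
  { intros z Hz. rewrite <- (mobius_inverse (- a) z) at 2 by auto. now replace (- - a)%C with a by ring. }
  (* [f] and [g] are mutually inverse self-maps of the disk fixing 0. The Schwarz lemma for both
     forces [Cmod (f z) = Cmod z]. *)
  set (f := fun w => psi (mobius (- a) w)). set (g := fun w => mobius a (phi w)).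
  assert (fD : forall z, disk z -> disk (f z)) by (intros z Hz; apply Hpsi, mobius_disk; auto).
  assert (fH : holomorphic_on disk f).
  { intros z Hz. destruct (Mder (- a)%C z Ha' Hz) as [l Hl].
    destruct (Hol (mobius (- a) z)) as [k Hk]; [now apply mobius_disk|].
    eexists. apply (is_C_derive_comp psi (mobius (- a))); [exact Hk|exact Hl]. }
  assert (gH : holomorphic_on disk g).
  { intros z Hz. destruct (Hol' z Hz) as [l Hl]. destruct (Mder a (phi z) Ha (Hphi z Hz)) as [k Hk].
    eexists. apply (is_C_derive_comp (mobius a) phi); [exact Hk|exact Hl]. }
  assert (f_le : forall z, disk z -> Cmod (f z) <= Cmod z).
  { apply schwarz_lemma; auto. unfold f. transitivity (psi a); [f_equal; unfold mobius|now apply psiphi].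
    replace (0 - - a)%C with a by ring. replace (1 - Cconj (- a) * 0)%C with (RtoC 1) by ring.
    field. }
  assert (g_le : forall z, disk z -> Cmod (g z) <= Cmod z).
  { apply schwarz_lemma; auto.
    - intros z Hz. apply mobius_disk; auto.
    - unfold g. fold a. unfold mobius, Cdiv. replace (a - a)%C with (RtoC 0) by ring. ring. }
  destruct (isometry_fixing_origin f fH) as [c [Hc Hlin]].
  { intros z Hz. apply Rle_antisym; [now apply f_le|].
    rewrite <- (Minv z Hz) at 1. rewrite <- (phipsi (mobius (- a) z)) by now apply mobius_disk.
    apply (g_le (f z)). now apply fD. }
  exists a, c. repeat split; auto. intros z Hz. rewrite <- Hlin by now apply mobius_disk.
  unfold f. now rewrite mobius_inverse.
Qed.

(** * Solutions given by quadratic polynomials *)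

Definition quadric (A B C D : R) (z : Complex.C) : R :=
  A * (fst z ^ 2 + snd z ^ 2) + B * fst z + C * snd z + D.

(** Completing the square: [4 A] times the quadric is a sum of two squares plus
    [4 A D - B^2 - C^2 = 1]. *)
Lemma quadric_pos (A B C D : R) (z : Complex.C) :
  0 < A -> 4 * A * D = 1 + B ^ 2 + C ^ 2 -> 0 < quadric A B C D z.
Proof.
  intros HA H. apply Rmult_lt_reg_l with (4 * A); [lra|].
  replace (4 * A * quadric A B C D z)
    with ((2 * A * fst z + B) ^ 2 + (2 * A * snd z + C) ^ 2 + (4 * A * D - B ^ 2 - C ^ 2))
    by (unfold quadric; ring).
  pose proof (pow2_ge_0 (2 * A * fst z + B)). pose proof (pow2_ge_0 (2 * A * snd z + C)). lra.
Qed.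

(* The logarithm is included so that the class contains the solution itself. *)
Inductive regular (q : C -> R) : (C -> R) -> Prop :=
| regular_const (c : R) : regular q (fun _ => c)
| regular_x : regular q fst
| regular_y : regular q snd
| regular_plus f g : regular q f -> regular q g -> regular q (fun z => f z + g z)
| regular_mult f g : regular q f -> regular q g -> regular q (fun z => f z * g z)
| regular_inv : regular q (fun z => / q z)
| regular_ln : regular q (fun z => ln (q z)).

Lemma quadric_partial (A B C D : R) (a : axis) (z : Complex.C) :
  is_derive (slice a (quadric A B C D) z) (coord a z)
    (2 * A * coord a z + match a with X_axis => B | Y_axis => C end).
Proof.
  destruct z as [x y], a; unfold slice, coord, quadric, Re, Im; simpl; auto_derive; auto; ring.
Qed.

Lemma slice_coord (a : axis) (f : C -> R) (z : C) : slice a f z (coord a z) = f z.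
Proof. destruct z as [x y], a; reflexivity. Qed.

Lemma is_derive_inv_comp (f : R -> R) (x l : R) :
  is_derive f x l -> f x <> 0 -> is_derive (fun t => / f t) x (- l * (/ f x * / f x)).
Proof.
  intros H H0. auto_derive; [split; [eexists; exact H|split; auto]|].
  rewrite (is_derive_unique (fun u : R => f u) _ _ H). field. exact H0.
Qed.

Lemma is_derive_ln_comp (f : R -> R) (x l : R) :
  is_derive f x l -> 0 < f x -> is_derive (fun t => ln (f t)) x (l * / f x).
Proof.
  intros H H0. auto_derive; [split; [eexists; exact H|split; auto]|].
  rewrite (is_derive_unique (fun u : R => f u) _ _ H). field. lra.
Qed.

(** Closure under partial derivatives gives smoothness of all orders by induction on the word of
    axes. The quadric being positive on the whole plane, all these derivatives continue across the
    circle. *)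
Lemma regular_partial (A B C D : R) (f : Complex.C -> R) (a : axis) :
  0 < A -> 4 * A * D = 1 + B ^ 2 + C ^ 2 ->
  regular (quadric A B C D) f -> exists g, regular (quadric A B C D) g /\
    forall z, is_derive (slice a f z) (coord a z) (g z).
Proof.
  intros HA HD Hf. set (q := quadric A B C D) in *. induction Hf as [c| | |f g Hf [f' [Rf Df]] Hg [g' [Rg Dg]]|f g Hf [f' [Rf Df]] Hg [g' [Rg Dg]]| | ].
  - exists (fun _ => 0). split; [constructor|]. intros z.
    destruct a; apply (@is_derive_const R_AbsRing R_NormedModule).
  - exists (fun _ => match a with X_axis => 1 | Y_axis => 0 end). split; [constructor|].
    intros z. destruct a; unfold slice, coord; simpl; [apply (@is_derive_id R_AbsRing)|].
    apply (@is_derive_const R_AbsRing R_NormedModule).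
  - exists (fun _ => match a with X_axis => 0 | Y_axis => 1 end). split; [constructor|].
    intros z. destruct a; unfold slice, coord; simpl; [|apply (@is_derive_id R_AbsRing)].
    apply (@is_derive_const R_AbsRing R_NormedModule).
  - exists (fun z => f' z + g' z). split; [now constructor|]. intros z.
    specialize (Df z). specialize (Dg z).
    destruct a; exact (@is_derive_plus R_AbsRing R_NormedModule _ _ _ _ _ Df Dg).
  - exists (fun z => f' z * g z + f z * g' z). split; [repeat constructor; auto|]. intros z.
    specialize (Df z). specialize (Dg z).
    rewrite <- (slice_coord a f z), <- (slice_coord a g z).
    destruct a; exact (Derive.is_derive_mult _ _ _ _ _ Df Dg).
  - exists (fun z => -1 * ((2 * A * coord a z + match a with X_axis => B | Y_axis => C end) * (/ q z * / q z))).
    split.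
    + destruct a; repeat (apply regular_mult || apply regular_plus || constructor).
    + intros z. pose proof (quadric_partial A B C D a z) as Hq.
      pose proof (quadric_pos A B C D z HA HD) as Hp. fold q in Hq, Hp.
      rewrite <- (slice_coord a q z) in Hp |- *.
      apply is_derive_inv_comp in Hq; [|lra].
      match goal with |- is_derive _ _ ?v => replace v with
        (- (2 * A * coord a z + match a with X_axis => B | Y_axis => C end) *
          (/ slice a q z (coord a z) * / slice a q z (coord a z))) by ring end.
      destruct a; exact Hq.
  - exists (fun z => (2 * A * coord a z + match a with X_axis => B | Y_axis => C end) * / q z).
    split.
    + destruct a; repeat (apply regular_mult || apply regular_plus || constructor).
    + intros z. pose proof (quadric_partial A B C D a z) as Hq.
      pose proof (quadric_pos A B C D z HA HD) as Hp. fold q in Hq, Hp.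
      rewrite <- (slice_coord a q z) in Hp |- *.
      apply is_derive_ln_comp in Hq; [|exact Hp].
      destruct a; exact Hq.
Qed.

Lemma regular_continuity_2d (A B C D : R) (f : Complex.C -> R) (x y : R) :
  0 < A -> 4 * A * D = 1 + B ^ 2 + C ^ 2 ->
  regular (quadric A B C D) f -> continuity_2d_pt (fun u v => f (u, v)) x y.
Proof.
  intros HA HD. set (q := quadric A B C D).
  assert (Hq : continuity_2d_pt (fun u v => q (u, v)) x y).
  { unfold q, quadric; simpl.
    repeat first [apply continuity_2d_pt_mult | apply continuity_2d_pt_plus
      | apply continuity_2d_pt_id1 | apply continuity_2d_pt_id2 | apply continuity_2d_pt_const]. }
  pose proof (quadric_pos A B C D (x, y) HA HD) as Hp.
  intros Hf. induction Hf.
  - apply continuity_2d_pt_const.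
  - apply continuity_2d_pt_id1.
  - apply continuity_2d_pt_id2.
  - now apply continuity_2d_pt_plus.
  - now apply continuity_2d_pt_mult.
  - apply continuity_2d_pt_inv; [exact Hq|]. unfold q. lra.
  - apply (continuity_1d_2d_pt_comp ln); [|exact Hq].
    apply derivable_continuous_pt. eexists. apply derivable_pt_lim_ln. exact Hp.
Qed.

Lemma disk_slice (a : axis) (z : C) (P : C -> Prop) :
  disk z -> (forall w, disk w -> P w) ->
  locally (coord a z) (fun t => P match a with X_axis => (t, Im z) | Y_axis => (Re z, t) end).
Proof.
  intros Hz HP. destruct (locally_Cmod_lt z 1 Hz) as [d Hd]. exists d. intros t Ht.
  apply HP. destruct z as [x y], a; apply Hd; (split; [|]); first [exact Ht|apply ball_center].
Qed.

Lemma partial_ext_disk (a : axis) (f g : C -> R) (z : C) (l : R) :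
  (forall w, disk w -> f w = g w) -> disk z -> is_derive (slice a g z) (coord a z) l ->
  is_derive (slice a f z) (coord a z) l.
Proof.
  intros Hfg Hz Hg. apply is_derive_ext_loc with (2 := Hg).
  pose proof (disk_slice a z (fun w => g w = f w) Hz (fun w hw => eq_sym (Hfg w hw))) as H.
  destruct a; exact H.
Qed.

Lemma quadric_solution (A B C D : R) (u : Complex.C -> R) :
  0 < A -> D - A = 1 -> 4 * A * D = 1 + B ^ 2 + C ^ 2 ->
  (forall z, closed_disk z -> u z = - ln (quadric A B C D z)) -> is_solution u.
Proof.
  intros HA HDA HD Hu.
  set (q := quadric A B C D) in *.
  assert (qpos : forall z, 0 < q z) by (intros z; now apply quadric_pos).
  assert (Hu' : forall z, disk z -> u z = -1 * ln (q z)).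
  { intros z Hz. rewrite Hu; [ring|]. unfold disk, closed_disk in *. lra. }
  assert (Ru : regular q (fun z => -1 * ln (q z))) by (apply regular_mult; constructor).
  assert (Hw : forall w, exists g, regular q g /\ forall z, disk z -> partials w u z = g z).
  { induction w as [|a w [g [Rg Eg]]].
    - now exists (fun z => -1 * ln (q z)).
    - destruct (regular_partial A B C D g a HA HD Rg) as [g' [Rg' Dg']].
      exists g'. split; [exact Rg'|]. intros z Hz. simpl. unfold partial.
      apply is_derive_unique. now apply partial_ext_disk with g. }
  split; [split|split].
  - intros z Hz.
    apply filterlim_within_ext with (fun z => -1 * ln (q z)).
    { intros w Hw'. rewrite Hu by auto. ring. }
    replace (u z) with (-1 * ln (q z)) by (rewrite Hu by auto; ring).
    apply (continuous_on_continuity_2d closed_disk (fun z => -1 * ln (q z))); [|exact Hz].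
    intros w _. exact (regular_continuity_2d A B C D _ (fst w) (snd w) HA HD Ru).
  - intros w. destruct (Hw w) as [g [Rg Eg]]. split.
    + intros a z Hz. destruct (regular_partial A B C D g a HA HD Rg) as [g' [Rg' Dg']].
      exists (g' z). now apply partial_ext_disk with g.
    + exists g. split; [|exact Eg]. apply continuous_on_continuity_2d. intros z _.
      exact (regular_continuity_2d A B C D g (fst z) (snd z) HA HD Rg).
  - assert (P1 : forall a z, disk z -> partial a u z =
      - ((2 * A * coord a z + match a with X_axis => B | Y_axis => C end) * / q z)).
    { intros a z Hz. apply is_derive_unique. apply partial_ext_disk with (fun z => - ln (q z)); auto.
      { intros w Hw'. rewrite Hu'; [ring|auto]. }
      pose proof (quadric_partial A B C D a z) as Hq. pose proof (qpos z) as Hp.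
      rewrite <- (slice_coord a q z) in Hp |- *.
      destruct a; apply (@is_derive_opp R_AbsRing R_NormedModule), is_derive_ln_comp; auto. }
    assert (P2 : forall a z, disk z -> partial a (partial a u) z =
      - (2 * A * / q z - (2 * A * coord a z + match a with X_axis => B | Y_axis => C end) ^ 2 * (/ q z * / q z))).
    { intros a z Hz. apply is_derive_unique.
      apply partial_ext_disk with (fun z => - ((2 * A * coord a z + match a with X_axis => B | Y_axis => C end) * / q z)); auto.
      pose proof (quadric_partial A B C D a z) as Hq. pose proof (qpos z) as Hp.
      rewrite <- (slice_coord a q z) in Hp |- *.
      apply is_derive_inv_comp in Hq; [|fold q; lra]. fold q in Hq.
      set (bc := match a with X_axis => B | Y_axis => C end) in *.
      assert (Hlin : is_derive (fun t => 2 * A * t + bc) (coord a z) (2 * A)) by (auto_derive; auto; ring).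
      pose proof (@is_derive_opp R_AbsRing R_NormedModule _ _ _ (Derive.is_derive_mult _ _ _ _ _ Hlin Hq)) as HH.
      destruct a; (eapply is_derive_ext; [|refine (eq_rect _ (fun l => is_derive _ _ l) HH _ _)];
        [intros t; reflexivity|unfold opp; simpl; ring]). }
    intros z Hz. unfold laplacian. rewrite !P2 by auto.
    rewrite Hu' by auto. replace (2 * (-1 * ln (q z))) with (- (ln (q z) + ln (q z))) by ring.
    rewrite exp_Ropp, exp_plus, exp_ln by auto.
    pose proof (qpos z) as Hp.
    (* This is [q * laplacian q = |grad q|^2 + 1], the equation for [u = - ln q] multiplied by
       [q^2]. *)
    assert (E : 4 * A * q z = (2 * A * fst z + B) ^ 2 + (2 * A * snd z + C) ^ 2 + 1).
    { unfold q, quadric. replace 1 with (4 * A * D - B ^ 2 - C ^ 2) by lra. ring. }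
    unfold coord, Re, Im. apply Rmult_eq_reg_r with (q z * q z); [|nra].
    rewrite Rinv_l by nra. rewrite Ropp_mult_distr_l_reverse.
    transitivity (4 * A * q z - (2 * A * fst z + B) ^ 2 - (2 * A * snd z + C) ^ 2); [field; lra|lra].
  - intros z Hz. unfold circle in Hz. pose proof (qpos z) as Hp.
    (* The radial derivative of [q] on the circle is [2 A + B x + C y], which equals [q - 1] because
       [D - A = 1]; so this value is [-1 + 1 / q]. *)
    exists (- (2 * A + (B * fst z + C * snd z)) / q z).
    assert (Hz2 : fst z ^ 2 + snd z ^ 2 = 1) by (rewrite <- Cmod_sqr, Hz; ring).
    assert (Eq : q z = A + (B * fst z + C * snd z) + D) by (unfold q, quadric; rewrite Hz2; ring).
    assert (Hcd : closed_disk z) by (unfold closed_disk; lra).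
    split.
    + set (b := B * fst z + C * snd z) in *.
      assert (Hline : forall h, q (RtoC (1 + h) * z)%C = A * (1 + h) ^ 2 + b * (1 + h) + D).
      { intros h. unfold q, quadric, b, Cmult, RtoC; simpl fst; simpl snd.
        replace (((1 + h) * fst z - 0 * snd z) ^ 2 + ((1 + h) * snd z + 0 * fst z) ^ 2)
          with ((1 + h) ^ 2 * (fst z ^ 2 + snd z ^ 2)) by ring. rewrite Hz2. ring. }
      assert (Hd : derivable_pt_lim (fun h => - ln (A * (1 + h) ^ 2 + b * (1 + h) + D)) 0 (- (2 * A + b) / q z)).
      { apply is_derive_Reals. auto_derive.
        - replace (A * ((1 + 0) * ((1 + 0) * 1)) + b * (1 + 0) + D) with (q z) by (rewrite Eq; ring). auto.
        - rewrite Eq. field. rewrite Eq in Hp. lra. }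
      apply filterlim_locally. intros eps. destruct (Hd eps (cond_pos eps)) as [d Hd'].
      (* The bound 1 keeps [1 + h] nonnegative, so the point on the radius stays in the closed disk,
         where [u] is known. *)
      assert (Hd1 : 0 < Rmin d 1) by (apply Rmin_glb_lt; [apply cond_pos|lra]).
      exists (mkposreal _ Hd1). intros h Hh Hh0. apply Rabs_def2 in Hh. simpl in Hh.
      unfold minus, plus, opp in Hh; simpl in Hh.
      pose proof (Rmin_l d 1). pose proof (Rmin_r d 1).
      assert (Hin : closed_disk (RtoC (1 + h) * z)%C).
      { unfold closed_disk. rewrite Cmod_mult, Cmod_R, Hz, Rabs_pos_eq; lra. }
      rewrite (Hu _ Hin), (Hu _ Hcd), Hline.
      specialize (Hd' h ltac:(lra) ltac:(apply Rabs_def1; lra)). rewrite Rplus_0_l in Hd'.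
      replace (A * (1 + 0) ^ 2 + b * (1 + 0) + D) with (q z) in Hd' by (rewrite Eq; ring).
      exact Hd'.
    + rewrite Hu by auto. rewrite exp_Ropp, exp_ln by auto. 
      apply Rmult_eq_reg_r with (q z); [|lra]. rewrite Rinv_l by lra.
      transitivity (- (2 * A + (B * fst z + C * snd z)) + q z); [field; lra|]. rewrite Eq. lra.
Qed.

(** * Bubbles of Mobius maps *)

Lemma radius_bounds : 0 < radius < 1.
Proof.
  unfold radius. assert (1 < sqrt 2) by (rewrite <- sqrt_1; apply sqrt_lt_1_alt; lra).
  assert (sqrt 2 < 2); [|lra]. rewrite <- (sqrt_square 2) at 2 by lra. apply sqrt_lt_1_alt. lra.
Qed.

Lemma radius_eq : radius ^ 2 + 2 * radius = 1.
Proof. unfold radius. pose proof (sqrt_sqrt 2 ltac:(lra)). nra. Qed.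

(* Equals [(1 + radius^2) / (2 radius (1 - |a|^2))], because [radius^2 + 2 radius = 1]. *)
Definition mobius_scale (a : C) : R := (radius + 1) / (1 - Cmod a ^ 2).

(** This is [e^{-u}] for the bubble of [mobius a], expanded. With [k] the scale, the outer
    coefficients are [k - 1 / (2 R)] and [k - R / 2]; the first is rewritten by [1 / R = R + 2]. *)
Definition mobius_quadric (a : C) : C -> R :=
  quadric (mobius_scale a - (radius + 2) / 2) (- 2 * mobius_scale a * fst a)
    (- 2 * mobius_scale a * snd a) (mobius_scale a - radius / 2).

Lemma mobius_scale_eq (a : C) : disk a -> mobius_scale a * (1 - Cmod a ^ 2) = radius + 1 /\ 0 < 1 - Cmod a ^ 2.
Proof.
  unfold disk. intros Ha. pose proof (Cmod_ge_0 a). assert (0 < 1 - Cmod a ^ 2) by nra.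
  split; [|auto]. unfold mobius_scale. field. lra.
Qed.

Lemma mobius_quadric_coefficients (a : C) : disk a ->
  let k := mobius_scale a in
  0 < k - (radius + 2) / 2 /\ (k - radius / 2) - (k - (radius + 2) / 2) = 1 /\
  4 * (k - (radius + 2) / 2) * (k - radius / 2) = 1 + (- 2 * k * fst a) ^ 2 + (- 2 * k * snd a) ^ 2.
Proof.
  intros Ha k. destruct (mobius_scale_eq a Ha) as [E P]. fold k in E.
  pose proof radius_bounds. pose proof radius_eq.
  rewrite Cmod_sqr in E, P.
  assert (radius + 1 <= k).
  { assert (0 < k) by (apply Rmult_lt_reg_r with (1 - (fst a ^ 2 + snd a ^ 2)); lra).
    pose proof (pow2_ge_0 (fst a)). pose proof (pow2_ge_0 (snd a)). nra. }
  repeat split; [lra|lra|].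
  (* The final 1 is [radius * (radius + 2)]. Replacing [radius + 1] by [k * (1 - |a|^2)] leaves
     [1 + 4 k^2 |a|^2]. *)
  transitivity (4 * k ^ 2 - 4 * k * (radius + 1) + 1); [nra|]. rewrite <- E. ring.
Qed.

Lemma mobius_quadric_pos (a z : C) : disk a -> 0 < mobius_quadric a z.
Proof.
  intros Ha. destruct (mobius_quadric_coefficients a Ha) as (H1 & _ & H2). now apply quadric_pos.
Qed.

Lemma mobius_quadric_formula (a z : C) : disk a ->
  mobius_quadric a z * (2 * radius * (1 - Cmod a ^ 2)) =
  Cmod (1 - Cconj a * z)%C ^ 2 + radius ^ 2 * Cmod (z - a)%C ^ 2.
Proof.
  intros Ha. destruct (mobius_scale_eq a Ha) as [E P].
  pose proof radius_eq as HR. unfold mobius_quadric, quadric. set (k := mobius_scale a) in *.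
  rewrite !Cmod_sqr in *. destruct a as [p q], z as [x y].
  unfold Cminus, Cplus, Copp, Cconj, Cmult, RtoC; simpl fst in *; simpl snd in *.
  set (s := 1 - (p ^ 2 + q ^ 2)) in *.
  transitivity (2 * radius * (k * s) * (x ^ 2 + y ^ 2 - 2 * p * x - 2 * q * y + 1)
    - radius * (radius + 2) * s * (x ^ 2 + y ^ 2) - radius ^ 2 * s); [field|].
  rewrite E. replace (radius * (radius + 2)) with 1 by lra.
  replace (2 * radius * (radius + 1)) with (1 + radius ^ 2) by lra. unfold s. ring.
Qed.

Definition mobius_slope (a z : C) : C :=
  ((1 - Cconj a * a) / ((1 - Cconj a * z) * (1 - Cconj a * z)))%C.

(** Only the value and derivative of [Psi] at [z] enter, so this applies both to an extension at a
    point of the circle and to an automorphism inside the disk. The rotation [c] disappears from the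
    moduli. *)
Lemma bubble_mobius (a c : C) (Psi : C -> C) (z : C) :
  disk a -> Cmod c = 1 -> closed_disk z -> Psi z = (c * mobius a z)%C ->
  is_C_derive Psi z (c * mobius_slope a z)%C -> bubble Psi z = - ln (mobius_quadric a z).
Proof.
  intros Ha Hc Hz E Hd. unfold bubble. rewrite (is_C_derive_unique _ _ _ Hd), E.
  rewrite !Cmod_mult, Hc. unfold mobius_slope, mobius.
  assert (Hn : (1 - Cconj a * z)%C <> 0%C) by now apply mobius_den_closed_disk.
  assert (Hn2 : ((1 - Cconj a * z) * (1 - Cconj a * z))%C <> 0%C) by now apply Cmult_neq_0.
  rewrite !Cmod_div, Cmod_mult by auto.
  pose proof (proj1 (Cmod_gt_0 _) Hn) as Hp.
  pose proof (mobius_quadric_formula a z Ha) as F. pose proof (mobius_quadric_pos a z Ha) as Q.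
  destruct (mobius_scale_eq a Ha) as [_ P]. pose proof radius_bounds.
  assert (Es : Cmod (1 - Cconj a * a)%C = 1 - Cmod a ^ 2).
  { rewrite <- (Rabs_pos_eq (1 - Cmod a ^ 2)) by lra. rewrite <- Cmod_R. f_equal.
    rewrite Cmod_sqr. destruct a. unfold Cminus, Cplus, Copp, Cconj, Cmult, RtoC; simpl. f_equal; ring. }
  rewrite Es. rewrite <- ln_Rinv by auto. f_equal.
  set (m := Cmod (1 - Cconj a * z)%C) in *. set (n := Cmod (z - a)%C) in *. set (s := 1 - Cmod a ^ 2) in *.
  assert (Hs : 0 < 2 * radius * s) by (repeat apply Rmult_lt_0_compat; lra).
  replace (mobius_quadric a z) with ((m ^ 2 + radius ^ 2 * n ^ 2) / (2 * radius * s))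
    by (rewrite <- F; field; lra).
  assert (0 < m ^ 2) by now apply pow_lt.
  pose proof (pow2_ge_0 (radius * n)).
  assert (Hsum : 0 < m ^ 2 + radius ^ 2 * n ^ 2) by nra.
  field. repeat split; lra.
Qed.

Lemma mobius_rotated_derive (a c z : C) : (1 - Cconj a * z)%C <> 0%C ->
  is_C_derive (fun w => c * mobius a w)%C z (c * mobius_slope a z)%C.
Proof.
  intros H. eapply is_C_derive_value.
  - apply (is_C_derive_mult (fun _ => c) (mobius a)); [apply is_C_derive_const|now apply mobius_derive].
  - unfold mobius_slope. cbv beta. ring.
Qed.

Lemma mobius_rotated_extension (a c : C) (psi : C -> C) :
  disk a -> (forall z, disk z -> psi z = (c * mobius a z)%C) ->
  holomorphic_extension psi (fun w => c * mobius a w)%C.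
Proof.
  intros Ha E. exists (fun z => Cmod z < 2 / (1 + Cmod a)). unfold disk in Ha. pose proof (Cmod_ge_0 a) as Pa.
  split; [|split; [|split]].
  - intros z Hz. now apply locally_Cmod_lt.
  - intros z Hz. unfold closed_disk in Hz. apply Rle_lt_trans with (1 := Hz).
    apply Rmult_lt_reg_r with (1 + Cmod a); [lra|]. unfold Rdiv. rewrite Rmult_assoc, Rinv_l; lra.
  - intros z Hz. exists (c * mobius_slope a z)%C. apply mobius_rotated_derive, mobius_den.
    pose proof (Cmod_ge_0 z).
    apply (Rmult_lt_compat_r (1 + Cmod a)) in Hz; [|lra].
    unfold Rdiv in Hz. rewrite Rmult_assoc, Rinv_l in Hz by lra. nra.
  - intros z Hz. now rewrite E.
Qed.

(* On the circle, the difference quotients along the radius determine value and derivative. *)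
Lemma derive_determined_by_disk (f g : C -> C) (z l k : C) :
  closed_disk z -> (forall w, disk w -> f w = g w) -> is_C_derive f z l -> is_C_derive g z k ->
  f z = g z /\ l = k.
Proof.
  intros Hz Hfg Hf Hg.
  destruct (Rle_lt_or_eq_dec _ _ Hz) as [Hlt|Hz1].
  - split; [now apply Hfg|].
    assert (Hg' : is_C_derive g z l).
    { apply is_C_derive_ext_loc with f; [|exact Hf].
      apply filter_imp with (2 := locally_Cmod_lt z 1 Hlt). exact Hfg. }
    now rewrite <- (is_C_derive_unique _ _ _ Hg), <- (is_C_derive_unique _ _ _ Hg').
  - pose proof (is_C_derive_minus _ _ _ _ _ Hf Hg) as H.
    assert (Hray : forall eps, 0 < eps -> exists d, 0 < d /\ forall t, 0 < t < d ->
      Cmod (f z - g z - t * (z * (l - k))) <= eps * t).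
    { intros eps He. destruct (proj1 (is_C_derive_eps _ _ _) H eps He) as [d [Hd H']].
      exists (Rmin d 1). split; [apply Rmin_glb_lt; lra|]. intros t [Ht Ht'].
      apply Rmin_Rgt_l in Ht'. specialize (H' (RtoC (1 - t) * z)%C).
      replace (RtoC (1 - t) * z - z)%C with (RtoC (- t) * z)%C in H'
        by (rewrite RtoC_minus, RtoC_opp; ring).
      rewrite Cmod_mult, Cmod_R, Hz1, Rabs_Ropp, Rabs_pos_eq, Rmult_1_r in H' by lra.
      rewrite Hfg in H' by (unfold disk; rewrite Cmod_mult, Cmod_R, Hz1, Rabs_pos_eq; lra).
      replace (f z - g z - t * (z * (l - k)))%C
        with (- (g (RtoC (1 - t) * z) - g (RtoC (1 - t) * z) - (f z - g z) - RtoC (- t) * z * (l - k)))%C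
        by (rewrite RtoC_opp; ring).
      rewrite Cmod_opp. apply H'. lra. }
    (* As [t] tends to 0 the constant term must vanish first; dividing by [t] then removes the
       slope. *)
    assert (E0 : Cmod (f z - g z)%C = 0).
    { apply Rle_antisym; [|apply Cmod_ge_0]. apply Rnot_lt_le. intros Hpos.
      destruct (Hray 1 ltac:(lra)) as [d [Hd H']].
      set (m := Cmod (z * (l - k))%C) in *. assert (Hm : 0 <= m) by apply Cmod_ge_0.
      set (t := Rmin (d / 2) (Cmod (f z - g z)%C / (2 * (1 + m)))).
      assert (Hq : 0 < Cmod (f z - g z)%C / (2 * (1 + m))) by (apply Rdiv_lt_0_compat; lra).
      assert (Ht : 0 < t < d /\ t <= Cmod (f z - g z)%C / (2 * (1 + m))).
      { unfold t. pose proof (Rmin_l (d / 2) (Cmod (f z - g z)%C / (2 * (1 + m)))).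
        split; [split; [apply Rmin_glb_lt; lra|lra]|apply Rmin_r]. }
      destruct Ht as [Ht Ht2]. specialize (H' t Ht).
      pose proof (Cmod_triangle_sub (f z - g z) (t * (z * (l - k)))) as T.
      rewrite (Cmod_mult t), Cmod_R, Rabs_pos_eq in T by lra. fold m in T.
      apply (Rmult_le_compat_r (2 * (1 + m))) in Ht2; [|lra].
      replace (Cmod (f z - g z) / (2 * (1 + m)) * (2 * (1 + m))) with (Cmod (f z - g z)%C) in Ht2 by (field; lra).
      nra. }
    apply Cmod_eq_0 in E0.
    assert (E1 : Cmod (l - k)%C = 0).
    { apply Rle_antisym; [|apply Cmod_ge_0]. apply Rnot_lt_le. intros Hpos.
      destruct (Hray (Cmod (l - k)%C / 2) ltac:(lra)) as [d [Hd H']].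
      specialize (H' (d / 2) ltac:(lra)). rewrite E0 in H'.
      replace (0 - RtoC (d / 2) * (z * (l - k)))%C with (- (RtoC (d / 2) * (z * (l - k))))%C in H' by ring.
      rewrite Cmod_opp, !Cmod_mult, Cmod_R, Hz1, Rabs_pos_eq in H' by lra. nra. }
    apply Cmod_eq_0 in E1. split.
    + replace (f z) with (f z - g z + g z)%C by ring. rewrite E0. ring.
    + replace l with (l - k + k)%C by ring. rewrite E1. ring.
Qed.

(** Any holomorphic extension agrees on the closed disk, together with its derivative, with the
    rotated Mobius map; so the extension chosen in [given_by] does not affect [u]. *)
Lemma given_by_mobius (a c : C) (psi : C -> C) (u : C -> R) :
  disk a -> Cmod c = 1 -> (forall z, disk z -> psi z = (c * mobius a z)%C) ->
  given_by psi u <-> forall z, closed_disk z -> u z = - ln (mobius_quadric a z).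
Proof.
  intros Ha Hc E. split.
  - intros (Psi & (U & _ & HU & Hol & Ext) & Hu) z Hz. rewrite Hu by auto.
    destruct (Hol z (HU z Hz)) as [l Hl].
    pose proof (mobius_rotated_derive a c z (mobius_den_closed_disk a z Ha Hz)) as Hm.
    destruct (derive_determined_by_disk Psi _ z _ _ Hz
      (fun w hw => eq_trans (Ext w hw) (E w hw)) Hl Hm) as [Ev El].
    rewrite El in Hl. now apply bubble_mobius with c.
  - intros Hu. exists (fun w => c * mobius a w)%C. split; [now apply mobius_rotated_extension|].
    intros z Hz. rewrite Hu by auto. symmetry. apply bubble_mobius with c; auto.
    apply mobius_rotated_derive. now apply mobius_den_closed_disk.
Qed.

Lemma mobius_automorphism (a : C) : disk a -> disk_automorphism (mobius a).
Proof.
  assert (Hol : forall b, disk b -> holomorphic_on disk (mobius b)).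
  { intros b Hb z Hz. eexists. apply mobius_derive, mobius_den_closed_disk; unfold disk, closed_disk in *; lra. }
  intros Ha. pose proof (disk_opp a Ha) as Ha'.
  split; [|split]; auto.
  - intros z. now apply mobius_disk.
  - exists (mobius (- a)). repeat split; auto.
    + intros z. now apply mobius_disk.
    + intros z Hz. now apply mobius_inverse.
    + intros z Hz. replace a with (- - a)%C at 1 by ring. now apply mobius_inverse.
Qed.

Lemma quadric_is_mobius_quadric (A B C D : R) :
  0 < A -> D - A = 1 -> 4 * A * D = 1 + B ^ 2 + C ^ 2 ->
  exists a, disk a /\ forall z, quadric A B C D z = mobius_quadric a z.
Proof.
  intros HA HDA HD. pose proof radius_bounds. pose proof radius_eq as HR.
  (* Read off from the coefficients of [mobius_quadric]: the leading one determines the scale [k],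
     and the linear ones then determine [a]. The relation [E] shows both that [k] is the scale of
     [a] and that [a] lies in the disk. *)
  set (k := A + (radius + 2) / 2). assert (Hk : 0 < k) by (unfold k; lra).
  exists ((- B / (2 * k), - C / (2 * k)) : Complex.C).
  set (a := (- B / (2 * k), - C / (2 * k)) : Complex.C).
  assert (E : k * (1 - Cmod a ^ 2) = radius + 1).
  { rewrite Cmod_sqr. unfold a; simpl fst; simpl snd.
    apply Rmult_eq_reg_r with (4 * k); [|lra].
    transitivity (4 * k ^ 2 - (B ^ 2 + C ^ 2)); [field; lra|].
    replace (B ^ 2 + C ^ 2) with (4 * A * (A + 1) - 1) by (replace (A + 1) with D by lra; lra).
    unfold k. nra. }
  assert (Ha : 0 < 1 - Cmod a ^ 2) by (apply Rmult_lt_reg_l with k; lra).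
  assert (Es : mobius_scale a = k) by (unfold mobius_scale; rewrite <- E; field; lra).
  split; [unfold disk; pose proof (Cmod_ge_0 a); nra|].
  intros z. unfold mobius_quadric. rewrite Es. unfold quadric, a; simpl fst; simpl snd.
  replace D with (A + 1) by lra. replace A with (k - (radius + 2) / 2) by (unfold k; ring). field. lra.
Qed.

Lemma mobius_quadric_injective (a b : C) : disk a -> disk b ->
  (forall z, disk z -> mobius_quadric a z = mobius_quadric b z) -> a = b.
Proof.
  intros Ha Hb H.
  assert (D1 : forall x y, x ^ 2 + y ^ 2 < 1 -> disk (x, y)).
  { intros x y h. unfold disk. pose proof (Cmod_sqr (x, y)) as E. simpl fst in E; simpl snd in E.
    pose proof (Cmod_ge_0 (x, y)). nra. }
  (* The origin determines the scale; given the scale, one point on each axis determines a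
     coordinate. *)
  pose proof (H (0, 0) (D1 0 0 ltac:(lra))) as H0.
  pose proof (H (1/2, 0) (D1 (1/2) 0 ltac:(lra))) as H1.
  pose proof (H (0, 1/2) (D1 0 (1/2) ltac:(lra))) as H2.
  unfold mobius_quadric, quadric in H0, H1, H2. simpl fst in *; simpl snd in *.
  assert (Ek : mobius_scale a = mobius_scale b) by lra. rewrite Ek in H1, H2.
  destruct (mobius_scale_eq b Hb) as [E P]. pose proof radius_bounds.
  assert (Hk : mobius_scale b <> 0) by (intros Z; rewrite Z in E; lra).
  rewrite (surjective_pairing a), (surjective_pairing b).
  f_equal; apply Rmult_eq_reg_l with (mobius_scale b); auto; lra.
Qed.

Lemma unit_circle_angle (c : C) : Cmod c = 1 -> exists theta, c = (cos theta, sin theta).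
Proof.
  intros H. pose proof (Cmod_sqr c) as E. rewrite H in E. destruct c as [x y]. simpl fst in E. simpl snd in E.
  assert (Hx : -1 <= x <= 1) by nra.
  assert (Es : sqrt (1 - Rsqr x) = Rabs y).
  { rewrite <- sqrt_Rsqr_abs. f_equal. unfold Rsqr. lra. }
  destruct (Rle_dec 0 y) as [h|h].
  - exists (acos x). rewrite cos_acos, sin_acos, Es, Rabs_pos_eq by lra. reflexivity.
  - exists (- acos x). rewrite cos_neg, sin_neg, cos_acos, sin_acos, Es, Rabs_left by lra. f_equal. ring.
Qed.

(** * Gradients on the disk and boundary values *)

(** Total differentiability, so that products, [exp] and composition with radii and circles need no
    continuity of the partial derivatives. *)
Definition has_gradient (f fx fy : C -> R) : Prop :=
  forall x y, disk (x, y) -> differentiable_pt_lim (fun u v => f (u, v)) x y (fx (x, y)) (fy (x, y)).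

Lemma locally_2d_disk (x y : R) (P : C -> Prop) :
  disk (x, y) -> (forall z, disk z -> P z) -> locally_2d (fun u v => P (u, v)) x y.
Proof.
  intros Hz HP. destruct (locally_Cmod_lt (x, y) 1 Hz) as [d Hd]. exists d.
  intros u v Hu Hv. apply HP, Hd. now split.
Qed.

Lemma has_gradient_ext (f g fx fy gx gy : C -> R) :
  (forall z, disk z -> f z = g z) -> (forall z, disk z -> fx z = gx z) -> (forall z, disk z -> fy z = gy z) ->
  has_gradient f fx fy -> has_gradient g gx gy.
Proof.
  intros E Ex Ey H x y Hz. rewrite <- Ex, <- Ey by auto.
  apply differentiable_pt_lim_ext with (2 := H x y Hz).
  now apply (locally_2d_disk x y (fun z => f z = g z)).
Qed.

Lemma has_gradient_unique (f fx fy gx gy : C -> R) :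
  has_gradient f fx fy -> has_gradient f gx gy -> forall z, disk z -> fx z = gx z /\ fy z = gy z.
Proof.
  intros H1 H2 [x y] Hz.
  destruct (differentiable_pt_lim_unique _ _ _ _ _ (H1 x y Hz)) as [<- <-].
  exact (differentiable_pt_lim_unique _ _ _ _ _ (H2 x y Hz)).
Qed.

Lemma has_gradient_continuity (f fx fy : C -> R) (x y : R) :
  has_gradient f fx fy -> disk (x, y) -> continuity_2d_pt (fun u v => f (u, v)) x y.
Proof. intros H Hz. eapply differentiable_lim_continuity. now apply H. Qed.

Lemma has_gradient_const (c : R) : has_gradient (fun _ => c) (fun _ => 0) (fun _ => 0).
Proof.
  intros x y _. apply (differentiable_pt_lim_proj1_0 (fun _ => c)). apply derivable_pt_lim_const.
Qed.

Lemma has_gradient_fst : has_gradient fst (fun _ => 1) (fun _ => 0).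
Proof. intros x y _. apply (differentiable_pt_lim_proj1_0 (fun t => t)). apply derivable_pt_lim_id. Qed.

Lemma has_gradient_snd : has_gradient snd (fun _ => 0) (fun _ => 1).
Proof.
  intros x y _. simpl. intros e. exists e. intros u v _ _.
  replace (v - y - (0 * (u - x) + 1 * (v - y))) with 0 by ring. rewrite Rabs_R0.
  apply Rmult_le_pos; [apply Rlt_le, cond_pos|]. apply Rle_trans with (1 := Rabs_pos (u - x)), Rmax_l.
Qed.

Lemma has_gradient_plus (f g fx fy gx gy : C -> R) :
  has_gradient f fx fy -> has_gradient g gx gy ->
  has_gradient (fun z => f z + g z) (fun z => fx z + gx z) (fun z => fy z + gy z).
Proof.
  intros Hf Hg x y Hz.
  replace (fx (x, y) + gx (x, y)) with (1 * fx (x, y) + 1 * gx (x, y)) by ring.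
  replace (fy (x, y) + gy (x, y)) with (1 * fy (x, y) + 1 * gy (x, y)) by ring.
  apply (differentiable_pt_lim_comp (fun u v => u + v)); [|now apply Hf|now apply Hg].
  apply (differentiable_of_partials (fun u v => u + v) (fun _ _ => 1) (fun _ _ => 1)).
  - exists (mkposreal 1 Rlt_0_1). intros u v _ _. auto_derive; auto.
  - exists (mkposreal 1 Rlt_0_1). intros u v _ _. auto_derive; auto.
  - apply continuity_2d_pt_const.
  - apply continuity_2d_pt_const.
Qed.

Lemma has_gradient_mult (f g fx fy gx gy : C -> R) :
  has_gradient f fx fy -> has_gradient g gx gy ->
  has_gradient (fun z => f z * g z) (fun z => fx z * g z + f z * gx z) (fun z => fy z * g z + f z * gy z).
Proof.
  intros Hf Hg x y Hz.
  replace (fx (x, y) * g (x, y)) with (g (x, y) * fx (x, y)) by ring.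
  replace (fy (x, y) * g (x, y)) with (g (x, y) * fy (x, y)) by ring.
  apply (differentiable_pt_lim_comp (fun u v => u * v)); [|now apply Hf|now apply Hg].
  apply (differentiable_of_partials (fun u v => u * v) (fun _ v => v) (fun u _ => u)).
  - exists (mkposreal 1 Rlt_0_1). intros u v _ _. auto_derive; auto. ring.
  - exists (mkposreal 1 Rlt_0_1). intros u v _ _. auto_derive; auto. ring.
  - apply continuity_2d_pt_id2.
  - apply continuity_2d_pt_id1.
Qed.

Lemma has_gradient_exp (f fx fy : C -> R) :
  has_gradient f fx fy ->
  has_gradient (fun z => exp (f z)) (fun z => exp (f z) * fx z) (fun z => exp (f z) * fy z).
Proof.
  intros Hf x y Hz.
  replace (exp (f (x, y)) * fx (x, y)) with (exp (f (x, y)) * fx (x, y) + 0 * fx (x, y)) by ring.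
  replace (exp (f (x, y)) * fy (x, y)) with (exp (f (x, y)) * fy (x, y) + 0 * fy (x, y)) by ring.
  apply (differentiable_pt_lim_comp (fun u _ => exp u) (fun u v => f (u, v)) (fun u v => f (u, v)));
    [|now apply Hf|now apply Hf].
  apply differentiable_pt_lim_proj1_0. apply derivable_pt_lim_exp.
Qed.

Lemma has_gradient_zero_constant (f : C -> R) :
  has_gradient f (fun _ => 0) (fun _ => 0) -> forall z, disk z -> f z = f (0, 0).
Proof.
  intros H [x y] Hz.
  replace (x, y) with (1 * x, 1 * y) by (f_equal; ring).
  replace (0, 0) with (0 * x, 0 * y) by (f_equal; ring).
  apply (zero_derivative_constant (fun t => f (t * x, t * y)) 0 1); [lra|]. intros t Ht.
  assert (Hin : disk (t * x, t * y)).
  { replace (t * x, t * y) with (RtoC t * (x, y))%C by (unfold Cmult, RtoC; simpl; f_equal; ring).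
    unfold disk in *. rewrite Cmod_mult, Cmod_R, Rabs_pos_eq by lra. pose proof (Cmod_ge_0 (x, y)). nra. }
  assert (lin : forall p, derivable_pt_lim (fun s => s * p) t p).
  { intros p. apply is_derive_Reals. auto_derive; auto. ring. }
  apply is_derive_Reals. replace 0 with (0 * x + 0 * y) by ring.
  exact (derivable_pt_lim_comp_2d _ (fun s => s * x) (fun s => s * y) t _ _ _ _ (H _ _ Hin) (lin x) (lin y)).
Qed.

Lemma has_gradient_schwarz (f fx fy fxx fxy fyx fyy : C -> R) :
  has_gradient f fx fy -> has_gradient fx fxx fxy -> has_gradient fy fyx fyy ->
  (forall x y, disk (x, y) -> continuity_2d_pt (fun u v => fxy (u, v)) x y) ->
  (forall x y, disk (x, y) -> continuity_2d_pt (fun u v => fyx (u, v)) x y) ->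
  forall z, disk z -> fxy z = fyx z.
Proof.
  intros H Hx Hy Cxy Cyx [x y] Hz.
  assert (Ux : forall u v, disk (u, v) -> Derive (fun t => f (t, v)) u = fx (u, v)).
  { intros u v h. apply is_derive_unique. exact (differentiable_partial_x _ _ _ _ _ (H u v h)). }
  assert (Uy : forall u v, disk (u, v) -> Derive (fun t => f (u, t)) v = fy (u, v)).
  { intros u v h. apply is_derive_unique. exact (differentiable_partial_y _ _ _ _ _ (H u v h)). }
  assert (Dxy : forall u v, disk (u, v) -> is_derive (fun z => Derive (fun t => f (t, z)) u) v (fxy (u, v))).
  { intros u v h. apply is_derive_ext_loc with (fun t => fx (u, t)).
    - apply (locally_2d_1d_const_x (fun s t => fx (s, t) = Derive (fun r => f (r, t)) s)).
      apply (locally_2d_disk u v (fun z => fx z = Derive (fun r => f (r, snd z)) (fst z)) h).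
      intros [s t] hs. symmetry. now apply Ux.
    - exact (differentiable_partial_y _ _ _ _ _ (Hx u v h)). }
  assert (Dyx : forall u v, disk (u, v) -> is_derive (fun z => Derive (fun t => f (z, t)) v) u (fyx (u, v))).
  { intros u v h. apply is_derive_ext_loc with (fun t => fy (t, v)).
    - apply (locally_2d_1d_const_y (fun s t => fy (s, t) = Derive (fun r => f (s, r)) t)).
      apply (locally_2d_disk u v (fun z => fy z = Derive (fun r => f (fst z, r)) (snd z)) h).
      intros [s t] hs. symmetry. now apply Uy.
    - exact (differentiable_partial_x _ _ _ _ _ (Hy u v h)). }
  rewrite <- (is_derive_unique _ _ _ (Dxy x y Hz)), <- (is_derive_unique _ _ _ (Dyx x y Hz)).
  symmetry. apply (Schwarz (fun u v => f (u, v))).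
  - apply (locally_2d_disk x y (fun w => ex_derive (fun z => f (z, snd w)) (fst w) /\
      ex_derive (fun z => f (fst w, z)) (snd w) /\
      ex_derive (fun z => Derive (fun t => f (z, t)) (snd w)) (fst w) /\
      ex_derive (fun z => Derive (fun t => f (t, z)) (fst w)) (snd w)) Hz).
    intros [u v] h. simpl fst; simpl snd. repeat split.
    + eexists. exact (differentiable_partial_x _ _ _ _ _ (H u v h)).
    + eexists. exact (differentiable_partial_y _ _ _ _ _ (H u v h)).
    + eexists. exact (Dyx u v h).
    + eexists. exact (Dxy u v h).
  - apply continuity_2d_pt_ext_loc with (2 := Cyx x y Hz).
    apply (locally_2d_disk x y (fun w => fyx w = Derive (fun z => Derive (fun t => f (z, t)) (snd w)) (fst w)) Hz).
    intros [u v] h. symmetry. now apply is_derive_unique, Dyx.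
  - apply continuity_2d_pt_ext_loc with (2 := Cxy x y Hz).
    apply (locally_2d_disk x y (fun w => fxy w = Derive (fun z => Derive (fun t => f (t, z)) (fst w)) (snd w)) Hz).
    intros [u v] h. symmetry. now apply is_derive_unique, Dxy.
Qed.

(** * Continuity and the maximum principle on the closed disk *)

Lemma continuous_on_plus (K : C -> Prop) (f g : C -> R) :
  continuous_on K f -> continuous_on K g -> continuous_on K (fun z => f z + g z).
Proof.
  intros Hf Hg z Kz. 
  eapply filterlim_comp_2; [exact (Hf z Kz)|exact (Hg z Kz)|apply (@filterlim_plus R_AbsRing R_NormedModule)].
Qed.

Lemma continuous_on_mult (K : C -> Prop) (f g : C -> R) :
  continuous_on K f -> continuous_on K g -> continuous_on K (fun z => f z * g z).
Proof.
  intros Hf Hg z Kz. 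
  eapply filterlim_comp_2; [exact (Hf z Kz)|exact (Hg z Kz)|apply (@filterlim_mult R_AbsRing)].
Qed.

Lemma continuous_on_exp (K : C -> Prop) (f : C -> R) :
  continuous_on K f -> continuous_on K (fun z => exp (f z)).
Proof.
  intros Hf z Kz. eapply filterlim_comp; [exact (Hf z Kz)|]. apply continuous_exp.
Qed.

Lemma continuous_on_const (K : C -> Prop) (c : R) : continuous_on K (fun _ => c).
Proof. apply continuous_on_continuity_2d. intros z _. apply continuity_2d_pt_const. Qed.

Lemma continuous_on_fst (K : C -> Prop) : continuous_on K fst.
Proof. apply continuous_on_continuity_2d. intros z _. apply continuity_2d_pt_id1. Qed.

Lemma continuous_on_snd (K : C -> Prop) : continuous_on K snd.
Proof. apply continuous_on_continuity_2d. intros z _. apply continuity_2d_pt_id2. Qed.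

(** It recognizes only sums, products and [exp]; functions meant for it have their differences
    written with [-1 *]. *)
Ltac solve_continuous_on :=
  lazymatch goal with
  | |- continuous_on ?K (fun z => @?f z + @?g z) =>
      apply (continuous_on_plus K f g); cbv beta; solve_continuous_on
  | |- continuous_on ?K (fun z => @?f z * @?g z) =>
      apply (continuous_on_mult K f g); cbv beta; solve_continuous_on
  | |- continuous_on ?K (fun z => exp (@?f z)) =>
      apply (continuous_on_exp K f); cbv beta; solve_continuous_on
  | |- _ => first [assumption | apply continuous_on_fst | apply continuous_on_snd | apply continuous_on_const]
  end.

Lemma continuous_on_eps (K : C -> Prop) (f : C -> R) (z : C) (eps : R) :
  continuous_on K f -> K z -> 0 < eps ->
  exists d, 0 < d /\ forall w, K w -> Cmod (w - z) < d -> Rabs (f w - f z) < eps.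
Proof.
  intros Hf Kz He. specialize (Hf z Kz). rewrite filterlim_locally in Hf.
  specialize (Hf (mkposreal _ He)). apply locally_C_Cmod in Hf. destruct Hf as [d [Hd H]].
  exists d. split; [exact Hd|]. intros w Kw Hw. exact (H w Hw Kw).
Qed.

Lemma closed_disk_shrink (z : C) (t : R) : closed_disk z -> 0 <= t < 1 -> disk (RtoC t * z)%C.
Proof.
  unfold closed_disk, disk. intros Hz Ht. rewrite Cmod_mult, Cmod_R, Rabs_pos_eq by lra.
  pose proof (Cmod_ge_0 z). nra.
Qed.

Lemma continuous_on_closure_eq (f g : C -> R) :
  continuous_on closed_disk f -> continuous_on closed_disk g -> (forall z, disk z -> f z = g z) ->
  forall z, closed_disk z -> f z = g z.
Proof.
  intros Hf Hg E z Hz. apply Rminus_diag_uniq. destruct (Req_dec (f z - g z) 0) as [|Hn]; [auto|exfalso].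
  apply Rabs_pos_lt in Hn.
  destruct (continuous_on_eps _ _ z (Rabs (f z - g z) / 2) Hf Hz ltac:(lra)) as [d1 [Hd1 H1]].
  destruct (continuous_on_eps _ _ z (Rabs (f z - g z) / 2) Hg Hz ltac:(lra)) as [d2 [Hd2 H2]].
  set (t := Rmin (1/2) (Rmin (d1 / 2) (d2 / 2))).
  assert (Ht : 0 < t <= 1 / 2 /\ t < d1 /\ t < d2).
  { unfold t. pose proof (Rmin_l (1/2) (Rmin (d1 / 2) (d2 / 2))). pose proof (Rmin_r (1/2) (Rmin (d1 / 2) (d2 / 2))).
    pose proof (Rmin_l (d1 / 2) (d2 / 2)). pose proof (Rmin_r (d1 / 2) (d2 / 2)).
    split; [split; [repeat apply Rmin_glb_lt; lra|lra]|lra]. }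
  pose proof (closed_disk_shrink z (1 - t) Hz ltac:(lra)) as Hw.
  assert (Hc : closed_disk (RtoC (1 - t) * z)%C) by (unfold closed_disk, disk in *; lra).
  assert (Hm : Cmod (RtoC (1 - t) * z - z)%C <= t).
  { replace (RtoC (1 - t) * z - z)%C with (RtoC (- t) * z)%C by (rewrite RtoC_minus, RtoC_opp; ring).
    rewrite Cmod_mult, Cmod_R, Rabs_Ropp, Rabs_pos_eq by lra. unfold closed_disk in Hz. nra. }
  specialize (H1 _ Hc ltac:(lra)). specialize (H2 _ Hc ltac:(lra)). rewrite <- (E _ Hw) in H2.
  pose proof (Rabs_triang (f z - f (RtoC (1 - t) * z)%C) (f (RtoC (1 - t) * z)%C - g z)) as T.
  replace (f z - f (RtoC (1 - t) * z)%C + (f (RtoC (1 - t) * z)%C - g z)) with (f z - g z) in T by ring.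
  rewrite (Rabs_minus_sym (f z) (f (RtoC (1 - t) * z)%C)) in T. lra.
Qed.

(** With [eps] half of a supposed positive value, [F + eps |z|^2] equals [eps] on the circle and
    exceeds it at [z1]. Its maximum is then interior, against [no_interior_max] with Laplacian
    [4 * eps]. *)
Lemma harmonic_nonpositive (f g F : C -> R) :
  (forall x y, disk (x, y) -> cauchy_riemann_at (fun u v => f (u, v)) (fun u v => g (u, v)) x y) ->
  continuous_on closed_disk F -> (forall z, disk z -> F z = f z) -> (forall z, circle z -> F z = 0) ->
  forall z, disk z -> f z <= 0.
Proof.
  intros HCR HF HFf HF0 z1 Hz1. apply Rnot_lt_le. intros Hpos.
  set (eps := f z1 / 2).
  set (k := fun z : C => F z + eps * (fst z ^ 2 + snd z ^ 2)).
  destruct (compact_argmax k closed_disk 1 z1) as [[x0 y0] [Km Hmax]].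
  - unfold disk, closed_disk in *. lra.
  - intros z Hz. unfold closed_disk in Hz. pose proof (Rmax_Cmod z).
    pose proof (Rmax_l (Rabs (fst z)) (Rabs (snd z))). pose proof (Rmax_r (Rabs (fst z)) (Rabs (snd z))). lra.
  - intros z Hn. apply Rnot_le_lt in Hn. apply filter_imp with (2 := locally_Cmod_gt z 1 Hn).
    unfold closed_disk. intros w Hw. lra.
  - unfold k. apply continuous_on_plus; [exact HF|]. simpl. solve_continuous_on.
  - assert (Hin : disk (x0, y0)).
    { destruct (Rle_lt_or_eq_dec _ _ Km) as [h|h]; [exact h|exfalso].
      assert (Hc1 : closed_disk z1) by (unfold disk, closed_disk in *; lra).
      pose proof (Hmax z1 Hc1) as Hk. unfold k in Hk. rewrite (HF0 _ h), (HFf _ Hz1), <- !Cmod_sqr, h in Hk.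
      pose proof (pow2_ge_0 (Cmod z1)). unfold eps in Hk. nra. }
    destruct (locally_Cmod_lt (x0, y0) 1 Hin) as [d Hd].
    assert (Hloc : forall x y, Rabs (x - x0) <= d / 2 -> Rabs (y - y0) <= d / 2 -> disk (x, y)).
    { intros x y h1 h2. apply Hd. pose proof (cond_pos d).
      split; [change (Rabs (x - x0) < d)|change (Rabs (y - y0) < d)]; lra. }
    apply (no_interior_max (fun x y => f (x, y)) (fun x y => g (x, y)) (fun x y => eps * (x ^ 2 + y ^ 2))
      (fun x y => eps * (2 * x)) (fun x y => eps * (2 * y)) (fun _ _ => eps * 2) (fun _ _ => eps * 2)
      x0 y0 (d / 2) (4 * eps)).
    + pose proof (cond_pos d). lra.
    + unfold eps. lra.
    + intros x y h1 h2. apply HCR. now apply Hloc.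
    + intros x y h1 h2. split; [|split; [|split; [|split; [|split]]]];
        try (auto_derive; auto; ring); [|lra].
      simpl. repeat first [apply continuity_2d_pt_mult | apply continuity_2d_pt_plus
        | apply continuity_2d_pt_id1 | apply continuity_2d_pt_id2 | apply continuity_2d_pt_const].
    + intros x y h1 h2. pose proof (Hloc x y (Rlt_le _ _ h1) (Rlt_le _ _ h2)) as Hxy.
      rewrite <- (HFf _ Hxy), <- (HFf _ Hin). apply (Hmax (x, y)). unfold disk, closed_disk in *. lra.
Qed.

Lemma harmonic_zero (f g F : C -> R) :
  (forall x y, disk (x, y) -> cauchy_riemann_at (fun u v => f (u, v)) (fun u v => g (u, v)) x y) ->
  continuous_on closed_disk F -> (forall z, disk z -> F z = f z) -> (forall z, circle z -> F z = 0) ->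
  forall z, disk z -> f z = 0.
Proof.
  intros HCR HF HFf HF0 z Hz. apply Rle_antisym.
  - exact (harmonic_nonpositive f g F HCR HF HFf HF0 z Hz).
  - apply Ropp_le_cancel. rewrite Ropp_0.
    apply (harmonic_nonpositive (fun z => - f z) (fun z => - g z) (fun z => -1 * F z)); auto.
    + intros x y h. destruct (HCR x y h) as (px & py & H1 & H2). exists (- px), (- py).
      split; now apply differentiable_opp.
    + solve_continuous_on.
    + intros w hw. rewrite HFf by auto. ring.
    + intros w hw. rewrite HF0 by auto. ring.
Qed.

(** * Tangential and normal derivatives on the circle *)

Lemma cos_lipschitz (s t : R) : Rabs (cos s - cos t) <= Rabs (s - t).
Proof.
  destruct (MVT_gen cos t s (fun x => - sin x)) as [c [_ ->]].
  - intros x _. auto_derive; auto; ring.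
  - intros x _. apply continuity_cos.
  - rewrite Rabs_mult, Rabs_Ropp. pose proof (SIN_bound c). pose proof (Rabs_pos (s - t)).
    assert (Rabs (sin c) <= 1) by (apply Rabs_le; lra). nra.
Qed.

Lemma sin_lipschitz (s t : R) : Rabs (sin s - sin t) <= Rabs (s - t).
Proof.
  destruct (MVT_gen sin t s (fun x => cos x)) as [c [_ ->]].
  - intros x _. auto_derive; auto; ring.
  - intros x _. apply continuity_sin.
  - rewrite Rabs_mult. pose proof (COS_bound c). pose proof (Rabs_pos (s - t)).
    assert (Rabs (cos c) <= 1) by (apply Rabs_le; lra). nra.
Qed.

Lemma Cmod_polar (r s : R) : 0 <= r -> Cmod (r * cos s, r * sin s) = r.
Proof.
  intros Hr. unfold Cmod; simpl fst; simpl snd.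
  replace ((r * cos s) ^ 2 + (r * sin s) ^ 2) with (r ^ 2 * (Rsqr (sin s) + Rsqr (cos s)))
    by (unfold Rsqr; ring).
  rewrite sin2_cos2, Rmult_1_r. now apply sqrt_pow2.
Qed.

(* If the angular derivative were positive at a boundary point, it would be bounded
   below near that point, and [f] would increase by a fixed amount along arcs of
   circles arbitrarily close to the unit circle. *)
Lemma tangential_derivative_nonpositive (f fx fy F Fx Fy : C -> R) :
  has_gradient f fx fy ->
  continuous_on closed_disk F -> continuous_on closed_disk Fx -> continuous_on closed_disk Fy ->
  (forall z, disk z -> F z = f z) -> (forall z, disk z -> Fx z = fx z) -> (forall z, disk z -> Fy z = fy z) ->
  (forall z, circle z -> F z = 0) ->
  forall z, circle z -> fst z * Fy z - snd z * Fx z <= 0.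
Proof.
  intros Hg HF HFx HFy E Ex Ey H0 z0 Hz0. apply Rnot_lt_le. intros Hpos.
  set (h := fun z : C => fst z * Fy z + -1 * (snd z * Fx z)).
  assert (Hh : continuous_on closed_disk h) by (unfold h; solve_continuous_on).
  assert (Hc : 0 < h z0) by (unfold h; lra).
  assert (cd : forall z, circle z -> closed_disk z) by (unfold circle, closed_disk; intros; lra).
  assert (dd : forall z, disk z -> closed_disk z) by (unfold disk, closed_disk; intros; lra).
  destruct (unit_circle_angle z0 Hz0) as [th Eth].
  destruct (continuous_on_eps _ _ z0 (h z0 / 2) Hh (cd _ Hz0) ltac:(lra)) as [d [Hd Hnear]].
  (* By [Pnear], an arc of angle [eta] at radius [r] with [1 - r < d / 8] stays within [d / 2] of
     [z0], where the angular derivative exceeds [h z0 / 2]. *)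
  set (eta := d / 8). assert (Heta : 0 < eta) by (unfold eta; lra).
  set (P := fun r s : R => (r * cos s, r * sin s) : C).
  assert (Pc : forall s, circle (P 1 s)) by (intros s; unfold circle, P; apply Cmod_polar; lra).
  assert (Pd : forall r s, 0 <= r < 1 -> disk (P r s)).
  { intros r s hr. unfold disk, P. rewrite Cmod_polar; lra. }
  assert (Pnear : forall r s t, 0 < r < 1 -> Cmod (P r s - P 1 t) <= 2 * ((1 - r) + Rabs (s - t))).
  { intros r s t hr. apply Rnot_lt_le. intros Hlt. apply (Rlt_irrefl (Cmod (P r s - P 1 t))).
    set (e := Cmod (P r s - P 1 t)%C / 2) in *.
    replace (Cmod (P r s - P 1 t)%C) with (2 * e) at 2 by (unfold e; field).
    assert (he : 1 - r + Rabs (s - t) < e) by (unfold e; lra).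
    pose proof (cos_lipschitz s t). pose proof (sin_lipschitz s t).
    unfold P. apply Cmod_square_bound.
    - replace (r * cos s - 1 * cos t) with ((cos s - cos t) - (1 - r) * cos s) by ring.
      apply Rle_lt_trans with (2 := he). apply Rle_trans with (1 := Rabs_triang _ _).
      rewrite Rabs_Ropp, Rabs_mult, (Rabs_pos_eq (1 - r)) by lra.
      assert (Rabs (cos s) <= 1) by (apply Rabs_le, COS_bound). nra.
    - replace (r * sin s - 1 * sin t) with ((sin s - sin t) - (1 - r) * sin s) by ring.
      apply Rle_lt_trans with (2 := he). apply Rle_trans with (1 := Rabs_triang _ _).
      rewrite Rabs_Ropp, Rabs_mult, (Rabs_pos_eq (1 - r)) by lra.
      assert (Rabs (sin s) <= 1) by (apply Rabs_le, SIN_bound). nra. }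
  assert (Ez0 : z0 = P 1 th) by (rewrite Eth; unfold P; f_equal; ring).
  assert (Hinc : forall r, 0 < r < 1 -> 1 - r < d / 8 -> h z0 / 2 * eta <= F (P r (th + eta)) - F (P r th)).
  { intros r hr hr'. rewrite !E by (apply Pd; lra).
    assert (Hder : forall s, is_derive (fun s => f (P r s)) s (fx (P r s) * (r * - sin s) + fy (P r s) * (r * cos s))).
    { intros s. apply is_derive_Reals.
      apply (derivable_pt_lim_comp_2d (fun u v => f (u, v)) (fun s => r * cos s) (fun s => r * sin s) s).
      - apply Hg. apply (Pd r s). lra.
      - apply is_derive_Reals. auto_derive; auto; ring.
      - apply is_derive_Reals. auto_derive; auto; ring. }
    destruct (MVT_gen (fun s => f (P r s)) th (th + eta)
      (fun s => fx (P r s) * (r * - sin s) + fy (P r s) * (r * cos s))) as [c [hc Ec]].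
    - intros s _. apply Hder.
    - intros s _. apply derivable_continuous_pt. eexists. apply is_derive_Reals, Hder.
    - rewrite Rmin_left, Rmax_right in hc by lra. rewrite Ec.
      replace (th + eta - th) with eta by ring. apply Rmult_le_compat_r; [lra|].
      assert (hd : disk (P r c)) by (apply Pd; lra).
      assert (Hn : Cmod (P r c - z0) < d).
      { rewrite Ez0. apply Rle_lt_trans with (1 := Pnear r c th hr).
        rewrite Rabs_pos_eq by lra. unfold eta in hc. lra. }
      specialize (Hnear _ (dd _ hd) Hn). apply Rabs_def2 in Hnear.
      replace (fx (P r c) * (r * - sin c) + fy (P r c) * (r * cos c)) with (h (P r c)); [lra|].
      unfold h. rewrite Ex, Ey by auto. unfold P; simpl. ring. }
  (* Both ends of the arc have values within a quarter of the guaranteed increase from the boundary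
     value 0, which is too close for that increase. *)
  assert (He : 0 < h z0 / 2 * eta / 4) by (apply Rdiv_lt_0_compat; [apply Rmult_lt_0_compat|]; lra).
  destruct (continuous_on_eps _ _ (P 1 th) _ HF (cd _ (Pc th)) He) as [d1 [Hd1 N1]].
  destruct (continuous_on_eps _ _ (P 1 (th + eta)) _ HF (cd _ (Pc (th + eta))) He) as [d2 [Hd2 N2]].
  set (r := 1 - Rmin (1 / 2) (Rmin (d / 16) (Rmin (d1 / 4) (d2 / 4)))).
  assert (Hr : 0 < r < 1 /\ 1 - r < d / 8 /\ 2 * (1 - r) < d1 /\ 2 * (1 - r) < d2).
  { unfold r. pose proof (Rmin_l (1/2) (Rmin (d / 16) (Rmin (d1 / 4) (d2 / 4)))).
    pose proof (Rmin_r (1/2) (Rmin (d / 16) (Rmin (d1 / 4) (d2 / 4)))).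
    pose proof (Rmin_l (d / 16) (Rmin (d1 / 4) (d2 / 4))). pose proof (Rmin_r (d / 16) (Rmin (d1 / 4) (d2 / 4))).
    pose proof (Rmin_l (d1 / 4) (d2 / 4)). pose proof (Rmin_r (d1 / 4) (d2 / 4)).
    assert (0 < Rmin (1 / 2) (Rmin (d / 16) (Rmin (d1 / 4) (d2 / 4)))) by (repeat apply Rmin_glb_lt; lra).
    lra. }
  destruct Hr as (hr & hr1 & hr2 & hr3).
  pose proof (Hinc r hr hr1) as Hi.
  assert (M1 : Cmod (P r th - P 1 th) < d1).
  { apply Rle_lt_trans with (1 := Pnear r th th hr). rewrite Rminus_eq_0, Rabs_R0. lra. }
  assert (M2 : Cmod (P r (th + eta) - P 1 (th + eta)) < d2).
  { apply Rle_lt_trans with (1 := Pnear r _ (th + eta) hr). rewrite Rminus_eq_0, Rabs_R0. lra. }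
  specialize (N1 _ (dd _ (Pd r th ltac:(lra))) M1). specialize (N2 _ (dd _ (Pd r (th + eta) ltac:(lra))) M2).
  rewrite (H0 _ (Pc _)) in N1. rewrite (H0 _ (Pc _)) in N2. apply Rabs_def2 in N1. apply Rabs_def2 in N2. lra.
Qed.

Lemma tangential_derivative_zero (f fx fy F Fx Fy : C -> R) :
  has_gradient f fx fy ->
  continuous_on closed_disk F -> continuous_on closed_disk Fx -> continuous_on closed_disk Fy ->
  (forall z, disk z -> F z = f z) -> (forall z, disk z -> Fx z = fx z) -> (forall z, disk z -> Fy z = fy z) ->
  (forall z, circle z -> F z = 0) ->
  forall z, circle z -> fst z * Fy z - snd z * Fx z = 0.
Proof.
  intros Hg HF HFx HFy E Ex Ey H0 z Hz. apply Rle_antisym.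
  - exact (tangential_derivative_nonpositive f fx fy F Fx Fy Hg HF HFx HFy E Ex Ey H0 z Hz).
  - apply Ropp_le_cancel. rewrite Ropp_0.
    replace (- (fst z * Fy z - snd z * Fx z)) with (fst z * (-1 * Fy z) - snd z * (-1 * Fx z)) by ring.
    apply (tangential_derivative_nonpositive (fun z => -1 * f z) (fun z => -1 * fx z) (fun z => -1 * fy z)
      (fun z => -1 * F z) (fun z => -1 * Fx z) (fun z => -1 * Fy z)); try solve [solve_continuous_on]; auto.
    + apply (has_gradient_ext (fun z => -1 * f z) _ (fun z => 0 * f z + -1 * fx z) (fun z => 0 * f z + -1 * fy z)).
      * reflexivity.
      * intros; ring.
      * intros; ring.
      * apply (has_gradient_mult (fun _ => -1)); [apply has_gradient_const|exact Hg].
    + intros w hw. now rewrite E.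
    + intros w hw. now rewrite Ex.
    + intros w hw. now rewrite Ey.
    + intros w hw. rewrite H0 by auto. ring.
Qed.

(** The mean value theorem on a radius turns the difference quotient into a value of
    [x gx + y gy]-type at a nearby point, with the direction [z] fixed; the extensions [gx], [gy]
    are continuous up to the circle. *)
Lemma normal_derivative_value (u ux uy gx gy : C -> R) (z : C) (l : R) :
  has_gradient u ux uy -> continuous_on closed_disk u ->
  continuous_on closed_disk gx -> continuous_on closed_disk gy ->
  (forall w, disk w -> gx w = ux w) -> (forall w, disk w -> gy w = uy w) ->
  circle z -> is_normal_derivative u z l -> l = fst z * gx z + snd z * gy z.
Proof.
  intros Hu Cu Cx Cy Ex Ey Hz Hl. destruct (Req_dec l (fst z * gx z + snd z * gy z)) as [|Hn]; [auto|exfalso].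
  set (G := fun w => fst z * gx w + snd z * gy w).
  assert (CG : continuous_on closed_disk G) by (unfold G; solve_continuous_on).
  fold (G z) in Hn.
  assert (He : 0 < Rabs (l - G z) / 2) by (assert (0 < Rabs (l - G z)) by (apply Rabs_pos_lt; lra); lra).
  assert (cd : closed_disk z) by (unfold circle, closed_disk in *; lra).
  assert (Hsh : forall t, 0 <= t <= 1 -> closed_disk (RtoC t * z)%C).
  { intros t Ht. unfold circle, closed_disk in *. rewrite Cmod_mult, Cmod_R, Rabs_pos_eq, Hz; lra. }
  assert (Hdist : forall t, Cmod (RtoC t * z - z)%C = Rabs (t - 1)).
  { intros t. replace (RtoC t * z - z)%C with (RtoC (t - 1) * z)%C by (rewrite RtoC_minus; ring).
    rewrite Cmod_mult, Cmod_R. unfold circle in Hz. rewrite Hz. ring. }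
  destruct (continuous_on_eps _ _ z _ CG cd He) as [d1 [Hd1 H1]].
  unfold is_normal_derivative in Hl. rewrite filterlim_locally in Hl.
  destruct (Hl (mkposreal _ He)) as [d2 H2].
  set (t := Rmin (1 / 2) (Rmin (d1 / 2) (d2 / 2))).
  assert (Ht : 0 < t <= 1 / 2 /\ t < d1 /\ t < d2).
  { pose proof (cond_pos d2).
    unfold t. pose proof (Rmin_l (1/2) (Rmin (d1 / 2) (d2 / 2))). pose proof (Rmin_r (1/2) (Rmin (d1 / 2) (d2 / 2))).
    pose proof (Rmin_l (d1 / 2) (d2 / 2)). pose proof (Rmin_r (d1 / 2) (d2 / 2)).
    split; [split; [repeat apply Rmin_glb_lt; lra|lra]|lra]. }
  specialize (H2 (- t)). change (Rabs (- t - 0) < d2 -> - t < 0 ->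
    Rabs ((u (RtoC (1 + - t) * z)%C - u z) / - t - l) < Rabs (l - G z) / 2) in H2.
  rewrite Rminus_0_r, Rabs_Ropp, Rabs_pos_eq in H2 by lra.
  specialize (H2 ltac:(lra) ltac:(lra)).
  (* Values of [u] outside the closed disk are arbitrary, yet [MVT_gen] asks for two-sided
     continuity at the end point 1; truncation at 1 provides it. *)
  set (phi := fun s => u (RtoC (Rmin s 1) * z)%C).
  assert (Hder : forall s, 0 < s < 1 -> is_derive phi s (G (RtoC s * z)%C)).
  { intros s Hs. apply is_derive_ext_loc with (fun s => u (s * fst z, s * snd z)).
    - exists (mkposreal (1 - s) ltac:(lra)). intros r Hr. apply Rabs_def2 in Hr. simpl in Hr.
      unfold minus, plus, opp in Hr; simpl in Hr. unfold phi. rewrite Rmin_left by lra.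
      f_equal. unfold Cmult, RtoC; simpl. f_equal; ring.
    - pose proof (closed_disk_shrink z s cd ltac:(lra)) as Hin.
      unfold G. rewrite Ex, Ey by auto.
      replace (RtoC s * z)%C with (s * fst z, s * snd z) in * by (unfold Cmult, RtoC; simpl; f_equal; ring).
      assert (lin : forall p, derivable_pt_lim (fun s => s * p) s p).
      { intros p. apply is_derive_Reals. auto_derive; auto. ring. }
      apply is_derive_Reals. rewrite (Rmult_comm (fst z)), (Rmult_comm (snd z)).
      exact (derivable_pt_lim_comp_2d _ (fun s => s * fst z) (fun s => s * snd z) s _ _ _ _ (Hu _ _ Hin) (lin _) (lin _)). }
  destruct (MVT_gen phi (1 - t) 1 (fun s => G (RtoC s * z)%C)) as [c [Hc Ec]].
  - intros s. rewrite Rmin_left, Rmax_right by lra. intros Hs. apply Hder. lra.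
  - intros s. rewrite Rmin_left, Rmax_right by lra. intros Hs.
    destruct (Rle_lt_or_eq_dec s 1 ltac:(lra)) as [h|h].
    + apply derivable_continuous_pt. eexists. apply is_derive_Reals, Hder. lra.
    + subst s. apply continuity_pt_filterlim, filterlim_locally. intros eps.
      destruct (continuous_on_eps _ _ z eps Cu cd (cond_pos eps)) as [d3 [Hd3 H3]].
      exists (mkposreal (Rmin d3 1) ltac:(apply Rmin_glb_lt; lra)). intros s Hs'. 
      apply Rabs_def2 in Hs'. simpl in Hs'. unfold minus, plus, opp in Hs'; simpl in Hs'.
      pose proof (Rmin_l d3 1). pose proof (Rmin_r d3 1).
      change (Rabs (phi s - phi 1) < eps). unfold phi at 2. rewrite Rmin_left by lra.
      replace (RtoC 1 * z)%C with z by ring. unfold phi. apply H3.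
      * apply Hsh. split; [apply Rmin_glb; lra|apply Rmin_r].
      * rewrite Hdist. unfold Rmin. destruct (Rle_dec s 1); apply Rabs_def1; lra.
  - rewrite Rmin_left, Rmax_right in Hc by lra. unfold phi in Ec. rewrite !Rmin_left in Ec by lra.
    replace (RtoC 1 * z)%C with z in Ec by ring.
    assert (Eq : (u (RtoC (1 + - t) * z)%C - u z) / - t = G (RtoC c * z)%C).
    { change (1 + - t) with (1 - t). replace (u (RtoC (1 - t) * z)%C - u z) with (- (G (RtoC c * z)%C * (1 - (1 - t)))) by lra.
      field. lra. }
    rewrite Eq in H2.
    assert (Hc1 : Rabs (G (RtoC c * z)%C - G z) < Rabs (l - G z) / 2).
    { apply H1; [apply Hsh; lra|]. rewrite Hdist. apply Rabs_def1; lra. }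
    pose proof (Rabs_triang (l - G (RtoC c * z)%C) (G (RtoC c * z)%C - G z)) as T.
    replace (l - G (RtoC c * z)%C + (G (RtoC c * z)%C - G z)) with (l - G z) in T by ring.
    rewrite (Rabs_minus_sym l (G (RtoC c * z)%C)) in T. lra.
Qed.

(** * Classification of solutions *)

Lemma smooth_continuity_2d (u : C -> R) (w : list axis) (x y : R) :
  smooth_up_to_boundary u -> disk (x, y) -> continuity_2d_pt (fun s t => partials w u (s, t)) x y.
Proof.
  intros [_ H] Hz. destruct (proj2 (H w)) as [g [Cg Eg]]. intros eps.
  destruct (continuous_on_eps _ _ (x, y) eps Cg ltac:(unfold disk, closed_disk in *; lra) (cond_pos eps)) as [d [Hd H1]].
  pose proof (locally_2d_disk x y (fun z => disk z) Hz (fun z h => h)) as [d2 H2].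
  assert (Hm : 0 < Rmin (d / 2) d2) by (apply Rmin_glb_lt; [lra|apply cond_pos]).
  exists (mkposreal _ Hm). simpl. intros s t hs ht.
  apply Rmin_Rgt_l in hs. apply Rmin_Rgt_l in ht.
  assert (Hst : disk (s, t)) by (apply H2; lra).
  rewrite !Eg by auto. apply H1; [unfold disk, closed_disk in *; lra|].
  replace d with (2 * (d / 2)) by field. apply Cmod_square_bound; lra.
Qed.

(** Smoothness is stated through partial derivatives along the axes; those of the next order are
    continuous in the disk, which upgrades existence to total differentiability. *)
Lemma smooth_has_gradient (u : C -> R) (w : list axis) :
  smooth_up_to_boundary u ->
  has_gradient (partials w u) (partials (X_axis :: w) u) (partials (Y_axis :: w) u).
Proof.
  intros Hu x y Hz. destruct (proj2 Hu w) as [Hex _].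
  apply (differentiable_of_partials (fun s t => partials w u (s, t))
    (fun s t => partials (X_axis :: w) u (s, t)) (fun s t => partials (Y_axis :: w) u (s, t))).
  - apply (locally_2d_disk x y (fun z => is_derive (fun t => partials w u (t, snd z)) (fst z) (partials (X_axis :: w) u z)) Hz).
    intros z h. apply Derive_correct. exact (Hex X_axis z h).
  - apply (locally_2d_disk x y (fun z => is_derive (fun t => partials w u (fst z, t)) (snd z) (partials (Y_axis :: w) u z)) Hz).
    intros z h. apply Derive_correct. exact (Hex Y_axis z h).
  - now apply smooth_continuity_2d.
  - now apply smooth_continuity_2d.
Qed.

Lemma smooth_schwarz (u : C -> R) (w : list axis) (z : C) :
  smooth_up_to_boundary u -> disk z ->
  partials (Y_axis :: X_axis :: w) u z = partials (X_axis :: Y_axis :: w) u z.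
Proof.
  intros Hu. apply (has_gradient_schwarz (partials w u) (partials (X_axis :: w) u) (partials (Y_axis :: w) u)
    (partials (X_axis :: X_axis :: w) u) _ _ (partials (Y_axis :: Y_axis :: w) u));
    try now apply smooth_has_gradient.
  - intros x y. now apply smooth_continuity_2d.
  - intros x y. now apply smooth_continuity_2d.
Qed.

Lemma has_gradient_value (f fx fy gx gy : C -> R) :
  has_gradient f fx fy -> (forall z, disk z -> fx z = gx z) -> (forall z, disk z -> fy z = gy z) ->
  has_gradient f gx gy.
Proof. intros H Ex Ey. now apply (has_gradient_ext f f fx fy gx gy). Qed.

Ltac solve_gradient :=
  repeat first [eassumption | apply has_gradient_plus | apply has_gradient_mult | apply has_gradient_exp
    | apply has_gradient_fst | apply has_gradient_snd | apply has_gradient_const].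

(* With [E = x dx + y dy] and [T = x dy - y dx], the imaginary part of
   [4 z^2 (u_zz - u_z^2)] is [-2 (T F - F (T u))], where [F = E u - e^u + 1]
   vanishes on the circle by the boundary condition. *)
Lemma solution_hopf_differential (u : C -> R) :
  is_solution u -> forall z, disk z ->
  partials (X_axis :: X_axis :: nil) u z - partials (X_axis :: nil) u z ^ 2 =
    partials (Y_axis :: Y_axis :: nil) u z - partials (Y_axis :: nil) u z ^ 2 /\
  partials (X_axis :: Y_axis :: nil) u z = partials (X_axis :: nil) u z * partials (Y_axis :: nil) u z.
Proof.
  intros (Hs & Hpde & Hbd).
  set (a := partials (X_axis :: nil) u). set (b := partials (Y_axis :: nil) u).
  set (p := partials (X_axis :: X_axis :: nil) u). set (s := partials (X_axis :: Y_axis :: nil) u).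
  set (t := partials (Y_axis :: Y_axis :: nil) u).
  assert (Gu : has_gradient u a b) by exact (smooth_has_gradient u nil Hs).
  assert (Ga : has_gradient a p s).
  { apply (has_gradient_ext a a p (partials (Y_axis :: X_axis :: nil) u) p s); auto.
    - intros z Hz. now apply (smooth_schwarz u nil).
    - exact (smooth_has_gradient u (X_axis :: nil) Hs). }
  assert (Gb : has_gradient b s t) by exact (smooth_has_gradient u (Y_axis :: nil) Hs).
  set (p1 := partials (X_axis :: X_axis :: X_axis :: nil) u).
  set (s1 := partials (X_axis :: X_axis :: Y_axis :: nil) u).
  set (s2 := partials (Y_axis :: X_axis :: Y_axis :: nil) u).
  set (t2 := partials (Y_axis :: Y_axis :: Y_axis :: nil) u).
  assert (Gs : has_gradient s s1 s2) by exact (smooth_has_gradient u (X_axis :: Y_axis :: nil) Hs).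
  assert (Gp : has_gradient p p1 s1).
  { pose proof (smooth_has_gradient u (X_axis :: X_axis :: nil) Hs) as H.
    apply (has_gradient_ext p p p1 (partials (Y_axis :: X_axis :: X_axis :: nil) u) p1 s1); auto.
    apply (has_gradient_schwarz a p s p1 _ _ s2); auto.
    - intros x y. now apply smooth_continuity_2d.
    - intros x y. now apply smooth_continuity_2d. }
  assert (Gt : has_gradient t s2 t2).
  { pose proof (smooth_has_gradient u (Y_axis :: Y_axis :: nil) Hs) as H.
    apply (has_gradient_ext t t (partials (X_axis :: Y_axis :: Y_axis :: nil) u) t2 s2 t2); auto.
    intros z Hz. symmetry. revert z Hz. apply (has_gradient_schwarz b s t s1 _ _ t2); auto.
    - intros x y. now apply smooth_continuity_2d.
    - intros x y. now apply smooth_continuity_2d. }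
  assert (Epde : forall z, disk z -> p z + t z = -1 * exp (2 * u z)).
  { intros z Hz. specialize (Hpde z Hz). unfold laplacian in Hpde.
    change (- (p z + t z) = exp (2 * u z)) in Hpde. lra. }
  (* The differentiated equation, with [exp (2 u)] eliminated: the gradient of [laplacian u] is
     [2 * laplacian u] times the gradient of [u]. *)
  assert (Edp : forall z, disk z -> p1 z + s2 z = 2 * a z * (p z + t z) /\ s1 z + t2 z = 2 * b z * (p z + t z)).
  { intros z Hz.
    assert (G1 : has_gradient (fun z => -1 * exp (2 * u z)) (fun z => p1 z + s2 z) (fun z => s1 z + t2 z)).
    { apply (has_gradient_ext (fun z => p z + t z) _ (fun z => p1 z + s2 z) (fun z => s1 z + t2 z)); auto.
      solve_gradient. }
    assert (G2 : has_gradient (fun z => -1 * exp (2 * u z))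
      (fun z => 0 * exp (2 * u z) + -1 * (exp (2 * u z) * (0 * u z + 2 * a z)))
      (fun z => 0 * exp (2 * u z) + -1 * (exp (2 * u z) * (0 * u z + 2 * b z)))).
    { apply (has_gradient_mult (fun _ => -1) (fun z => exp (2 * u z))); [apply has_gradient_const|].
      apply (has_gradient_exp (fun z => 2 * u z)).
      apply (has_gradient_mult (fun _ => 2) u); [apply has_gradient_const|exact Gu]. }
    destruct (has_gradient_unique _ _ _ _ _ G1 G2 z Hz) as [-> ->]. rewrite !Epde by auto. split; ring. }
  (* [P - i Q] is [4 (u_zz - u_z^2)]. Its Cauchy-Riemann equations are [GP] and [GQ], the latter
     resting on the differentiated equation. *)
  set (P := fun z => p z + -1 * t z + -1 * (a z * a z) + b z * b z).
  set (Q := fun z => 2 * s z + -2 * (a z * b z)).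
  set (Px := fun z => p1 z - s2 z - 2 * a z * p z + 2 * b z * s z).
  set (Py := fun z => s1 z - t2 z - 2 * a z * s z + 2 * b z * t z).
  assert (GP : has_gradient P Px Py).
  { unfold P. eapply has_gradient_value; [solve_gradient| |];
      intros z Hz; unfold Px, Py; simpl; ring. }
  assert (GQ : has_gradient Q Py (fun z => - Px z)).
  { unfold Q. eapply has_gradient_value; [solve_gradient| |];
      intros z Hz; destruct (Edp z Hz) as [E1 E2]; unfold Px, Py; simpl; lra. }
  (* [ph] and [wh] are the real and imaginary parts of [z^2 (P - i Q)]. *)
  set (ph := fun z => (fst z * fst z + -1 * (snd z * snd z)) * P z + 2 * (fst z * snd z) * Q z).
  set (wh := fun z => 2 * (fst z * snd z) * P z + -1 * ((fst z * fst z + -1 * (snd z * snd z)) * Q z)).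
  set (wx := fun z => 2 * snd z * P z - 2 * fst z * Q z + 2 * fst z * snd z * Px z - (fst z ^ 2 - snd z ^ 2) * Py z).
  set (wy := fun z => 2 * fst z * P z + 2 * snd z * Q z + 2 * fst z * snd z * Py z + (fst z ^ 2 - snd z ^ 2) * Px z).
  assert (Gw : has_gradient wh wx wy).
  { unfold wh. eapply has_gradient_value; [solve_gradient| |];
      intros z Hz; unfold wx, wy; simpl; ring. }
  assert (Gph : has_gradient ph wy (fun z => - wx z)).
  { unfold ph. eapply has_gradient_value; [solve_gradient| |];
      intros z Hz; unfold wx, wy; simpl; ring. }
  destruct Hs as [Cu Hs'].
  destruct (proj2 (Hs' (X_axis :: nil))) as [ga [Ca Ea]]. destruct (proj2 (Hs' (Y_axis :: nil))) as [gb [Cb Eb]].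
  destruct (proj2 (Hs' (X_axis :: X_axis :: nil))) as [gp [Cp Ep]].
  destruct (proj2 (Hs' (X_axis :: Y_axis :: nil))) as [gs [Cs Es]].
  destruct (proj2 (Hs' (Y_axis :: Y_axis :: nil))) as [gt [Ct Et]].
  fold a in Ea. fold b in Eb. fold p in Ep. fold s in Es. fold t in Et.
  (* [F], [Fx], [Fy] are built from the continuous extensions, so they make sense on the circle;
     inside they are [E u - e^u + 1] and its partial derivatives. *)
  set (F := fun z => fst z * ga z + snd z * gb z + -1 * exp (u z) + 1).
  set (Fx := fun z => ga z + fst z * gp z + snd z * gs z + -1 * (exp (u z) * ga z)).
  set (Fy := fun z => fst z * gs z + gb z + snd z * gt z + -1 * (exp (u z) * gb z)).
  assert (CF : continuous_on closed_disk F) by (unfold F; solve_continuous_on).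
  assert (CFx : continuous_on closed_disk Fx) by (unfold Fx; solve_continuous_on).
  assert (CFy : continuous_on closed_disk Fy) by (unfold Fy; solve_continuous_on).
  assert (F0 : forall z, circle z -> F z = 0).
  { intros z Hz. destruct (Hbd z Hz) as [l [Hl El]].
    rewrite (normal_derivative_value u a b ga gb z l Gu Cu Ca Cb
      (fun w h => eq_sym (Ea w h)) (fun w h => eq_sym (Eb w h)) Hz Hl) in El.
    unfold F. lra. }
  assert (TF0 : forall z, circle z -> fst z * Fy z - snd z * Fx z = 0).
  { set (f := fun z => fst z * a z + snd z * b z + -1 * exp (u z) + 1).
    set (fx := fun z => a z + fst z * p z + snd z * s z + -1 * (exp (u z) * a z)).
    set (fy := fun z => fst z * s z + b z + snd z * t z + -1 * (exp (u z) * b z)).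
    assert (Gf : has_gradient f fx fy).
    { unfold f. eapply has_gradient_value; [solve_gradient| |];
        intros z Hz; unfold fx, fy; simpl; ring. }
    apply (tangential_derivative_zero f fx fy F Fx Fy Gf CF CFx CFy); auto;
      intros z Hz; unfold F, f, Fx, fx, Fy, fy; now rewrite ?Ea, ?Eb, ?Ep, ?Es, ?Et. }
  set (W := fun z => -2 * (fst z * Fy z + -1 * (snd z * Fx z) + -1 * (F z * (fst z * gb z + -1 * (snd z * ga z))))).
  assert (w0 : forall z, disk z -> wh z = 0).
  { apply (harmonic_zero wh (fun z => - ph z) W).
    - intros x y Hz. exists (wx (x, y)), (wy (x, y)). split; [now apply Gw|].
      replace (wx (x, y)) with (- - wx (x, y)) by ring. apply differentiable_opp. now apply Gph.
    - unfold W. solve_continuous_on.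
    - intros z Hz. unfold W, F, Fx, Fy, wh, P, Q. rewrite <- Ea, <- Eb, <- Ep, <- Es, <- Et by auto. ring.
    - intros z Hz. unfold W. rewrite F0 by auto. specialize (TF0 z Hz). nra. }
  assert (wg0 : forall z, disk z -> wx z = 0 /\ wy z = 0).
  { apply (has_gradient_unique wh); [exact Gw|].
    apply (has_gradient_ext (fun _ => 0) _ (fun _ => 0) (fun _ => 0)); auto.
    - intros z Hz. now rewrite w0.
    - apply has_gradient_const. }
  assert (p0 : forall z, disk z -> ph z = 0).
  { intros z Hz. rewrite (has_gradient_zero_constant ph); [unfold ph; simpl; ring| |exact Hz].
    apply (has_gradient_ext ph ph wy (fun z => - wx z)); auto.
    - intros w hw. apply (wg0 w hw).
    - intros w hw. destruct (wg0 w hw) as [-> _]. ring. }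
  assert (PQ : forall z, disk z -> fst z ^ 2 + snd z ^ 2 <> 0 -> P z = 0 /\ Q z = 0).
  { intros z Hz Hn. specialize (w0 z Hz). specialize (p0 z Hz). unfold wh in w0. unfold ph in p0.
    (* Multiplying [ph + i wh] by the square of the conjugate of [z] gives [|z|^4 (P - i Q)]. *)
    assert (Hn2 : (fst z ^ 2 + snd z ^ 2) ^ 2 <> 0) by now apply pow_nonzero.
    split; apply Rmult_eq_reg_l with ((fst z ^ 2 + snd z ^ 2) ^ 2); auto; rewrite Rmult_0_r.
    - transitivity ((fst z ^ 2 - snd z ^ 2) * ((fst z * fst z + -1 * (snd z * snd z)) * P z + 2 * (fst z * snd z) * Q z)
        + 2 * (fst z * snd z) * (2 * (fst z * snd z) * P z + -1 * ((fst z * fst z + -1 * (snd z * snd z)) * Q z))).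
      + ring.
      + rewrite w0, p0. ring.
    - transitivity (2 * (fst z * snd z) * ((fst z * fst z + -1 * (snd z * snd z)) * P z + 2 * (fst z * snd z) * Q z)
        - (fst z ^ 2 - snd z ^ 2) * (2 * (fst z * snd z) * P z + -1 * ((fst z * fst z + -1 * (snd z * snd z)) * Q z))).
      + ring.
      + rewrite w0, p0. ring. }
  assert (D0 : disk (0, 0)) by (unfold disk; replace (0, 0) with (RtoC 0) by reflexivity; rewrite Cmod_0; lra).
  (* The factor [z^2] gives no information at 0, so the vanishing of [P] and [Q] there comes from
     continuity. *)
  assert (Origin : forall f fx fy : C -> R, has_gradient f fx fy ->
    (forall z, disk z -> fst z ^ 2 + snd z ^ 2 <> 0 -> f z = 0) -> f (0, 0) = 0).
  { intros f fx fy Hf H. destruct (Req_dec (f (0, 0)) 0) as [|Hn]; [auto|exfalso].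
    apply Rabs_pos_lt in Hn.
    destruct (has_gradient_continuity f fx fy 0 0 Hf D0 (mkposreal _ Hn)) as [d Hd].
    set (h := Rmin (d / 2) (1 / 2)). pose proof (cond_pos d).
    assert (Hh : 0 < h /\ h < d /\ h < 1).
    { unfold h. pose proof (Rmin_l (d / 2) (1 / 2)). pose proof (Rmin_r (d / 2) (1 / 2)).
      split; [apply Rmin_glb_lt; lra|lra]. }
    specialize (Hd h 0). rewrite H in Hd.
    - assert (Hlt : Rabs (0 - f (0, 0)) < Rabs (f (0, 0))).
      { apply Hd; [rewrite Rminus_0_r, Rabs_pos_eq; lra|rewrite Rminus_eq_0, Rabs_R0; lra]. }
      rewrite Rminus_0_l, Rabs_Ropp in Hlt. lra.
    - unfold disk. replace (h, 0) with (RtoC h) by reflexivity. rewrite Cmod_R, Rabs_pos_eq; lra.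
    - simpl. nra. }
  intros z Hz.
  assert (HPQ : P z = 0 /\ Q z = 0).
  { destruct (Req_dec (fst z ^ 2 + snd z ^ 2) 0) as [E0|E0]; [|now apply PQ].
    assert (fst z = 0) by nra. assert (snd z = 0) by nra.
    replace z with (0, 0) by (rewrite (surjective_pairing z); now f_equal).
    split; [apply (Origin P _ _ GP)|apply (Origin Q _ _ GQ)]; intros; now apply PQ. }
  destruct HPQ as [HP HQ]. unfold P in HP. unfold Q in HQ. split; [nra|lra].
Qed.

Lemma has_gradient_constant_gradient (f : C -> R) (p q : R) :
  has_gradient f (fun _ => p) (fun _ => q) -> forall z, disk z -> f z = p * fst z + q * snd z + f (0, 0).
Proof.
  intros H z Hz.
  assert (G : has_gradient (fun z => f z + (- p * fst z + - q * snd z)) (fun _ => 0) (fun _ => 0)).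
  { eapply has_gradient_value; [solve_gradient| |]; intros w hw; simpl; ring. }
  pose proof (has_gradient_zero_constant _ G z Hz) as E. simpl in E. lra.
Qed.

Lemma solution_quadric (u : Complex.C -> R) :
  is_solution u -> exists A B C D, 0 < A /\ D - A = 1 /\ 4 * A * D = 1 + B ^ 2 + C ^ 2 /\
    forall z, closed_disk z -> u z = - ln (quadric A B C D z).
Proof.
  intros Hsol. pose proof (solution_hopf_differential u Hsol) as Hopf.
  destruct Hsol as (Hs & Hpde & Hbd).
  set (a := partials (X_axis :: nil) u) in *. set (b := partials (Y_axis :: nil) u) in *.
  set (p := partials (X_axis :: X_axis :: nil) u) in *. set (s := partials (X_axis :: Y_axis :: nil) u) in *.
  set (t := partials (Y_axis :: Y_axis :: nil) u) in *.
  assert (Gu : has_gradient u a b) by exact (smooth_has_gradient u nil Hs).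
  assert (Ga : has_gradient a p s).
  { apply (has_gradient_value a p (partials (Y_axis :: X_axis :: nil) u)); auto.
    - exact (smooth_has_gradient u (X_axis :: nil) Hs).
    - intros z Hz. now apply (smooth_schwarz u nil). }
  assert (Gb : has_gradient b s t) by exact (smooth_has_gradient u (Y_axis :: nil) Hs).
  set (t2 := partials (Y_axis :: Y_axis :: Y_axis :: nil) u).
  (* Since [s = a b], the derivatives of [s] reduce to second-order quantities, which allows the
     mixed third derivatives below to cancel. *)
  assert (Gs : has_gradient s (fun z => p z * b z + a z * s z) (fun z => s z * b z + a z * t z)).
  { apply (has_gradient_ext (fun z => a z * b z) s (fun z => p z * b z + a z * s z) (fun z => s z * b z + a z * t z)); auto.
    - intros z Hz. symmetry. now apply Hopf.
    - solve_gradient. }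
  set (v := fun z => exp (-1 * u z)).
  assert (Gv : has_gradient v (fun z => - a z * v z) (fun z => - b z * v z)).
  { unfold v. eapply has_gradient_value; [solve_gradient| |]; intros z Hz; simpl; ring. }
  (* [k] is [v_xx]. The two Hopf relations say that [v_yy] is the same function and that
     [v_xy = 0]. *)
  set (k := fun z => (a z * a z + -1 * p z) * v z).
  assert (Gvx : has_gradient (fun z => -1 * (a z * v z)) k (fun _ => 0)).
  { eapply has_gradient_value; [solve_gradient| |]; intros z Hz; unfold k; simpl; [ring|].
    rewrite (proj2 (Hopf z Hz)). ring. }
  assert (Gvy : has_gradient (fun z => -1 * (b z * v z)) (fun _ => 0) k).
  { eapply has_gradient_value; [solve_gradient| |]; intros z Hz; unfold k; simpl.
    - rewrite (proj2 (Hopf z Hz)). ring.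
    - replace (a z * a z + -1 * p z) with (b z * b z + -1 * t z) by (destruct (Hopf z Hz); lra). ring. }
  (* The mixed third derivatives of [v] vanish: [k_y = (v_xy)_x] and [k_x = (v_xy)_y]. *)
  assert (Gk : has_gradient k (fun _ => 0) (fun _ => 0)).
  { pose proof (smooth_has_gradient u (X_axis :: X_axis :: nil) Hs) as Gp.
    pose proof (smooth_has_gradient u (Y_axis :: Y_axis :: nil) Hs) as Gt. fold p in Gp. fold t in Gt.
    assert (G1 : exists k1, has_gradient k k1 (fun _ => 0)).
    { eexists. unfold k. eapply has_gradient_value; [solve_gradient|intros z Hz; reflexivity|].
      intros z Hz. simpl.
      assert (E : partials (Y_axis :: X_axis :: X_axis :: nil) u z = p z * b z + a z * s z).
      { revert z Hz. apply (has_gradient_schwarz a p s (partials (X_axis :: X_axis :: X_axis :: nil) u)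
          _ _ (fun z => s z * b z + a z * t z)); auto.
        - intros x y. now apply smooth_continuity_2d.
        - intros x y Hz. apply (continuity_2d_pt_plus (fun u v => p (u, v) * b (u, v)) (fun u v => a (u, v) * s (u, v)));
            apply continuity_2d_pt_mult; now apply smooth_continuity_2d. }
      change (partial Y_axis (partial X_axis (partial X_axis u)) z) with (partials (Y_axis :: X_axis :: X_axis :: nil) u z).
      rewrite E, (proj2 (Hopf z Hz)). ring. }
    assert (G2 : exists k2, has_gradient k (fun _ => 0) k2).
    { eexists. apply (has_gradient_ext (fun z => (b z * b z + -1 * t z) * v z) k
        (fun z => (2 * b z * s z - partials (X_axis :: Y_axis :: Y_axis :: nil) u z) * v z - (b z * b z - t z) * a z * v z)
        (fun z => (2 * b z * t z - t2 z) * v z - (b z * b z - t z) * b z * v z)).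
      - intros z Hz. unfold k. destruct (Hopf z Hz) as [E _]. f_equal. lra.
      - intros z Hz.
        assert (E : s z * b z + a z * t z = partials (X_axis :: Y_axis :: Y_axis :: nil) u z).
        { revert z Hz. apply (has_gradient_schwarz b s t (fun z => p z * b z + a z * s z)
            _ _ (partials (Y_axis :: Y_axis :: Y_axis :: nil) u)); auto.
          - intros x y Hz. apply (continuity_2d_pt_plus (fun u v => s (u, v) * b (u, v)) (fun u v => a (u, v) * t (u, v)));
              apply continuity_2d_pt_mult; now apply smooth_continuity_2d.
          - intros x y. now apply smooth_continuity_2d. }
        rewrite <- E, (proj2 (Hopf z Hz)). ring.
      - reflexivity.
      - eapply has_gradient_value; [solve_gradient| |]; intros z Hz; unfold t2; simpl; ring. }
    destruct G1 as [k1 G1]. destruct G2 as [k2 G2].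
    apply (has_gradient_value k k1 (fun _ => 0)); auto.
    intros z Hz. apply (has_gradient_unique _ _ _ _ _ G1 G2 z Hz). }
  assert (D0 : disk (0, 0)) by (unfold disk; replace (0, 0) with (RtoC 0) by reflexivity; rewrite Cmod_0; lra).
  set (A := k (0, 0) / 2). set (B := -1 * (a (0, 0) * v (0, 0))). set (C := -1 * (b (0, 0) * v (0, 0))). set (D := v (0, 0)).
  assert (Ek : forall z, disk z -> k z = 2 * A).
  { intros z Hz. rewrite (has_gradient_zero_constant k Gk z Hz). unfold A. field. }
  assert (Ea : forall z, disk z -> -1 * (a z * v z) = 2 * A * fst z + B).
  { intros z Hz. rewrite (has_gradient_constant_gradient (fun z => -1 * (a z * v z)) (2 * A) 0).
    - unfold B. ring.
    - now apply (has_gradient_value _ k (fun _ => 0)).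
    - exact Hz. }
  assert (Eb : forall z, disk z -> -1 * (b z * v z) = 2 * A * snd z + C).
  { intros z Hz. rewrite (has_gradient_constant_gradient (fun z => -1 * (b z * v z)) 0 (2 * A)).
    - unfold C. ring.
    - now apply (has_gradient_value _ (fun _ => 0) k).
    - exact Hz. }
  assert (Ev : forall z, disk z -> v z = quadric A B C D z).
  { intros z Hz.
    assert (G : has_gradient (fun z => v z + - A * (fst z * fst z + snd z * snd z)) (fun _ => B) (fun _ => C)).
    { eapply has_gradient_value; [solve_gradient| |]; intros w hw; simpl.
      - specialize (Ea w hw). lra.
      - specialize (Eb w hw). lra. }
    pose proof (has_gradient_constant_gradient _ B C G z Hz) as E. simpl in E. unfold quadric. fold D in E. lra. }
  assert (HD : 0 < D) by apply exp_pos.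
  (* The equation at the origin multiplied by [D^2 = exp (- 2 u)]: since [2 A = v_xx = v_yy], the
     left side [- laplacian u * D^2] becomes [4 A D - B^2 - C^2]. *)
  assert (E4 : 4 * A * D = 1 + B ^ 2 + C ^ 2).
  { specialize (Hpde _ D0). change (- (p (0, 0) + t (0, 0)) = exp (2 * u (0, 0))) in Hpde.
    destruct (Hopf _ D0) as [H1 _].
    assert (Hv2 : exp (2 * u (0, 0)) * (D * D) = 1).
    { unfold D, v. rewrite <- !exp_plus. rewrite <- exp_0. f_equal. ring. }
    rewrite <- Hpde in Hv2. unfold A, k, B, C. fold D. nra. }
  assert (HA : 0 < A).
  { apply Rmult_lt_reg_r with (4 * D); [lra|]. pose proof (pow2_ge_0 B). pose proof (pow2_ge_0 C). lra. }
  destruct Hs as [Cu Hs'].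
  destruct (proj2 (Hs' (X_axis :: nil))) as [ga [Ca Ega]]. destruct (proj2 (Hs' (Y_axis :: nil))) as [gb [Cb Egb]].
  fold a in Ega. fold b in Egb.
  assert (EDA : D - A = 1).
  { assert (Hz1 : circle (1, 0)).
    { unfold circle. replace (1, 0) with (RtoC 1) by reflexivity. apply Cmod_1. }
    destruct (Hbd _ Hz1) as [l [Hl El]].
    rewrite (normal_derivative_value u a b ga gb _ l Gu Cu Ca Cb
      (fun w h => eq_sym (Ega w h)) (fun w h => eq_sym (Egb w h)) Hz1 Hl) in El.
    (* In the disk [e^{-u} (E u + 1) = D - A |z|^2], with [E] the radial field. At the boundary
       point 1 the left side is [e^{-u} e^u = 1], so a single point of the circle suffices. *)
    pose proof (continuous_on_closure_eq (fun z => v z * (fst z * ga z + snd z * gb z + 1))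
      (fun z => D + -1 * (A * (fst z * fst z + snd z * snd z)))) as E.
    specialize (E ltac:(unfold v; solve_continuous_on) ltac:(unfold v; solve_continuous_on)).
    assert (E' : closed_disk (1, 0)) by exact (Req_le _ _ Hz1).
    apply E in E'; clear E.
    + cbv beta in E'. rewrite El in E'. unfold v in E'. rewrite <- exp_plus in E'.
      replace (-1 * u (1, 0) + u (1, 0)) with 0 in E' by ring. rewrite exp_0 in E'. simpl in E'. lra.
    + intros z Hz. rewrite <- Ega, <- Egb by auto.
      specialize (Ea z Hz). specialize (Eb z Hz). specialize (Ev z Hz). unfold quadric in Ev.
      transitivity (fst z * (a z * v z) + snd z * (b z * v z) + v z); [ring|].
      replace (a z * v z) with (- (2 * A * fst z + B)) by lra.
      replace (b z * v z) with (- (2 * A * snd z + C)) by lra. rewrite Ev. ring. }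
  exists A, B, C, D. repeat split; auto.
  intros z Hz.
  assert (E : v z = quadric A B C D z).
  { apply (continuous_on_closure_eq v (quadric A B C D)); auto.
    - unfold v. solve_continuous_on.
    - unfold quadric. simpl. solve_continuous_on. }
  rewrite <- E. unfold v. rewrite ln_exp. ring.
Qed.

Theorem theorem1p3 :
  (forall u : C -> R, is_solution u ->
     exists psi : C -> C, disk_automorphism psi /\ given_by psi u) /\
  (forall psi : C -> C, disk_automorphism psi ->
     (exists u : C -> R, given_by psi u) /\
     (forall u : C -> R, given_by psi u -> is_solution u)) /\
  (forall psi1 psi2 : C -> C,
     disk_automorphism psi1 -> disk_automorphism psi2 ->
     (forall z : C, disk z -> bubble psi1 z = bubble psi2 z) ->
     exists theta : R, forall z : C, disk z ->
       psi2 z = ((cos theta, sin theta) * psi1 z)%C).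
Proof.
  split; [|split].
  - intros u Hu. destruct (solution_quadric u Hu) as (A & B & C & D & HA & HDA & H4 & E).
    destruct (quadric_is_mobius_quadric A B C D HA HDA H4) as [a [Ha Eq]].
    exists (mobius a). split; [now apply mobius_automorphism|].
    apply (given_by_mobius a (RtoC 1)); auto.
    + apply Cmod_1.
    + intros z _. ring.
    + intros z Hz. rewrite <- Eq. now apply E.
  - intros psi Hpsi. destruct (automorphism_mobius psi Hpsi) as (a & c & Ha & Hc & E).
    split.
    + exists (fun z => - ln (mobius_quadric a z)). now apply (given_by_mobius a c).
    + intros u Hu. destruct (mobius_quadric_coefficients a Ha) as (H1 & H2 & H3).
      apply (quadric_solution _ _ _ _ u H1 H2 H3). now apply (given_by_mobius a c psi).
  - intros psi1 psi2 H1 H2 Hb.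
    destruct (automorphism_mobius psi1 H1) as (a1 & c1 & Ha1 & Hc1 & E1).
    destruct (automorphism_mobius psi2 H2) as (a2 & c2 & Ha2 & Hc2 & E2).
    (* Inside the open disk [psi] and the rotated Mobius map agree near [z], so the bubble is
       computed without passing to an extension. *)
    assert (Hbub : forall a c psi z, disk a -> Cmod c = 1 -> (forall z, disk z -> psi z = (c * mobius a z)%C) ->
      disk z -> bubble psi z = - ln (mobius_quadric a z)).
    { intros a c psi z Ha Hc E Hz.
      assert (Hcd : closed_disk z) by (unfold disk, closed_disk in *; lra).
      apply bubble_mobius with c; auto.
      apply (is_C_derive_ext_loc (fun w => c * mobius a w)%C).
      - apply filter_imp with (2 := locally_Cmod_lt z 1 Hz). intros w Hw. now rewrite E.
      - now apply mobius_rotated_derive, mobius_den_closed_disk. }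
    assert (Ea : a1 = a2).
    { apply mobius_quadric_injective; auto. intros z Hz. specialize (Hb z Hz).
      rewrite (Hbub a1 c1 psi1 z), (Hbub a2 c2 psi2 z) in Hb by auto.
      apply ln_inv; try now apply mobius_quadric_pos. lra. }
    subst a2.
    assert (Hn : c1 <> RtoC 0) by (intros ->; rewrite Cmod_0 in Hc1; lra).
    destruct (unit_circle_angle (c2 / c1)%C) as [theta Et].
    { rewrite Cmod_div, Hc1, Hc2 by auto. field. }
    exists theta. intros z Hz. rewrite <- Et, E1, E2 by auto. field. exact Hn.
Qed.
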